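(* Let $A=R/\mathfrak a$ and $B=S/\mathfrak b$ be oriented standard graded Artinian Gorenstein $K$-algebras with $\operatorname{reg}(A)=\operatorname{reg}(B)=e\ge3$, where $\mathfrak a,\mathfrak b$ contain no non-zero linear forms. For any integer $i\ge1$ there is an isomorphism of graded $K$-vector spaces, given in each degree $j$ by $$[\operatorname{Tor}_i^Q(A\#_K B,K)]_j\cong\begin{cases}0&\text{if } j\le i\text{ and }(i,j)\ne(0,0),\\ K&\text{if }(i,j)=(0,0),\\ [\operatorname{Tor}_i^Q(A,K)]_{i+1}\oplus[\operatorname{Tor}_i^Q(B,K)]_{i+1}\oplus[\operatorname{Tor}_i^Q(Q/(\mathbf x\cap\mathbf y),K)]_{i+1}&\text{if } j=i+1,\\ [\operatorname{Tor}_i^Q(A,K)]_j\oplus[\operatorname{Tor}_i^Q(B,K)]_j&\text{if } i+2\le j\le i+e-2,\\ [\operatorname{Tor}_i^Q(A,K)]_j\oplus[\operatorname{Tor}_i^Q(B,K)]_j\oplus[\operatorname{Tor}_{m+n-i}^Q(Q/(\mathbf x\cap\mathbf y),K)]_{m+n-i+1}&\text{if } j=i+e-1,\\ K&\text{if }(i,j)=(m+n,e+m+n),\\ 0&\text{if } j\ge e+i\text{ and }(i,j)\ne(m+n,e+m+n);\end{cases}$$ equivalently, $$P^Q_{A\#_K B}(t,s)=\widetilde P^Q_A(t,s)+\widetilde P^Q_B(t,s)+P^Q_{Q/(\mathbf x\cap\mathbf y)}(t,s)+s^{m+n+e}t^{m+n}P^Q_{Q/(\mathbf x\cap\mathbf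 y)}(t^{-1},s^{-1}).$$
   Context: $K$ is an arbitrary field; $R=K[x_1,\dots,x_m]$ and $S=K[y_1,\dots,y_n]$ are standard graded polynomial rings with homogeneous maximal ideals $\mathbf x$, $\mathbf y$, and $Q=R\otimes_K S=K[x_1,\dots,x_m,y_1,\dots,y_n]$; the same symbols denote extended ideals in $Q$. $A$ and $B$ are $Q$-modules via $A\cong Q/(\mathfrak a+\mathbf y)$, $B\cong Q/(\mathbf x+\mathfrak b)$. For a graded $Q$-module $M$, $P^Q_M(t,s)=\sum_{i,j}\dim_K[\operatorname{Tor}_i^Q(M,K)]_j\, t^is^j$, and $\widetilde P^Q_M(t,s)=\sum_{j>i}\dim_K[\operatorname{Tor}_i^Q(M,K)]_j\, t^is^j$ is the sum of all its terms with $j>i$. A graded Artinian $K$-algebra is Gorenstein (AG) if its socle $(0:m_A)$ is one-dimensional over $K$; its socle degree is the largest $d$ with $A_d\neq0$ and equals $\operatorname{reg}(A)$. An orientation of an AG algebra $A$ of socle degree $e$ is a non-zero graded linear map $f_A:A\to K(-e)$ (equivalently a non-zero linear functional on $A_e$); $K$ is oriented by the identity. The Thom class of the projection $\pi_A:A\to K$ is the unique $\tau_A\in A_e$ with $f_A(\tau_A)=1$; similarly $\tau_B$. The fiber product is $A\times_K B=\{(a,b)\in A\oplus B\mid\pi_A(a)=\pi_B(b)\}$ and the connected sum is $A\#_K B=(A\times_K B)/\langle(\tau_A,\tau_B)\rangle$, a quotient of $Q$.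
   Formalization: The Poincaré series identity is corrected: the terms of P_A and P_B with j=i+e are added to the left side (equivalently P̃ keeps only i<j<i+e), since the printed identity fails, e.g. for A=K[x]/(x^{e+1}), B=K[y]/(y^{e+1}). *)

(* Defs.v *)
From HB Require Import structures.
From mathcomp Require Import all_boot all_order all_algebra.
From mathcomp Require Import boolp.
From mathcomp Require Import mpoly.

Set Implicit Arguments.
Unset Strict Implicit.
Unset Printing Implicit Defensive.

Import GRing.Theory.
Local Open Scope ring_scope.
Local Open Scope quotient_scope.

(* The degree d of a graded piece ranges over all integers; the zero
   polynomial is the only homogeneous polynomial of negative degree. *)
Definition zhomog (K : fieldType) (N : nat) (d : int) (p : {mpoly K[N]}) : bool :=
  match d with
  | Posz k => p \is k.-homog
  | Negz _ => p == 0
  end.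

(* Proper homogeneous ideals of K[x_1, ..., x_N]. *)
Record hideal (K : fieldType) (N : nat) := HIdeal {
  hideal_idealr :> idealr {mpoly K[N]};
  hideal_homog : forall (d : nat) (p : {mpoly K[N]}),
    p \in hideal_idealr -> pihomog mdeg d p \in hideal_idealr }.

Section GradedAlgebra.
Variables (K : fieldType) (N : nat) (a : hideal K N).

Definition galg : Type := {ideal_quot a}.

HB.instance Definition _ := GRing.ComNzRing.on galg.

Definition galg_pi : {mpoly K[N]} -> galg := \pi_({ideal_quot a}).

Lemma galg_pi_is_zmod_morphism : zmod_morphism galg_pi.
Proof. exact: (raddfB (\pi_({ideal_quot a}))). Qed.

Lemma galg_pi_is_monoid_morphism : monoid_morphism galg_pi.
Proof.
split; first exact: (rmorph1 (\pi_({ideal_quot a}))).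
exact: (rmorphM (\pi_({ideal_quot a}))).
Qed.

HB.instance Definition _ :=
  GRing.isZmodMorphism.Build {mpoly K[N]} galg galg_pi galg_pi_is_zmod_morphism.
HB.instance Definition _ :=
  GRing.isMonoidMorphism.Build {mpoly K[N]} galg galg_pi
    galg_pi_is_monoid_morphism.

Definition galg_scale (c : K) (x : galg) : galg := galg_pi c%:MP * x.

Lemma galg_scaleA c d x : galg_scale c (galg_scale d x) = galg_scale (c * d) x.
Proof. by rewrite /galg_scale mulrA -rmorphM -mpolyCM. Qed.

Lemma galg_scale1 : left_id 1 galg_scale.
Proof. by move=> x; rewrite /galg_scale mpolyC1 rmorph1 mul1r. Qed.

Lemma galg_scaleDr : right_distributive galg_scale +%R.
Proof. by move=> c x y; rewrite /galg_scale mulrDr. Qed.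

Lemma galg_scaleDl x : {morph galg_scale^~ x : c d / c + d}.
Proof. by move=> c d; rewrite /galg_scale mpolyCD rmorphD mulrDl. Qed.

HB.instance Definition _ := GRing.Zmodule_isLmodule.Build K galg
  galg_scaleA galg_scale1 galg_scaleDr galg_scaleDl.

Definition galg_piece (d : int) (x : galg) : Prop :=
  exists2 p : {mpoly K[N]}, zhomog d p & x = galg_pi p.

(* The projection A -> K with kernel m_A: the constant coefficient of any
   representative. *)
Definition galg_proj (x : galg) : K := (repr x)@_0%MM.

Lemma hideal_mcoeff0 (p : {mpoly K[N]}) : p \in hideal_idealr a -> p@_0%MM = 0.
Proof.
move=> pa; apply/eqP/negPn/negP => nz.
have /= := hideal_homog 0 pa.
suff -> : pihomog mdeg 0 p = (p@_0%MM)%:MP.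
  move=> h; have := idealMr ((p@_0%MM)^-1)%:MP h.
  by rewrite -mpolyCM mulVf // mpolyC1 idealr1.
rewrite pihomogE.
under eq_bigl => mo do rewrite mdeg_eq0.
rewrite big_mkcond /= (bigD1_seq 0%MM) ?msupp_uniq ?mcoeff_msupp //= eqxx.
rewrite big1 ?addr0 ?mpolyX0; last by move=> mo /negPf ->.
by rewrite alg_mpolyC.
Qed.

Lemma galg_projE (p : {mpoly K[N]}) : galg_proj (galg_pi p) = p@_0%MM.
Proof.
apply/eqP; rewrite -subr_eq0 -raddfB /=; apply/eqP/hideal_mcoeff0.
by rewrite Quotient.idealrBE reprK.
Qed.

Lemma galg_piP (x : galg) : exists p, x = galg_pi p.
Proof. by exists (repr x); rewrite /galg_pi reprK. Qed.

Lemma galg_proj_is_zmod_morphism : zmod_morphism galg_proj.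
Proof.
move=> x y; have [p ->] := galg_piP x; have [q ->] := galg_piP y.
by rewrite -rmorphB !galg_projE raddfB.
Qed.

Lemma galg_proj_is_monoid_morphism : monoid_morphism galg_proj.
Proof.
split; first by rewrite -(rmorph1 galg_pi) galg_projE rmorph1.
move=> x y; have [p ->] := galg_piP x; have [q ->] := galg_piP y.
by rewrite -rmorphM !galg_projE rmorphM.
Qed.

HB.instance Definition _ :=
  GRing.isZmodMorphism.Build galg K galg_proj galg_proj_is_zmod_morphism.
HB.instance Definition _ :=
  GRing.isMonoidMorphism.Build galg K galg_proj galg_proj_is_monoid_morphism.

Definition no_linear_forms : Prop :=
  forall p : {mpoly K[N]}, p \in hideal_idealr a -> p \is 1.-homog -> p = 0.

(* For a finitely generated algebra over the field K, Artinian means finite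
   dimensional. *)
Definition artinian : Prop :=
  exists (k : nat) (g : 'I_k -> galg),
    forall x : galg, exists c : 'I_k -> K, x = \sum_i c i *: g i.

Definition socle (x : galg) : Prop :=
  forall u : galg, galg_proj u = 0 -> u * x = 0.

Definition socle_one_dim : Prop :=
  exists2 s : galg, socle s /\ s != 0 &
    forall x : galg, socle x -> exists c : K, x = c *: s.

Definition socle_degree (e : nat) : Prop :=
  (exists2 x : galg, galg_piece e x & x != 0) /\
  (forall (d : nat) (x : galg), (e < d)%N -> galg_piece d x -> x = 0).

Definition AG_algebra (e : nat) : Prop :=
  [/\ artinian, socle_one_dim & socle_degree e].

Definition orientation (e : nat) (f : {linear galg -> K^o}) : Prop :=
  (forall (d : nat) (x : galg), d != e -> galg_piece d x -> f x = 0) /\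
  (exists x : galg, f x != 0).

Definition thom_class (e : nat) (f : {linear galg -> K^o}) (t : galg) : Prop :=
  galg_piece e t /\ f t = 1.

End GradedAlgebra.

(* The ring A seen as an algebra over Q through a ring morphism Q -> A. *)
Section RestrictionOfScalars.
Variables (Q A : comNzRingType) (f : {rmorphism Q -> A}).

Definition restr of {rmorphism Q -> A} : Type := A.

Local Notation fA := (restr f).

HB.instance Definition _ := GRing.ComNzRing.on fA.

Definition restr_scale (q : Q) (x : fA) : fA := f q * (x : A).

Lemma restr_scaleA c d x :
  restr_scale c (restr_scale d x) = restr_scale (c * d) x.
Proof. by rewrite /restr_scale mulrA -rmorphM. Qed.

Lemma restr_scale1 : left_id 1 restr_scale.
Proof. by move=> x; rewrite /restr_scale rmorph1 mul1r. Qed.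

Lemma restr_scaleDr : right_distributive restr_scale +%R.
Proof. by move=> c x y; rewrite /restr_scale mulrDr. Qed.

Lemma restr_scaleDl x : {morph restr_scale^~ x : c d / c + d}.
Proof. by move=> c d; rewrite /restr_scale rmorphD mulrDl. Qed.

HB.instance Definition _ := GRing.Zmodule_isLmodule.Build Q fA
  restr_scaleA restr_scale1 restr_scaleDr restr_scaleDl.

Lemma restr_scaleAl (c : Q) (x y : fA) : c *: (x * y) = c *: x * y.
Proof. exact: mulrA. Qed.

HB.instance Definition _ :=
  GRing.Lmodule_isLalgebra.Build Q fA restr_scaleAl.

End RestrictionOfScalars.

Section QuotientModule.
Variables (R : nzRingType) (V : lmodType R) (U : {pred V}).
Variable hU : submod_closed U.

Definition submod_pred of submod_closed U : {pred V} := U.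

HB.instance Definition _ := GRing.isZmodClosed.Build V (submod_pred hU)
  (GRing.submod_closedB hU).

Definition lmod_quot : Type := Quotient.quot (submod_pred hU).

HB.instance Definition _ := GRing.Zmodule.on lmod_quot.

Definition lmod_pi : V -> lmod_quot := \pi_(Quotient.quot (submod_pred hU)).

Definition lmod_quot_scale (c : R) (x : lmod_quot) : lmod_quot :=
  lmod_pi (c *: repr x).

Lemma lmod_piB x y : lmod_pi (x - y) = lmod_pi x - lmod_pi y.
Proof. exact: (raddfB (\pi_(Quotient.quot (submod_pred hU)))). Qed.

Lemma lmod_piD x y : lmod_pi (x + y) = lmod_pi x + lmod_pi y.
Proof. exact: (raddfD (\pi_(Quotient.quot (submod_pred hU)))). Qed.

Lemma lmod_piK (x : lmod_quot) : lmod_pi (repr x) = x.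
Proof. exact: reprK. Qed.

Lemma lmod_pi_eq x y : lmod_pi x = lmod_pi y <-> x - y \in U.
Proof.
split=> [/eqP|h]; last apply/eqP.
  by rewrite -(Quotient.idealrBE (submod_pred hU)).
by rewrite -(Quotient.idealrBE (submod_pred hU)).
Qed.

Lemma lmod_quot_scaleE c x : lmod_quot_scale c (lmod_pi x) = lmod_pi (c *: x).
Proof.
apply/lmod_pi_eq; rewrite -scalerBr; apply: (GRing.subsemimod_closedZ hU).
by apply/lmod_pi_eq; rewrite lmod_piK.
Qed.

Lemma lmod_quot_scaleA c d x :
  lmod_quot_scale c (lmod_quot_scale d x) = lmod_quot_scale (c * d) x.
Proof. by rewrite -[x]lmod_piK !lmod_quot_scaleE scalerA. Qed.

Lemma lmod_quot_scale1 : left_id 1 lmod_quot_scale.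
Proof. by move=> x; rewrite -[x]lmod_piK lmod_quot_scaleE scale1r. Qed.

Lemma lmod_quot_scaleDr : right_distributive lmod_quot_scale +%R.
Proof.
move=> c x y; rewrite -[x]lmod_piK -[y]lmod_piK -lmod_piD !lmod_quot_scaleE.
by rewrite scalerDr lmod_piD.
Qed.

Lemma lmod_quot_scaleDl x : {morph lmod_quot_scale^~ x : c d / c + d}.
Proof.
move=> c d /=; rewrite -[x]lmod_piK !lmod_quot_scaleE.
by rewrite scalerDl lmod_piD.
Qed.

HB.instance Definition _ := GRing.Zmodule_isLmodule.Build R lmod_quot
  lmod_quot_scaleA lmod_quot_scale1 lmod_quot_scaleDr lmod_quot_scaleDl.

End QuotientModule.

(* Q = K[x_1, ..., x_m, y_1, ..., y_n] is {mpoly K[m + n]}: the x's are the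
   first m variables and the y's the last n ones. *)
Section ConnectedSum.
Variables (K : fieldType) (m n : nat).
Local Notation Q := {mpoly K[m + n]}.

(* Q -> R = Q / y and Q -> S = Q / x. *)
Definition kill_y : Q -> {mpoly K[m]} := comp_mpoly
  [tuple match split i with inl k => 'X_k | inr _ => 0 end | i < m + n].
Definition kill_x : Q -> {mpoly K[n]} := comp_mpoly
  [tuple match split i with inl _ => 0 | inr k => 'X_k end | i < m + n].

HB.instance Definition _ := GRing.RMorphism.on kill_y.
HB.instance Definition _ := GRing.RMorphism.on kill_x.

Lemma mcoeff0_comp (k : nat) (lq : (m + n).-tuple {mpoly K[k]}) (q : Q) :
  (forall i, (tnth lq i)@_0%MM = 0) -> (comp_mpoly lq q)@_0%MM = q@_0%MM.
Proof.
move=> lq0; elim/mpolyind: q => [|c mo p _ _ IH]; first by rewrite !raddf0.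
rewrite !raddfD /= IH; congr (_ + _).
rewrite comp_mpolyZ !mcoeffZ mcoeffX comp_mpolyX rmorph_prod /=; congr (_ * _).
have [->|nz] := eqVneq mo 0%MM.
  by rewrite big1 // => i _; rewrite mnm0E expr0 rmorph1.
have [i nzi] : exists i, mo i != 0%N.
  apply/existsP; apply: contraNT nz; rewrite negb_exists => /forallP h.
  by apply/eqP/mnmP => i; rewrite mnm0E; apply/eqP; have := h i; rewrite negbK.
by rewrite (bigD1 i) //= rmorphXn /= lq0 expr0n (negPf nzi) mul0r.
Qed.

Lemma kill_y_mcoeff0 q : (kill_y q)@_0%MM = q@_0%MM.
Proof.
apply: mcoeff0_comp => i; rewrite tnth_mktuple.
by case: split => k; rewrite ?mcoeff0 // mcoeffX mnm1_eq0.
Qed.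

Lemma kill_x_mcoeff0 q : (kill_x q)@_0%MM = q@_0%MM.
Proof.
apply: mcoeff0_comp => i; rewrite tnth_mktuple.
by case: split => k; rewrite ?mcoeff0 // mcoeffX mnm1_eq0.
Qed.

(* The ideal of Q generated by the variables whose index is in J. *)
Definition in_var_ideal (J : {set 'I_(m + n)}) (p : Q) : Prop :=
  exists c : 'I_(m + n) -> Q, p = \sum_(i in J) c i * 'X_i.

Definition x_vars : {set 'I_(m + n)} := [set lshift n i | i : 'I_m].
Definition y_vars : {set 'I_(m + n)} := [set rshift m i | i : 'I_n].

Definition x_cap_y : {pred Q^o} :=
  fun p => `[< in_var_ideal x_vars p /\ in_var_ideal y_vars p >].

Lemma in_var_ideal_closed J (c p q : Q) :
  in_var_ideal J p -> in_var_ideal J q -> in_var_ideal J (c * p + q).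
Proof.
move=> [u ->] [v ->]; exists (fun i => c * u i + v i).
rewrite mulr_sumr -big_split /=; apply: eq_bigr => i _.
by rewrite mulrDl mulrA.
Qed.

Lemma in_var_ideal0 J : in_var_ideal J 0.
Proof. by exists (fun=> 0); rewrite big1 // => i _; rewrite mul0r. Qed.

Lemma x_cap_y_submod_closed : submod_closed x_cap_y.
Proof.
split=> [|c p q /asboolP[px py] /asboolP[qx qy]]; apply/asboolP.
  by split; apply: in_var_ideal0.
by split; apply: in_var_ideal_closed.
Qed.

Definition Qxy : lmodType Q := lmod_quot x_cap_y_submod_closed.

Definition Qxy_piece (d : int) (u : Qxy) : Prop :=
  exists2 p : Q, zhomog d p & u = lmod_pi x_cap_y_submod_closed p.

Variables (a : hideal K m) (b : hideal K n).

Definition actA : {rmorphism Q -> galg a} :=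
  GRing.RMorphism.clone _ _ (@galg_pi K m a \o kill_y) _.
Definition actB : {rmorphism Q -> galg b} :=
  GRing.RMorphism.clone _ _ (@galg_pi K n b \o kill_x) _.

Definition modA : lalgType Q := restr actA.
Definition modB : lalgType Q := restr actB.

Definition modA_piece (d : int) (x : modA) : Prop := @galg_piece K m a d x.
Definition modB_piece (d : int) (x : modB) : Prop := @galg_piece K n b d x.

Definition in_fiber_product : {pred modA * modB} :=
  fun z => @galg_proj K m a z.1 == @galg_proj K n b z.2.

Lemma in_fiber_product_subalg_closed : subalg_closed in_fiber_product.
Proof.
split; first by rewrite unfold_in /= (rmorph1 (@galg_proj K m a)) rmorph1.
- move=> q u v; rewrite !unfold_in => /eqP hu /eqP hv.
  have -> : (q *: u + v).1 = galg_pi a (kill_y q) * (u.1 : galg a) + v.1 by [].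
  have -> : (q *: u + v).2 = galg_pi b (kill_x q) * (u.2 : galg b) + v.2 by [].
  rewrite (rmorphD (@galg_proj K m a)) (rmorphD (@galg_proj K n b)).
  rewrite (rmorphM (@galg_proj K m a)) (rmorphM (@galg_proj K n b)).
  apply/eqP; congr (_ * _ + _); [|exact: hu|exact: hv].
  by rewrite [LHS]galg_projE [RHS]galg_projE kill_y_mcoeff0 kill_x_mcoeff0.
- move=> u v; rewrite !unfold_in => /eqP hu /eqP hv.
  have -> : (u * v).1 = (u.1 : galg a) * v.1 by [].
  have -> : (u * v).2 = (u.2 : galg b) * v.2 by [].
  rewrite (rmorphM (@galg_proj K m a)) (rmorphM (@galg_proj K n b)).
  by apply/eqP; congr (_ * _); [exact: hu|exact: hv].
Qed.

HB.instance Definition _ := GRing.isSubalgClosed.Build Q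
  (modA * modB)%type in_fiber_product
  (GRing.subalg_closed_semi in_fiber_product_subalg_closed).

Record fiber_product := FiberProduct {
  fp_val :> modA * modB;
  fp_in : fp_val \in in_fiber_product }.

HB.instance Definition _ := [isSub for fp_val].
HB.instance Definition _ := [Choice of fiber_product by <:].
HB.instance Definition _ :=
  [SubChoice_isSubLalgebra of fiber_product by <:].

Definition fiber_product_piece (d : int) (z : fiber_product) : Prop :=
  modA_piece d (fp_val z).1 /\ modB_piece d (fp_val z).2.

Variables (tA : galg a) (tB : galg b).

(* The ideal of the fiber product generated by (tA, tB). *)
Definition thom_ideal : {pred fiber_product} := fun z =>
  `[< exists c : fiber_product, fp_val z = fp_val c * (tA : modA, tB : modB) >].

Lemma thom_ideal_submod_closed : submod_closed thom_ideal.
Proof.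
have valP : linear (\val : fiber_product -> modA * modB) by exact: linearP.
split=> [|q u v /asboolP[c hc] /asboolP[d hd]]; apply/asboolP.
  by exists 0; rewrite mul0r.
exists (q *: c + d); rewrite [LHS]valP [X in X * _]valP.
by rewrite [\val u]hc [\val v]hd mulrDl scalerAl.
Qed.

Definition connected_sum : lmodType Q := lmod_quot thom_ideal_submod_closed.

Definition connected_sum_piece (d : int) (u : connected_sum) : Prop :=
  exists2 z : fiber_product, fiber_product_piece d z & u = lmod_pi thom_ideal_submod_closed z.

End ConnectedSum.

(* Graded free resolutions of a graded module M by finitely generated graded
   free modules F_i = \bigoplus_k Q(- fr_deg i k); elements of F_i are row
   vectors, and fr_dif i is the matrix of F_(i+1) -> F_i acting on the right. *)
Record free_resolution (K : fieldType) (N : nat) (M : lmodType {mpoly K[N]})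
    (piece : int -> M -> Prop) := FreeResolution {
  fr_rank : nat -> nat;
  fr_deg : forall i : nat, 'I_(fr_rank i) -> int;
  fr_dif : forall i : nat, 'M[{mpoly K[N]}]_(fr_rank i.+1, fr_rank i);
  fr_aug : {linear 'rV[{mpoly K[N]}]_(fr_rank 0) -> M};
  fr_dif_homog : forall i k l,
    zhomog (fr_deg k - fr_deg l) (fr_dif i k l);
  fr_aug_homog : forall k, piece (fr_deg k) (fr_aug (delta_mx 0 k));
  fr_aug_surj : forall u : M, exists v, fr_aug v = u;
  fr_exact0 : forall v : 'rV_(fr_rank 0),
    fr_aug v = 0 <-> exists w : 'rV_(fr_rank 1), v = w *m fr_dif 0;
  fr_exactS : forall (i : nat) (v : 'rV_(fr_rank i.+1)),
    v *m fr_dif i = 0 <->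
      exists w : 'rV_(fr_rank i.+2), v = w *m fr_dif i.+1 }.

Section Tor.
Variables (K : fieldType) (N : nat) (M : lmodType {mpoly K[N]}).
Variables (piece : int -> M -> Prop) (F : free_resolution piece).

(* F_i (x)_Q K is K^(rank F_i); tensoring with K = Q / (all variables) replaces
   the entries of a matrix by their constant coefficients. *)
Definition tensK_dif (i : nat) :
    'Hom('rV[K]_(fr_rank F i.+1), 'rV[K]_(fr_rank F i)) :=
  linfun (mulmxr (map_mx (mcoeff 0%MM) (fr_dif F i))).

Definition tensK_piece (i : nat) (j : int) : {vspace 'rV[K]_(fr_rank F i)} :=
  (\sum_(k < fr_rank F i | fr_deg k == j) <[delta_mx 0%R k]>)%VS.

Definition tor_cycles (i : nat) (j : int) : {vspace 'rV[K]_(fr_rank F i)} :=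
  match i with
  | 0 => tensK_piece 0 j
  | i'.+1 => (tensK_piece i'.+1 j :&: lker (tensK_dif i'))%VS
  end.

Definition tor_boundaries (i : nat) (j : int) : {vspace 'rV[K]_(fr_rank F i)} :=
  (tensK_dif i @: tensK_piece i.+1 j)%VS.

(* [Tor_i^Q(M, K)]_j = H_i(F (x)_Q K)_j, which up to isomorphism does not depend
   on the resolution F of M.  Vector spaces in MathComp have no
   quotients: cycles / boundaries is represented by the complement U :\: V of
   the boundaries in the cycles.  Tor vanishes in negative homological
   degrees. *)
Definition Tor (i j : int) : vectType K :=
  match i with
  | Posz i' => subvs_of (tor_cycles i' j :\: tor_boundaries i' j)%VS
  | Negz _ => 'rV[K]_0
  end.

(* Poincare series are given by their coefficients at t^i s^j, i, j integers. *)
Definition poincare (i j : int) : nat := \dim {: Tor i j}.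

Definition poincare_gt (i j : int) : nat :=
  if (i < j)%R then poincare i j else 0%N.

(* The terms with j = i + e.  For an algebra of socle degree e in m of the m + n
   variables these sum to t^m s^(m+e) (1 + ts)^n, whereas a connected sum only
   has t^(m+n) s^(m+n+e) on this line. *)
Definition poincare_line (e : nat) (i j : int) : nat :=
  if j == i + e%:Z then poincare i j else 0%N.

End Tor.

Definition vect_iso (K : fieldType) (V W : vectType K) : Prop :=
  exists f : {linear V -> W}, bijective f.

(* Main.v *)
Require Import Defs.
From HB Require Import structures.
From mathcomp Require Import all_boot all_order all_algebra.
From mathcomp Require Import boolp.
From mathcomp Require Import mpoly zify.

Set Implicit Arguments.
Unset Strict Implicit.
Unset Printing Implicit Defensive.

Import Order.TTheory GRing.Theory Num.Theory.
Local Open Scope ring_scope.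

(** The connected sum C = A # B looks like A (+) B in all degrees from 1 to e
    - 1; only in the degrees 0 and e it is one-dimensional where A (+) B is
    two-dimensional. The Betti numbers feel this as follows.

    Each of A, B, C and P = Q / (x /\ y) is a cyclic module Q / I, and Tor_i(Q
    / I, K)_j is the homology at (i, d), where d = j - i, of the Koszul
    complex on all variables with coefficients in Q / I (tor_koszul). This
    homology depends on the components of Q / I of degrees d - 1, d and d + 1
    only: its dimension is that of the chains minus the ranks of the
    differentials leaving (i, d) and (i + 1, d - 1) (chain_rank_homology). All
    three numbers are additive when Q / I is, degreewise, a direct sum of two
    quotients of Q (kchain_dim_split, kd_rank_split), so for 2 <= d <= e - 2
    the Betti numbers of C are the sums of those of A and B. For d = 1 and for
    d = e - 1 the chains still split, and the sum has to be corrected by the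
    rank of the differential out of degree 0, resp. into degree e.

    Both ranks count sets of variables. Let J be the set of variables that act
    nontrivially: the x's for A, the y's for B, all of them for C and P. If I
    contains no linear form in the variables of J, the rank out of degree 0 in
    homological degree i is the number of i-sets that meet J
    (kd_rank_degree0). If the socle is spanned by degree e and (Q / I)_1 pairs
    perfectly with (Q / I)_(e-1), the rank into degree e in homological degree
    i is the number of i-sets that do not contain J (kd_rank_top); for A and B
    this pairing is what the Gorenstein property provides (dual_forms), and C
    inherits it.

    P is glued from the polynomial rings R = Q / y and S = Q / x just as C is
    glued from A and B, but R and S have no Koszul homology in degrees d >= 1
    (khom_dim_kernel). Hence P has no homology for d >= 2, and for d = 1 its
    homology is exactly the correction found for C (khom_dimP_linear), which
    gives the summand Tor(P) of Tor(C) for d = 1. Complementation of sets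
    exchanges the two kinds of sets counted above (card_not_sub_compl), whence
    the summand Tor_(m+n-i)(P) for d = e - 1.

    That Tor, defined through an arbitrary graded free resolution F, is Koszul
    homology is the balance of Tor. It is proved by walking along the diagonal
    of the double complex Koszul (x) F, whose rows and columns are exact; each
    step replaces a subquotient by an isomorphic one (zz_step). *)

(** * Dimensions of subquotients *)

Section LinearCombination.
Variables (K : fieldType) (V : lmodType K).

Definition subspace_pred (P : V -> Prop) : Prop :=
  P 0 /\ forall c x y, P x -> P y -> P (c *: x + y).

Definition lin_comb k (g : 'I_k -> V) (v : 'rV[K]_k) : V := \sum_i v 0 i *: g i.

Lemma lin_combD k (g : 'I_k -> V) a v w :
  lin_comb g (a *: v + w) = a *: lin_comb g v + lin_comb g w.
Proof.
rewrite /lin_comb scaler_sumr -big_split; apply: eq_bigr => i _.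
by rewrite !mxE scalerDl scalerA.
Qed.

Lemma lin_comb0 k (g : 'I_k -> V) : lin_comb g 0 = 0.
Proof. by rewrite /lin_comb big1 // => i _; rewrite mxE scale0r. Qed.

Lemma lin_comb_mulmx k l (g : 'I_l -> V) (v : 'rV[K]_k) (M : 'M[K]_(k, l)) :
  lin_comb g (v *m M) = \sum_i v 0 i *: lin_comb g (row i M).
Proof.
rewrite /lin_comb; under [RHS]eq_bigr do rewrite scaler_sumr.
rewrite exchange_big; apply: eq_bigr => j _ /=; rewrite mxE scaler_suml.
by apply: eq_bigr => i _; rewrite mxE scalerA.
Qed.

Variables (P : V -> Prop).
Hypothesis sP : subspace_pred P.

Lemma subspaceZ c x : P x -> P (c *: x).
Proof. by move=> h; rewrite -[_ *: _]addr0; apply: sP.2 => //; apply: sP.1. Qed.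

Lemma subspaceD x y : P x -> P y -> P (x + y).
Proof. by move=> hx hy; rewrite -[x]scale1r; apply: sP.2. Qed.

Lemma subspaceN x : P x -> P (- x).
Proof. by rewrite -scaleN1r; apply: subspaceZ. Qed.

Lemma subspaceB x y : P x -> P y -> P (x - y).
Proof. by move=> hx /subspaceN; apply: subspaceD. Qed.

Lemma subspace_sum (I : finType) (Q : pred I) (F : I -> V) :
  (forall i, Q i -> P (F i)) -> P (\sum_(i | Q i) F i).
Proof. by move=> h; elim/big_ind: _ => //; [apply: sP.1|apply: subspaceD]. Qed.

Lemma subspace_lin_comb k (g : 'I_k -> V) v :
  (forall i, P (g i)) -> P (lin_comb g v).
Proof. by move=> h; apply: subspace_sum => i _; apply: subspaceZ. Qed.

End LinearCombination.

Section Dimension.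
Variable K : fieldType.

(** The subquotient Z / (Z /\ B) of a possibly infinite-dimensional space has
    dimension k; B need not lie in Z. *)
Definition qdim (V : lmodType K) (Z B : V -> Prop) (k : nat) : Prop :=
  exists g : 'I_k -> V, [/\ forall i, Z (g i),
    forall v, B (lin_comb g v) -> v = 0 &
    forall z, Z z -> exists v, B (z - lin_comb g v)].

(** Diagram chases define relations, not maps, as each step chooses a lift.
    Linearity of the relation is all that the comparison of dimensions needs. *)
Definition linear_rel (V W : lmodType K) (rho : V -> W -> Prop) : Prop :=
  rho 0 0 /\ forall c x y x' y', rho x x' -> rho y y' ->
    rho (c *: x + y) (c *: x' + y').

Lemma linear_rel_lin_comb (V W : lmodType K) (rho : V -> W -> Prop) k
    (g : 'I_k -> V) (h : 'I_k -> W) v :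
  linear_rel rho -> (forall i, rho (g i) (h i)) ->
  rho (lin_comb g v) (lin_comb h v).
Proof.
move=> [r0 rD] gh; rewrite /lin_comb.
elim/big_rec2: _ => [|i y x _ IH]; [exact: r0|exact: rD].
Qed.

(** If the images under rho of an independent family are expressed through a
    spanning family, the matrix of coefficients has independent rows, since a
    linear dependency between them would lift back along rho. *)
Lemma independent_le_spanning (V W : lmodType K) (rho : V -> W -> Prop)
    (Z1 B1 : V -> Prop) (Z2 B2 : W -> Prop) k l (g : 'I_k -> V) (h : 'I_l -> W) :
  linear_rel rho -> subspace_pred Z1 -> subspace_pred Z2 -> subspace_pred B2 ->
  (forall z, Z1 z -> exists2 w, Z2 w & rho z w) ->
  (forall z w, Z1 z -> Z2 w -> rho z w -> B2 w -> B1 z) ->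
  (forall i, Z1 (g i)) -> (forall v, B1 (lin_comb g v) -> v = 0) ->
  (forall w, Z2 w -> exists v, B2 (w - lin_comb h v)) ->
  (k <= l)%N.
Proof.
move=> lr s1 s2 sB ex inj gZ ind span.
pose w i := sval (cid2 (ex _ (gZ i))).
have wZ i : Z2 (w i) by rewrite /w; case: cid2.
have gw i : rho (g i) (w i) by rewrite /w; case: cid2.
pose v i := sval (cid (span _ (wZ i))).
have wv i : B2 (w i - lin_comb h (v i)) by rewrite /v; case: cid.
pose M := \matrix_(i, j) v i 0 j.
have rM i : row i M = v i by apply/rowP => j; rewrite !mxE.
rewrite leqNgt; apply/negP => lk.
have : kermx M != 0.
  by rewrite kermx_eq0; apply: contraL lk; rewrite -leqNgt => /eqP <-; apply: rank_leq_col.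
case/rowV0Pn => c /sub_kermxP cM cn0; case/eqP: cn0; apply: ind.
apply: (inj _ (lin_comb w c)) => //.
- exact: subspace_lin_comb.
- exact: subspace_lin_comb.
- exact: linear_rel_lin_comb.
have : B2 (lin_comb (fun i => w i - lin_comb h (v i)) c) by apply: subspace_lin_comb.
suff -> : lin_comb (fun i => w i - lin_comb h (v i)) c =
          lin_comb w c - lin_comb h (c *m M).
  by rewrite cM lin_comb0 subr0.
rewrite lin_comb_mulmx -sumrB; apply: eq_bigr => i _.
by rewrite rM scalerBr.
Qed.

(** The graph of an isomorphism Z1 / B1 -> Z2 / B2, up to the choice of
    representatives. *)
Definition correspondence (V W : lmodType K) (rho : V -> W -> Prop)
    (Z1 B1 : V -> Prop) (Z2 B2 : W -> Prop) : Prop :=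
  [/\ linear_rel rho, forall z, Z1 z -> exists2 w, Z2 w & rho z w,
      forall w, Z2 w -> exists2 z, Z1 z & rho z w &
      forall z w, Z1 z -> Z2 w -> rho z w -> (B1 z <-> B2 w)].

Lemma qdim_transfer (V W : lmodType K) (rho : V -> W -> Prop)
    (Z1 B1 : V -> Prop) (Z2 B2 : W -> Prop) k :
  subspace_pred Z1 -> subspace_pred Z2 ->
  correspondence rho Z1 B1 Z2 B2 -> qdim Z1 B1 k -> qdim Z2 B2 k.
Proof.
move=> s1 s2 [lr ex1 ex2 iffB] [g [gZ ind span]].
pose w i := sval (cid2 (ex1 _ (gZ i))).
have wZ i : Z2 (w i) by rewrite /w; case: cid2.
have gw i : rho (g i) (w i) by rewrite /w; case: cid2.
exists w; split=> // [v|z Zz].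
  move=> Bv; apply: ind; apply/(iffB _ (lin_comb w v)) => //.
  - exact: subspace_lin_comb.
  - exact: subspace_lin_comb.
  - exact: linear_rel_lin_comb.
have [y Zy yz] := ex2 _ Zz; have [v Bv] := span _ Zy; exists v.
apply/(iffB (y - lin_comb g v)) => //.
- by apply: subspaceB => //; apply: subspace_lin_comb.
- by apply: subspaceB => //; apply: subspace_lin_comb.
- rewrite addrC -scaleN1r [z - _]addrC -[- lin_comb w v]scaleN1r.
  by apply: lr.2 => //; apply: linear_rel_lin_comb.
Qed.

Variable V : lmodType K.
Implicit Types Z B W : V -> Prop.

Lemma eq_linear_rel : linear_rel (@eq V).
Proof. by split=> // c x y _ _ <- <-. Qed.

Lemma qdim_unique Z B k l : subspace_pred Z -> subspace_pred B ->
  qdim Z B k -> qdim Z B l -> k = l.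
Proof.
move=> sZ sB [g [gZ gi gs]] [h [hZ hi hs]]; apply/eqP; rewrite eqn_leq.
apply/andP; split.
  apply: (independent_le_spanning (B1 := B) eq_linear_rel sZ sZ sB _ _ gZ gi hs).
    by move=> z Zz; exists z.
  by move=> z _ _ _ <-.
apply: (independent_le_spanning (B1 := B) eq_linear_rel sZ sZ sB _ _ hZ hi gs).
  by move=> z Zz; exists z.
by move=> z _ _ _ <-.
Qed.

Lemma qdim_ext Z B Z' B' k : (forall v, Z v <-> Z' v) ->
  (forall v, Z v -> (B v <-> B' v)) -> subspace_pred Z ->
  qdim Z B k -> qdim Z' B' k.
Proof.
move=> hZ hB sZ; apply: qdim_transfer (sZ) _ _; last first.
  split; [exact: eq_linear_rel|move=> z /hZ; by exists z|move=> z /hZ; by exists z|].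
  by move=> z _ Zz _ <-; apply: hB.
by split=> [|c x y /hZ hx /hZ hy]; apply/hZ; [exact: sZ.1|exact: sZ.2].
Qed.

(** Finitely many linear coordinates that detect B bound the size of the
    families of Z independent modulo B, and a largest such family spans. *)
Lemma qdim_exists k (c : {linear V -> 'rV[K]_k}) Z B :
  subspace_pred Z -> subspace_pred B -> (forall z, Z z -> c z = 0 -> B z) ->
  exists l, qdim Z B l.
Proof.
move=> sZ sB cB.
pose ind l := exists g : 'I_l -> V, (forall i, Z (g i)) /\
  (forall v, B (lin_comb g v) -> v = 0).
have ind_le l : ind l -> (l <= k)%N.
  move=> [g [gZ gi]].
  apply: (@independent_le_spanning _ 'rV[K]_k (fun z w => w = c z) Z B
    (fun _ => True) (fun w => w = 0) _ _ g (fun i => delta_mx 0 i)) => //.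
  - by split=> [|a x y _ _ -> ->]; rewrite ?linear0 ?linearP.
  - by split=> // a x y -> ->; rewrite scaler0 addr0.
  - by move=> z _; exists (c z).
  - by move=> z w Zz _ -> /cB; apply.
  - by move=> w _; exists w; rewrite /lin_comb -row_sum_delta subrr.
have exi : exists l, `[< ind l >].
  exists 0%N; apply/asboolP; exists (fun=> 0); split=> [[]//|v _].
  by apply/rowP => -[].
have bi l : `[< ind l >] -> (l <= k)%N by move/asboolP/ind_le.
case: (ex_maxnP exi bi) => l /asboolP[g [gZ gi]] lmax.
exists l, g; split=> // z Zz; apply: contrapT => nz.
suff : (l.+1 <= l)%N by rewrite ltnn.
apply: lmax; apply/asboolP.
exists (fun i => if unlift ord0 i is Some j then g j else z); split.
  by move=> i; case: unlift.
move=> v; rewrite /lin_comb big_ord_recl unlift_none.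
under eq_bigr do rewrite liftK.
set v' := \row_i v 0 (lift ord0 i).
rewrite (_ : \sum_(i < l) _ = lin_comb g v'); last first.
  by apply: eq_bigr => i _; rewrite mxE.
have [v0|v0] := eqVneq (v 0 ord0) 0.
  rewrite v0 scale0r add0r => /gi /rowP v'0; apply/rowP => i; rewrite mxE.
  by case: (unliftP ord0 i) => [j ->|-> //]; have := v'0 j; rewrite !mxE.
move=> Bz; case: nz; exists (- (v 0 ord0)^-1 *: v').
have := subspaceZ sB (v 0 ord0)^-1 Bz.
rewrite scalerDr scalerA mulVf // scale1r.
by rewrite -[- _^-1 *: v']addr0 lin_combD lin_comb0 addr0 scaleNr opprK.
Qed.

Lemma qdim_add W Z B k l : subspace_pred W -> subspace_pred Z ->
  subspace_pred B ->
  (forall v, Z v -> W v) -> (forall v, B v -> Z v) ->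
  qdim W Z k -> qdim Z B l -> qdim W B (k + l).
Proof.
move=> sW sZ sB ZW BZ [g [gW gi gs]] [h [hZ hi hs]].
pose f (i : 'I_(k + l)) := match split i with inl j => g j | inr j => h j end.
have fE v : lin_comb f v = lin_comb g (lsubmx v) + lin_comb h (rsubmx v).
  rewrite /lin_comb big_split_ord /=; congr (_ + _); apply: eq_bigr => i _.
    by rewrite /f (unsplitK (inl i : 'I_k + 'I_l)%type) mxE.
  by rewrite /f (unsplitK (inr i : 'I_k + 'I_l)%type) mxE.
exists f; split.
- by move=> i; rewrite /f; case: split => j //; apply: ZW.
- move=> v; rewrite fE => Bv.
  have l0 : lsubmx v = 0.
    apply: gi; rewrite -[lin_comb _ _](addrK (lin_comb h (rsubmx v))).
    by apply: subspaceB => //; [exact: BZ|exact: subspace_lin_comb].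
  move: Bv; rewrite l0 lin_comb0 add0r => /hi r0.
  by rewrite -[v]hsubmxK l0 r0 row_mx0.
- move=> w Ww; have [v Zv] := gs _ Ww; have [v' Bv] := hs _ Zv.
  by exists (row_mx v v'); rewrite fE row_mxKl row_mxKr opprD addrA.
Qed.

(** A family of coordinates indexed by S whose common zero locus in Z is B,
    together with a dual family in Z, exhibits Z / B as the space of functions
    on S. *)
Lemma qdim_dual (Y : finType) (S : {set Y}) (c : V -> Y -> K) Z B :
  (forall a z w y, c (a *: z + w) y = a * c z y + c w y) ->
  (forall z, Z z -> (B z <-> forall y, y \in S -> c z y = 0)) ->
  subspace_pred Z ->
  (forall y, y \in S -> exists2 z, Z z & forall y', y' \in S -> c z y' = (y == y')%:R) ->
  qdim Z B #|S|.
Proof.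
move=> cD BP sZ ex.
pose g i := sval (cid2 (ex _ (enum_valP (i : 'I_#|S|)))).
have gZ i : Z (g i) by rewrite /g; case: cid2.
have gc i j : c (g i) (enum_val j) = (i == j)%:R.
  rewrite /g; case: cid2 => z _ /= ->; last exact: enum_valP.
  by rewrite (inj_eq enum_val_inj).
have c0 y : c 0 y = 0.
  by have := cD (-1) 0 0 y; rewrite scaler0 addr0 mulN1r addNr.
have cl v y : c (lin_comb g v) y = \sum_i v 0 i * c (g i) y.
  rewrite /lin_comb; elim/big_rec2: _ => [|i a b _ IH]; first exact: c0.
  by rewrite cD IH.
have clE v j : c (lin_comb g v) (enum_val j) = v 0 j.
  rewrite cl (bigD1 j) //= gc eqxx mulr1 big1 ?addr0 // => i /negPf ij.
  by rewrite gc ij mulr0.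
exists g; split=> // [v|z Zz].
  move/BP => h; apply/rowP => j; rewrite mxE -clE.
  by apply: h; [exact: subspace_lin_comb|exact: enum_valP].
exists (\row_j c z (enum_val j)).
apply/BP; first by apply: subspaceB => //; exact: subspace_lin_comb.
move=> y yS; rewrite addrC -scaleN1r cD.
rewrite -(enum_rankK_in yS yS) clE mxE mulN1r; exact: addNr.
Qed.

Definition dimq Z B : nat :=
  if pselect (exists k, qdim Z B k) is left h then sval (cid h) else 0%N.

Lemma dimqE Z B k : subspace_pred Z -> subspace_pred B ->
  qdim Z B k -> dimq Z B = k.
Proof.
move=> sZ sB h; rewrite /dimq; case: pselect => [ex|[]]; last by exists k.
by case: cid => l /= hl; apply: qdim_unique hl h.
Qed.

Lemma dimqP Z B : (exists k, qdim Z B k) -> qdim Z B (dimq Z B).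
Proof. by move=> h; rewrite /dimq; case: pselect => // ex; case: cid. Qed.

End Dimension.

(** * Homogeneous components of polynomials *)

Section Homogeneity.
Variables (K : fieldType) (N : nat).
Local Notation Q := {mpoly K[N]}.
Implicit Types (p q : Q) (d s : int).

Lemma zhomogP d p :
  reflect (forall mu, p@_mu != 0 -> (mdeg mu)%:Z = d) (zhomog d p).
Proof.
apply: (iffP idP).
  case: d => d /=; last by move=> /eqP -> mu; rewrite mcoeff0 eqxx.
  by move=> /dhomogP h mu; rewrite -mcoeff_msupp => /h ->.
case: d => d /= h.
  by apply/dhomogP => mu; rewrite mcoeff_msupp => /h [].
apply/eqP/mpolyP => mu; rewrite mcoeff0; apply/eqP/negPn/negP => /h.
by case: d {h}.
Qed.

Lemma zhomog_coeff d p mu : zhomog d p -> (mdeg mu)%:Z != d -> p@_mu = 0.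
Proof. by move=> /zhomogP h; apply: contraNeq => /h ->. Qed.

Lemma zhomog_neg d p : zhomog d p -> (d < 0)%R -> p = 0.
Proof. by case: d => //= d /eqP. Qed.

Lemma zhomog0 d : zhomog d (0 : Q).
Proof. by apply/zhomogP => mu; rewrite mcoeff0 eqxx. Qed.

Lemma zhomogD d p q : zhomog d p -> zhomog d q -> zhomog d (p + q).
Proof.
move=> hp hq; apply/zhomogP => mu; apply: contraNeq => ne.
by rewrite mcoeffD !(zhomog_coeff _ ne) // addr0.
Qed.

Lemma zhomogZ d c p : zhomog d p -> zhomog d (c *: p).
Proof.
move=> hp; apply/zhomogP => mu; apply: contraNeq => ne.
by rewrite mcoeffZ (zhomog_coeff _ ne) // mulr0.
Qed.

Lemma zhomogN d p : zhomog d p -> zhomog d (- p).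
Proof. by rewrite -scaleN1r; apply: zhomogZ. Qed.

Lemma zhomogB d p q : zhomog d p -> zhomog d q -> zhomog d (p - q).
Proof. by move=> hp /zhomogN; apply: zhomogD. Qed.

Lemma zhomog_sum d (I : finType) (P : pred I) (F : I -> Q) :
  (forall i, P i -> zhomog d (F i)) -> zhomog d (\sum_(i | P i) F i).
Proof. by move=> h; elim/big_ind: _ => //; [exact: zhomog0|apply: zhomogD]. Qed.

Lemma zhomogM d s p q : zhomog d p -> zhomog s q -> zhomog (d + s) (p * q).
Proof.
case: d => d; last by move=> /eqP ->; rewrite mul0r => _; apply: zhomog0.
case: s => s; last by move=> _ /eqP ->; rewrite mulr0; apply: zhomog0.
exact: dhomogM.
Qed.

Lemma zhomogC (c : K) : zhomog 0 (c%:MP : Q).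
Proof.
apply/zhomogP => mu; rewrite mcoeffC.
by have [->|_] := eqVneq mu 0%MM; rewrite ?mdeg0 // mulr0 eqxx.
Qed.

Lemma zhomogX (k : 'I_N) : zhomog 1 ('X_k : Q).
Proof.
apply/zhomogP => mu; rewrite mcoeffX.
by have [<-|_] := eqVneq U_(k)%MM mu; rewrite ?mdeg1 // eqxx.
Qed.

Lemma zhomogXM d (k : 'I_N) p : zhomog (d - 1) p -> zhomog d ('X_k * p).
Proof. by move=> h; rewrite -[d](subrK 1) addrC; apply: zhomogM (zhomogX k) h. Qed.

Lemma zhomog0_const p : zhomog 0 p -> p = (p@_0%MM)%:MP.
Proof.
move=> h; apply/mpolyP => mu; rewrite mcoeffC.
have [->|nz] := eqVneq mu 0%MM; first by rewrite mulr1.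
by rewrite mulr0 (zhomog_coeff h) // eqz_nat mdeg_eq0.
Qed.

Lemma zhomog_coeff0 d p : zhomog d p -> d != 0 -> p@_0%MM = 0.
Proof. by move=> h nz; apply: zhomog_coeff h _; rewrite mdeg0 eq_sym. Qed.

(** Degrees are integers here, because the twists of a free resolution and the
    differences of its generators' degrees can be negative. *)
Definition zcomp d p : Q := if d is Posz k then pihomog mdeg k p else 0.

Lemma mcoeff_zcomp d p mu :
  (zcomp d p)@_mu = if (mdeg mu)%:Z == d then p@_mu else 0.
Proof.
case: d => d; rewrite /zcomp ?mcoeff0 //= eqz_nat.
rewrite pihomogE raddf_sum /=.
under eq_bigr do rewrite mcoeffZ mcoeffX.
have [mp|mp] := boolP (mu \in msupp p); last first.
  have mp0 : p@_mu = 0 by apply/eqP; rewrite mcoeff_eq0.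
  rewrite big1_seq ?mp0 ?if_same // => nu /andP[_].
  by case: eqVneq => [->|_ _]; rewrite ?mulr0 // mcoeff_msupp mp0 eqxx.
rewrite big_mkcond (bigD1_seq mu) ?msupp_uniq //= eqxx mulr1 big1.
  by rewrite addr0.
by move=> nu /negPf ->; rewrite mulr0 if_same.
Qed.

Lemma zhomog_zcomp d p : zhomog d (zcomp d p).
Proof.
by apply/zhomogP => mu; rewrite mcoeff_zcomp; case: (_ =P d) => //; rewrite eqxx.
Qed.

Lemma zcomp_id d p : zhomog d p -> zcomp d p = p.
Proof.
move=> h; apply/mpolyP => mu; rewrite mcoeff_zcomp.
by case: ifPn => // ne; rewrite (zhomog_coeff h ne).
Qed.

Lemma zcomp_neq d s p : zhomog s p -> s != d -> zcomp d p = 0.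
Proof.
move=> h ne; apply/mpolyP => mu; rewrite mcoeff_zcomp mcoeff0.
by case: eqP => // e; rewrite (zhomog_coeff h) // e eq_sym.
Qed.

Lemma zcomp_is_linear d : linear (zcomp d).
Proof.
move=> c p q; apply/mpolyP => mu.
rewrite mcoeffD mcoeffZ !mcoeff_zcomp mcoeffD mcoeffZ.
by case: ifP => //; rewrite mulr0 addr0.
Qed.

HB.instance Definition _ d :=
  GRing.isLinear.Build K Q Q _ (zcomp d) (zcomp_is_linear d).

(** This is what allows a solution of a linear system with homogeneous
    coefficients to be replaced by a homogeneous solution. *)
Lemma zcompMr d s p q : zhomog s q -> zcomp d (p * q) = zcomp (d - s) p * q.
Proof.
move=> hq; elim/mpolyind: p => [|c mu p _ _ IH].
  by rewrite mul0r !raddf0 mul0r.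
rewrite mulrDl !linearD /= IH mulrDl; congr (_ + _).
have hX : zhomog (mdeg mu)%:Z (c *: 'X_[mu] : Q).
  by apply: zhomogZ; rewrite /= dhomogX.
have hXq := zhomogM hX hq.
have [e|ne] := eqVneq ((mdeg mu)%:Z + s) d.
  by rewrite (zcomp_id (p := _ * q)) -e ?addrK ?(zcomp_id hX).
rewrite (zcomp_neq hXq ne) (zcomp_neq hX) ?mul0r //.
by apply: contraNneq ne => ->; rewrite subrK.
Qed.

Lemma mcoeffXUM (k : 'I_N) p nu :
  ('X_k * p)@_nu = if (0 < nu k)%N then p@_(nu - U_(k))%MM else 0.
Proof.
rewrite mulrC; case: ifPn => [nk|].
  have kn : (U_(k) <= nu)%MM.
    by apply/mnm_lepP => i; rewrite mnm1E; case: eqVneq => [<-|].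
  by rewrite -{1}(submK kn) addmC mcoeffMX.
rewrite lt0n negbK => nk; apply/eqP; rewrite mcoeff_eq0.
apply/negP => /msuppM_le /allpairsP[[m1 m2] /= [_]].
rewrite msuppX inE => /eqP -> e; move: nk.
by rewrite e mnmDE mnm1E eqxx addn1.
Qed.

End Homogeneity.

(** * The Koszul complex of the polynomial ring *)

Section Koszul.
Variables (K : fieldType) (N : nat).
Local Notation Q := {mpoly K[N]}.
Implicit Types (f g : {set 'I_N} -> Q) (J T : {set 'I_N}) (p q : Q).

Definition ksign (k : 'I_N) T : K := (-1) ^+ #|[set t in T | (t < k)%N]|.

Lemma ksign_sqr k T : ksign k T * ksign k T = 1.
Proof. by rewrite -expr2 sqrr_sign. Qed.

Lemma ksignU k l T : k \notin T ->
  ksign l (k |: T) = (-1) ^+ (k < l)%N * ksign l T.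
Proof.
move=> kT; rewrite /ksign -exprD; congr (_ ^+ _).
have -> : [set t in k |: T | (t < l)%N] =
    if (k < l)%N then k |: [set t in T | (t < l)%N] else [set t in T | (t < l)%N].
  apply/setP => t; case: ifPn => kl; rewrite !inE.
    by case: eqVneq => [->|] //=; rewrite kl.
  by case: eqVneq => [->|] //=; rewrite (negPf kl) andbF.
by case: ifPn => kl; rewrite ?add0n // cardsU1 !inE (negPf kT) andFb.
Qed.

Lemma ksignU1 k T : k \notin T -> ksign k (k |: T) = ksign k T.
Proof. by move=> kT; rewrite ksignU // ltnn mul1r. Qed.

Lemma ksign_anti k l T : k != l -> k \notin T -> l \notin T ->
  ksign k T * ksign l (k |: T) = - (ksign l T * ksign k (l |: T)).
Proof.
move=> kl kT lT; rewrite !ksignU // mulrCA [ksign l T * _]mulrCA.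
rewrite [ksign l T * _]mulrC -mulNr; congr (_ * _).
have := neq_ltn k l; rewrite -val_eqE /= in kl *.
by rewrite kl => /esym/orP[] h; rewrite h ltnNge (ltnW h) /= ?opprK.
Qed.

(** An element sum_T f(T) e_T of the Koszul complex is stored as the function
    f on sets of variables.  The differential uses the variables of J only;
    setT gives the full Koszul complex, and the set of all x's describes its
    action on polynomials in the x's. *)
Definition kd J f T : Q :=
  \sum_(k in J :\: T) ksign k T *: ('X_k * f (k |: T)).

Lemma eq_kd J f g T : f =1 g -> kd J f T = kd J g T.
Proof. by move=> fg; apply: eq_bigr => k _; rewrite fg. Qed.

Lemma kdP J a f g T :
  kd J (fun T => a *: f T + g T) T = a *: kd J f T + kd J g T.
Proof.
rewrite /kd scaler_sumr -big_split; apply: eq_bigr => k _ /=.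
by rewrite mulrDr scalerDr -scalerAr scalerA mulrC scalerA.
Qed.

Lemma kd0 J T : kd J (fun=> 0) T = 0.
Proof. by apply: big1 => k _; rewrite mulr0 scaler0. Qed.

Lemma kdB J f g T : kd J (fun T => f T - g T) T = kd J f T - kd J g T.
Proof.
rewrite -(eq_kd _ _ (f := fun T => (-1) *: g T + f T)); last first.
  by move=> T'; rewrite scaleN1r addrC.
by rewrite kdP scaleN1r addrC.
Qed.

Lemma kd_sumM J r (F : 'I_r -> {set 'I_N} -> Q) (c : 'I_r -> Q) T :
  kd J (fun T => \sum_l F l T * c l) T = \sum_l kd J (F l) T * c l.
Proof.
rewrite /kd; under [RHS]eq_bigr do rewrite mulr_suml.
rewrite exchange_big; apply: eq_bigr => k _ /=; rewrite mulr_sumr scaler_sumr.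
by apply: eq_bigr => l _; rewrite mulrA scalerAl.
Qed.

(** The terms for the pairs (k, l) and (l, k) cancel by ksign_anti. *)
Lemma kd_kd J f T : kd J (kd J f) T = 0.
Proof.
pose ok k := k \in J :\: T.
pose a k l : Q :=
  (ksign k T * ksign l (k |: T)) *: ('X_k * 'X_l * f (l |: (k |: T))).
pose b k l := if [&& ok k, ok l & (k < l)%N] then a k l else 0.
have aN k l : ok k -> ok l -> k != l -> a k l = - a l k.
  rewrite /ok !inE => /andP[kT _] /andP[lT _] kl.
  by rewrite /a ksign_anti // scaleNr setUCA ['X_k * _]mulrC.
transitivity (\sum_k \sum_l (b k l - b l k)); last first.
  under eq_bigr do rewrite sumrB.
  by rewrite sumrB [X in _ - X]exchange_big subrr.
rewrite /kd big_mkcond; apply: eq_bigr => k _.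
have [okk|nk] := boolP (ok k); last first.
  rewrite -/(ok k) (negPf nk) big1 // => l _.
  by rewrite /b (negPf nk) /= andbF subrr.
rewrite -/(ok k) okk mulr_sumr scaler_sumr big_mkcond; apply: eq_bigr => l _.
have -> : (l \in J :\: (k |: T)) = (l != k) && ok l.
  by rewrite /ok !inE negb_or andbA.
rewrite /b okk /=; have [okl|_] /= := boolP (ok l); last by rewrite andbF subrr.
have [->|lk] := eqVneq l k; first by rewrite ltnn subrr.
rewrite -scalerAr mulrA scalerA -/(a k l).
have := neq_ltn k l; rewrite val_eqE eq_sym lk => /esym/orP[] h.
  by rewrite h ltnNge (ltnW h) /= subr0.
by rewrite h ltnNge (ltnW h) /= sub0r aN // eq_sym.
Qed.

(** Division by X_k of those monomials of p in which k is the first variable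
    of J. *)
Definition kstrip J (k : 'I_N) p : Q :=
  \sum_(mu <- msupp p | (0 < mu k)%N && [forall (l | l \in J), (l < k)%N ==> (mu l == 0%N)])
     p@_mu *: 'X_[mu - U_(k)].

Lemma mcoeff_kstrip J k p nu : (kstrip J k p)@_nu =
  if [forall (l | l \in J), (l < k)%N ==> (nu l == 0%N)] then p@_(nu + U_(k))%MM else 0.
Proof.
rewrite /kstrip raddf_sum /=; under eq_bigr do rewrite mcoeffZ mcoeffX.
have E : [forall (l | l \in J), (l < k)%N ==> (nu l == 0%N)] =
         [forall (l | l \in J), (l < k)%N ==> ((nu + U_(k))%MM l == 0%N)].
  apply: eq_forallb_in => l _; case: ltnP => //= lk.
  have kl : k != l by rewrite -val_eqE /= gtn_eqF.
  by rewrite mnmDE mnm1E (negPf kl) addn0.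
have eqS (mu : 'X_{1..N}) : (0 < mu k)%N -> ((mu - U_(k))%MM == nu) = (mu == (nu + U_(k))%MM).
  move=> mk; apply/eqP/eqP => [<-|->]; last by rewrite addmK.
  rewrite submK //; apply/mnm_lepP => i; rewrite mnm1E.
  by case: eqVneq => [<-|].
have [mp|mp] := boolP ((nu + U_(k))%MM \in msupp p).
  rewrite big_mkcond (bigD1_seq (nu + U_(k))%MM) ?msupp_uniq //= big1.
    by rewrite addr0 -E mnmDE mnm1E eqxx addn1 /= addmK eqxx mulr1.
  move=> mu mn; case: ifP => // /andP[mk _].
  by rewrite eqS // (negPf mn) mulr0.
have mp0 : p@_(nu + U_(k)) = 0 by apply/eqP; rewrite mcoeff_eq0.
rewrite mp0 if_same big1_seq // => mu /andP[/andP[mk _]].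
rewrite eqS //; case: eqVneq => [->|]; last by rewrite mulr0.
by rewrite mcoeff_msupp mp0 eqxx.
Qed.

Lemma zhomog_kstrip J k p d : zhomog d p -> zhomog (d - 1) (kstrip J k p).
Proof.
move=> hp; apply/zhomogP => mu; rewrite mcoeff_kstrip.
case: ifP => _; last by rewrite eqxx.
by move/zhomogP: hp => hp /hp <-; rewrite mdegD mdeg1 PoszD addrK.
Qed.

(** The contracting homotopy moves the first variable of J that occurs in a
    term X^mu e_T from the monomial mu to the set T. *)
Definition khomotopy J f T : Q :=
  \sum_(k in T :&: J | [forall (l | l \in T :&: J), (k <= l)%N])
     ksign k T *: kstrip J k (f (T :\ k)).

(** For a term X^mu e_T let k be the first variable of J that occurs in mu or
    in T.  The differential preserves k, so that khomotopy can be compared with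
    it term by term; k exists except for the terms excluded by the second
    hypothesis.  Following a single monomial makes the argument independent of
    the characteristic. *)
Theorem kd_exact J f :
  (forall T, kd J f T = 0) ->
  (forall T (nu : 'X_{1..N}), T :&: J = set0 -> (forall l, l \in J -> nu l = 0%N) ->
     (f T)@_nu = 0) ->
  forall T, kd J (khomotopy J f) T = f T.
Proof.
move=> cyc f0 T; apply/mpolyP => nu.
pose occ k := (k \in J) && ((k \in T) || (0 < nu k)%N).
case: (pickP occ) => [k1 occ1|noc]; last first.
  rewrite (f0 T nu); first last.
  - by move=> l lJ; have := noc l; rewrite /occ lJ /= lt0n => /negbT/norP[_]/negbNE/eqP.
  - by apply/setP => l; rewrite !inE andbC; have := noc l; rewrite /occ; case: (l \in J) => //= /norP[/negPf].
  rewrite /kd raddf_sum big1 //= => l; rewrite inE => /andP[_ lJ].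
  rewrite mcoeffZ mcoeffXUM; have := noc l; rewrite /occ lJ /= => /negbT/norP[_ /negPf ->].
  by rewrite mulr0.
case: (arg_minnP (fun k : 'I_N => k : nat) occ1) => {occ1} k /andP[kJ kTn] kmin.
have nu0 l : l \in J -> (l < k)%N -> (l \notin T) /\ nu l = 0%N.
  move=> lJ lk; have : ~~ occ l by apply/negP => /kmin; rewrite leqNgt lk.
  by rewrite /occ lJ /= negb_or -eqn0Ngt => /andP[-> /eqP].
rewrite /kd raddf_sum /=; under eq_bigr do rewrite mcoeffZ mcoeffXUM.
(* If k is not in T, only the summand in which the differential takes k back
   to the monomial survives.  If k is in T, the remaining summands are
   recovered from the cycle condition at T minus k. *)
have [kT|kT] := boolP (k \in T); last first.
  rewrite (negPf kT) /= in kTn.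
  rewrite (bigD1 k) /=; last by rewrite inE kT.
  rewrite kTn /khomotopy (bigD1 k) /=; last first.
    rewrite !inE eqxx kJ /=; apply/forall_inP => l; rewrite !inE => /andP[/orP[/eqP ->|lT] lJ] //.
    by apply: kmin; rewrite /occ lJ lT.
  rewrite [X in (_ + X)@_ _]big1; last first.
    move=> l /andP[/andP[]]; rewrite !inE => /andP[lkT lJ] /forall_inP lmin lk.
    rewrite (negPf lk) /= in lkT.
    have : (l <= k)%N by apply: lmin; rewrite !inE eqxx kJ.
    rewrite leq_eqVlt val_eqE (negPf lk) /= => /(nu0 _ lJ)[].
    by rewrite lkT.
  rewrite addr0 mcoeffZ mcoeff_kstrip ifT; last first.
    apply/forall_inP => l lJ; apply/implyP => lk.
    by rewrite mnmBE (nu0 l lJ lk).2.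
  rewrite ksignU1 // mulrA ksign_sqr mul1r setU1K //.
  rewrite submK; last by apply/mnm_lepP => i; rewrite mnm1E; case: eqVneq => [<-|].
  rewrite big1 ?addr0 // => l /andP[]; rewrite inE => /andP[lT lJ] lk.
  case: ifP => ln; rewrite ?mulr0 // raddf_sum big1 ?mulr0 //= => i.
  rewrite !inE => /andP[/andP[iT iJ] /forall_inP imin].
  rewrite mcoeffZ mcoeff_kstrip ifF ?mulr0 //; apply/negP => /forall_inP/(_ k kJ).
  have ki : (k < i)%N.
    rewrite ltn_neqAle kmin ?andbT ?val_eqE; last first.
      by rewrite /occ iJ; case/orP: iT => [/eqP ->|->//]; rewrite ln orbT.
    by apply: contraTneq iT => <-; rewrite (negPf kT) orbF eq_sym.
  by rewrite ki mnmBE mnm1E (negPf lk) subn0 -leqn0 leqNgt kTn.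
pose T' := T :\ k.
have kT' : k \notin T' by rewrite !inE eqxx.
have TE : T = k |: T' by rewrite setD1K.
have main l : l \in J :\: T ->
   ksign l T * (if (0 < nu l)%N then (khomotopy J f (l |: T))@_(nu - U_(l)) else 0) =
   - (ksign k T' * (ksign l T' * (if (0 < nu l)%N then (f (l |: T'))@_(nu + U_(k) - U_(l)) else 0))).
  rewrite inE => /andP[lT lJ]; case: ifP => ln; last by rewrite !mulr0 oppr0.
  have kl : (k < l)%N.
    rewrite ltn_neqAle kmin ?andbT ?val_eqE; last by rewrite /occ lJ ln orbT.
    by apply: contraNneq lT => <-.
  have lk : l != k by rewrite -val_eqE gtn_eqF.
  rewrite /khomotopy (bigD1 k) /=; last first.
    rewrite !inE kT kJ orbT /=; apply/forall_inP => i; rewrite !inE => /andP[/orP[/eqP ->|iT] iJ].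
      exact: ltnW.
    by apply: kmin; rewrite /occ iJ iT.
  rewrite [X in (_ + X)@_ _]big1; last first.
    move=> i /andP[/andP[]]; rewrite !inE => /andP[iT iJ] /forall_inP imin ik.
    have : (i <= k)%N by apply: imin; rewrite !inE kT kJ orbT.
    rewrite leq_eqVlt val_eqE (negPf ik) /= => ilt.
    case/orP: iT => [/eqP il|iT]; first by move: ilt; rewrite il ltnNge (ltnW kl).
    by have [] := nu0 i iJ ilt; rewrite iT.
  rewrite addr0 mcoeffZ mcoeff_kstrip ifT; last first.
    apply/forall_inP => i iJ; apply/implyP => ik.
    by rewrite mnmBE (nu0 i iJ ik).2.
  have lT' : l \notin T' by rewrite !inE (negPf lT) andbF.
  rewrite (_ : (l |: T) :\ k = l |: T'); last first.
    by apply/setP => i; rewrite !inE; case: eqVneq => // ->; rewrite eq_sym (negPf lk).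
  rewrite (_ : (nu - U_(l) + U_(k))%MM = (nu + U_(k) - U_(l))%MM); last first.
    apply/mnmP => i; rewrite !(mnmDE, mnmBE, mnm1E); case: eqVneq => [<-|].
      by rewrite eq_sym (negPf lk) addn0 subn1 addn0 subn1.
    by rewrite !subn0.
  rewrite TE (ksignU _ kT') kl mulN1r !mulNr; congr (- _).
  rewrite mulrA mulrA; congr (_ * _).
  rewrite mulrC; congr (_ * _); rewrite ksignU //; last by rewrite in_setU1 negb_or lk lT'.
  by rewrite ltnNge (ltnW kl) /= mul1r ksignU1.
rewrite (eq_bigr _ main) sumrN.
have := congr1 (mcoeff (nu + U_(k))) (cyc T').
rewrite mcoeff0 /kd raddf_sum /= (bigD1 k) /=; last by rewrite inE kT'.
under eq_bigr do rewrite mcoeffZ mcoeffXUM.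
rewrite mcoeffZ mcoeffXUM mnmDE mnm1E eqxx addn1 /= addmK -TE.
move/(congr1 (fun z => ksign k T' * z)); rewrite mulr0 mulrDr mulrA ksign_sqr mul1r.
move/eqP; rewrite addr_eq0 => /eqP ->; congr (- _).
rewrite mulr_sumr; apply: eq_big => [l|l].
  by rewrite !inE; case: (eqVneq l k) => [->|_] /=; rewrite ?kT ?andbF ?andbT.
rewrite inE => /andP[lT lJ].
have lk : k != l by apply: contraNneq lT => <-.
by rewrite mnmDE mnm1E (negPf lk) addn0.
Qed.

End Koszul.

(** * Strands of the Koszul complex of a quotient of Q *)

Section Strand.
Variables (K : fieldType) (N : nat).
Local Notation Q := {mpoly K[N]}.
Local Notation chain := {ffun {set 'I_N} -> Q}.
Implicit Types (f g : {set 'I_N} -> Q) (J T : {set 'I_N}) (p q : Q) (d : int).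

Definition kchain i d f : Prop :=
  forall T, zhomog d (f T) /\ (#|T| != i -> f T = 0).

Lemma kchainP i d a f g : kchain i d f -> kchain i d g ->
  kchain i d (fun T => a *: f T + g T).
Proof.
move=> hf hg T; have [f1 f2] := hf T; have [g1 g2] := hg T.
split; first by apply: zhomogD => //; apply: zhomogZ.
by move=> ne; rewrite f2 // g2 // scaler0 addr0.
Qed.

Lemma kchain0 i d : kchain i d (fun=> 0).
Proof. by move=> T; split=> //; apply: zhomog0. Qed.

Lemma eq_kchain i d f g : f =1 g -> kchain i d f -> kchain i d g.
Proof. by move=> fg hf T; rewrite -fg. Qed.

Lemma kchain_kd J i d f : kchain i.+1 (d - 1) f -> kchain i d (kd J f).
Proof.
move=> hf T; split.
  by apply: zhomog_sum => k _; apply/zhomogZ/zhomogXM; have [] := hf (k |: T).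
move=> ne; apply: big1 => k; rewrite !inE => /andP[kT _].
by rewrite (hf _).2 ?mulr0 ?scaler0 // cardsU1 kT.
Qed.

Lemma kchain_homotopy J i d f : kchain i d f -> kchain i.+1 (d - 1) (khomotopy J f).
Proof.
move=> hf T; split.
  by apply: zhomog_sum => k _; apply/zhomogZ/zhomog_kstrip; have [] := hf (T :\ k).
move=> ne; apply: big1 => k; rewrite !inE => /andP[/andP[kT _] _].
rewrite (hf _).2; first by rewrite /kstrip msupp0 big_nil scaler0.
by apply: contraNneq ne => <-; rewrite (cardsD1 k) kT.
Qed.

Lemma kd_set0_coeff0 J f : (kd J f set0)@_0%MM = 0.
Proof.
rewrite raddf_sum big1 //= => k _.
by rewrite mcoeffZ mcoeffXUM mnm0E mulr0.
Qed.

(** The Koszul complex resolves K: the only homology sits at the constants of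
    homological degree 0. *)
Lemma kd_exactT i d f : kchain i d f ->
  (forall T, kd setT f T = 0) -> (f set0)@_0%MM = 0 ->
  exists2 h : chain, kchain i.+1 (d - 1) h & forall T, f T = kd setT h T.
Proof.
move=> hf cyc f0; exists [ffun T => khomotopy setT f T].
  by apply: eq_kchain (kchain_homotopy setT hf) => T; rewrite ffunE.
move=> T; rewrite (eq_kd _ _ (ffunE _)) kd_exact // => {}T nu; rewrite setIT => -> h.
by rewrite (_ : nu = 0%MM) //; apply/mnmP => l; rewrite mnm0E h ?inE.
Qed.

(** Unlike hideal, this includes the unit ideal; ideals arise below as
    annihilators and as kernels composed with ring morphisms. *)
Definition ideal_pred (I : Q -> Prop) : Prop :=
  I 0 /\ forall q x y, I x -> I y -> I (q * x + y).

Section IdealTheory.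
Variables (I : Q -> Prop) (idI : ideal_pred I).

Lemma ideal_predM q x : I x -> I (q * x).
Proof. by move=> Ix; rewrite -[_ * _]addr0; apply: idI.2 => //; apply: idI.1. Qed.

Lemma ideal_predZ c x : I x -> I (c *: x).
Proof. by rewrite -mul_mpolyC; apply: ideal_predM. Qed.

Lemma ideal_predD x y : I x -> I y -> I (x + y).
Proof. by move=> Ix Iy; rewrite -[x]mul1r; apply: idI.2. Qed.

Lemma ideal_predN x : I x -> I (- x).
Proof. by move=> Ix; rewrite -mulN1r; apply: ideal_predM. Qed.

Lemma ideal_predB x y : I x -> I y -> I (x - y).
Proof. by move=> Ix /ideal_predN; apply: ideal_predD. Qed.

Lemma ideal_pred_eq x y : I (x - y) -> (I x <-> I y).
Proof.
move=> h; split=> [Ix|Iy]; last by rewrite -(subrK y x); apply: ideal_predD.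
by rewrite -[y](subKr x); apply: ideal_predB.
Qed.

Lemma ideal_pred_sum (A : finType) (P : pred A) (F : A -> Q) :
  (forall i, P i -> I (F i)) -> I (\sum_(i | P i) F i).
Proof. by move=> h; elim/big_ind: _ => //; [apply: idI.1|apply: ideal_predD]. Qed.

Lemma ideal_pred_kd J f T : (forall T', I (f T')) -> I (kd J f T).
Proof.
by move=> h; apply: ideal_pred_sum => k _; apply: ideal_predZ; apply: ideal_predM.
Qed.

End IdealTheory.

Variable I : Q -> Prop.

(** Cycles and boundaries of Koszul (x) Q / I at homological degree i and
    internal degree d, with chains lifted to Q. *)
Definition kcycle i d (f : chain) : Prop :=
  kchain i d f /\ forall T, I (kd setT f T).

Definition kbound i d (f : chain) : Prop :=
  kchain i d f /\ exists2 g : chain, kchain i.+1 (d - 1) g &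
    forall T, I (f T - kd setT g T).

Lemma subspace_kchain i d : subspace_pred (fun f : chain => kchain i d f).
Proof.
split; first by apply: eq_kchain (kchain0 i d) => T; rewrite ffunE.
by move=> c x y hx hy; apply: eq_kchain (kchainP c hx hy) => T; rewrite !ffunE.
Qed.

Hypothesis idI : ideal_pred I.

Lemma subspace_kcycle i d : subspace_pred (kcycle i d).
Proof.
split.
  split; first exact: (subspace_kchain i d).1.
  move=> T; rewrite (eq_kd _ _ (g := fun=> 0)) ?kd0; first exact: idI.1.
  by move=> T'; rewrite ffunE.
move=> c x y [hx Ix] [hy Iy]; split; first exact: (subspace_kchain i d).2.
move=> T; rewrite (eq_kd _ _ (g := fun T => c *: x T + y T)); last first.
  by move=> T'; rewrite !ffunE.
by rewrite kdP; apply: ideal_predD => //; apply: ideal_predZ.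
Qed.

Lemma subspace_kbound i d : subspace_pred (kbound i d).
Proof.
split.
  split; first exact: (subspace_kchain i d).1.
  exists 0; first exact: (subspace_kchain _ _).1.
  move=> T; rewrite (eq_kd _ _ (g := fun=> 0)) ?kd0 ?ffunE ?subr0; first exact: idI.1.
  by move=> T'; rewrite ffunE.
move=> c x y [hx [g hg Ig]] [hy [h hh Ih]]; split; first exact: (subspace_kchain i d).2.
exists (c *: g + h); first exact: (subspace_kchain _ _).2.
move=> T; rewrite (eq_kd _ _ (g := fun T => c *: g T + h T)); last first.
  by move=> T'; rewrite !ffunE.
rewrite kdP !ffunE opprD addrACA -scalerBr.
by apply: ideal_predD => //; apply: ideal_predZ.
Qed.

End Strand.

(** * Tor of a cyclic module is Koszul homology *)

(** M is the quotient of Q by a homogeneous ideal, presented through the class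
    u0 of 1. *)
Record cyclic_graded (K : fieldType) (N : nat) (M : lmodType {mpoly K[N]})
    (piece : int -> M -> Prop) (u0 : M) : Prop := CyclicGraded {
  cyclic_gen : forall u, exists q, u = q *: u0;
  cyclic_piece : forall d u, piece d u -> exists2 q, zhomog d q & u = q *: u0;
  cyclic_homog : forall d q, q *: u0 = 0 -> zcomp d q *: u0 = 0 }.

Section Balance.
Variables (K : fieldType) (N : nat) (M : lmodType {mpoly K[N]}).
Variables (piece : int -> M -> Prop) (u0 : M).
Hypothesis cyc : cyclic_graded piece u0.
Variable F : free_resolution piece.
Local Notation Q := {mpoly K[N]}.
Local Notation chain := {ffun {set 'I_N} -> Q}.
Local Notation rk := (fr_rank F).
Local Notation fchain q := {ffun {set 'I_N} * 'I_(rk q) -> Q}.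

Definition ann (q : Q) : Prop := q *: u0 = 0.

Lemma ann_ideal : ideal_pred ann.
Proof.
split=> [|q x y]; rewrite /ann; first exact: scale0r.
by move=> hx hy; rewrite scalerDl -scalerA hx hy scaler0 addr0.
Qed.

(* The augmentation, as a column of homogeneous polynomials: the resolution is
   extended by one step to F_1 -> F_0 -> Q, exact modulo the annihilator. *)
Variable gam : 'I_(rk 0) -> Q.
Hypothesis gam_homog : forall l, zhomog (fr_deg l) (gam l).
Hypothesis gamE : forall l, fr_aug F (delta_mx 0 l) = gam l *: u0.

Lemma fr_augE v : fr_aug F v = (\sum_l v 0 l * gam l) *: u0.
Proof.
rewrite {1}[v]row_sum_delta linear_sum scaler_suml; apply: eq_bigr => l _.
by rewrite linearZ /= gamE scalerA.
Qed.

Lemma aug_exact d q : zhomog d q -> exists2 w : 'I_(rk 0) -> Q,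
  forall l, zhomog (d - fr_deg l) (w l) & ann (q - \sum_l w l * gam l).
Proof.
move=> hq; have [v vE] := fr_aug_surj F (q *: u0).
exists (fun l => zcomp (d - fr_deg l) (v 0 l)).
  by move=> l; apply: zhomog_zcomp.
have /(cyclic_homog cyc d) : ann (q - \sum_l v 0 l * gam l).
  by rewrite /ann scalerBl -fr_augE vE subrr.
rewrite linearB /= (zcomp_id hq) linear_sum /=.
by under eq_bigr do rewrite (zcompMr _ _ (gam_homog _)).
Qed.

(** The kernel of F_q -> F_(q-1), where F_(-1) = M. *)
Definition vker q : ('I_(rk q) -> Q) -> Prop :=
  match q with
  | 0 => fun v => ann (\sum_l v l * gam l)
  | q'.+1 => fun v => forall l', \sum_l v l * fr_dif F q' l l' = 0
  end.

Lemma vker_dif q (w : 'I_(rk q.+1) -> Q) :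
  vker (fun l => \sum_k w k * fr_dif F q k l).
Proof.
have E : \row_l \sum_k w k * fr_dif F q k l = \row_k w k *m fr_dif F q.
  by apply/rowP => l; rewrite !mxE; apply: eq_bigr => k _; rewrite mxE.
case: q w E => [|q] w E /=.
  have /= h := (@fr_exact0 _ _ _ _ F _).2 (ex_intro _ _ E).
  rewrite fr_augE in h; rewrite /ann -[RHS]h; congr (_ *: _).
  by apply: eq_bigr => l _; rewrite mxE.
have /= h := (@fr_exactS _ _ _ _ F _ _).2 (ex_intro _ _ E).
move=> l'; have /rowP/(_ l') := h; rewrite !mxE => h'; rewrite -[RHS]h'.
by apply: eq_bigr => l _; rewrite mxE.
Qed.

Lemma vker_exact q j (v : 'I_(rk q) -> Q) :
  (forall l, zhomog (j - fr_deg l) (v l)) -> vker v ->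
  exists2 w : 'I_(rk q.+1) -> Q, forall k, zhomog (j - fr_deg k) (w k) &
    forall l, v l = \sum_k w k * fr_dif F q k l.
Proof.
move=> hv kv; have [w wE] : exists w, \row_l v l = w *m fr_dif F q.
  case: q v kv {hv} => [|q] v kv.
    apply/(@fr_exact0 _ _ _ _ F); rewrite fr_augE; rewrite /= /ann in kv; rewrite -[RHS]kv.
    by congr (_ *: _); apply: eq_bigr => l _; rewrite mxE.
  apply/(@fr_exactS _ _ _ _ F)/rowP => l'; rewrite !mxE -[RHS](kv l').
  by apply: eq_bigr => l _; rewrite mxE.
exists (fun k => zcomp (j - fr_deg k) (w 0 k)).
  by move=> k; apply: zhomog_zcomp.
move=> l; rewrite -(zcomp_id (hv l)).
have -> : v l = \sum_k w 0 k * fr_dif F q k l.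
  by have /rowP/(_ l) := wE; rewrite !mxE.
rewrite linear_sum /=; apply: eq_bigr => k _.
rewrite (zcompMr _ _ (fr_dif_homog _ _)); congr (zcomp _ _ * _).
by rewrite opprB addrA subrK.
Qed.

Definition fpart q (f : fchain q) (l : 'I_(rk q)) : {set 'I_N} -> Q :=
  fun T => f (T, l).

(** The elements of wedge^p (x) F_q of total degree j. *)
Definition fhomog q p j (f : fchain q) : Prop :=
  forall l, kchain p (j - p%:Z - fr_deg l) (fpart f l).

Definition fkd q (f : fchain q) : fchain q :=
  [ffun x => kd setT (fpart f x.2) x.1].

Definition fdif q (f : fchain q.+1) : fchain q :=
  [ffun x => \sum_l fpart f l x.1 * fr_dif F q l x.2].

Definition fker q (f : fchain q) : Prop := forall T, vker (fpart f ^~ T).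

Definition fconst q (f : fchain q) (l : 'I_(rk q)) : K := (f (set0, l))@_0%MM.

Lemma fpart_lin q a (f g : fchain q) l T :
  fpart (a *: f + g) l T = a *: fpart f l T + fpart g l T.
Proof. by rewrite /fpart !ffunE. Qed.

Lemma fkd_is_linear q : linear (@fkd q).
Proof.
move=> a f g; apply/ffunP => -[T l]; rewrite !ffunE /= -kdP.
by apply: eq_kd => T'; apply: fpart_lin.
Qed.

Lemma fdif_is_linear q : linear (@fdif q).
Proof.
move=> a f g; apply/ffunP => -[T l]; rewrite !ffunE /= scaler_sumr -big_split /=.
by apply: eq_bigr => l' _; rewrite fpart_lin mulrDl scalerAl.
Qed.

HB.instance Definition _ q :=
  GRing.isLinear.Build K (fchain q) (fchain q) _ (@fkd q) (@fkd_is_linear q).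
HB.instance Definition _ q :=
  GRing.isLinear.Build K (fchain q.+1) (fchain q) _ (@fdif q) (@fdif_is_linear q).

Lemma fkd_fdif q (f : fchain q.+1) : fkd (fdif f) = fdif (fkd f).
Proof.
apply/ffunP => -[T l]; rewrite !ffunE /=.
rewrite (eq_kd _ _ (g := fun T' => \sum_k fpart f k T' * fr_dif F q k l)); last first.
  by move=> T'; rewrite /fpart ffunE.
by rewrite kd_sumM; apply: eq_bigr => k _; rewrite {2}/fpart ffunE.
Qed.

Lemma fkd_fkd q (f : fchain q) : fkd (fkd f) = 0.
Proof.
apply/ffunP => -[T l]; rewrite !ffunE /=.
by rewrite (eq_kd _ _ (g := kd setT (fpart f l))) ?kd_kd // => T'; rewrite /fpart ffunE.
Qed.

Lemma fker_fdif q (f : fchain q.+1) : fker (fdif f).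
Proof.
move=> T; have -> : (fpart (fdif f))^~ T = fun l => \sum_k fpart f k T * fr_dif F q k l.
  by apply/funext => l; rewrite /fpart ffunE.
exact: vker_dif.
Qed.

Lemma fkerS q (f : fchain q.+1) : fker f <-> fdif f = 0.
Proof.
split=> [h|h T l].
  by apply/ffunP => -[T l]; rewrite !ffunE; have /= := h T l.
by have /ffunP/(_ (T, l)) := h; rewrite !ffunE.
Qed.

Lemma fdif_fdif q (f : fchain q.+2) : fdif (fdif f) = 0.
Proof. by apply/fkerS/fker_fdif. Qed.

Lemma fconst_fkd q (f : fchain q) l : fconst (fkd f) l = 0.
Proof. by rewrite /fconst ffunE kd_set0_coeff0. Qed.

Lemma fconst_fdif q (f : fchain q.+1) l :
  fconst (fdif f) l = \sum_k fconst f k * (fr_dif F q k l)@_0%MM.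
Proof.
by rewrite /fconst ffunE raddf_sum; apply: eq_bigr => k _ /=; rewrite rmorphM.
Qed.

Lemma fconst0 q p j (f : fchain q) l : fhomog p.+1 j f -> fconst f l = 0.
Proof. by move=> /(_ l set0)[_]; rewrite cards0 /fconst /fpart => -> //; rewrite mcoeff0. Qed.

Lemma fhomog_lin q p j a (f g : fchain q) :
  fhomog p j f -> fhomog p j g -> fhomog p j (a *: f + g).
Proof.
move=> hf hg l; apply: eq_kchain (kchainP a (hf l) (hg l)) => T.
by rewrite fpart_lin.
Qed.

Lemma fhomog0 q p j : fhomog p j (0 : fchain q).
Proof. by move=> l T; rewrite /fpart ffunE; split=> //; apply: zhomog0. Qed.

Lemma fhomogB q p j (f g : fchain q) :
  fhomog p j f -> fhomog p j g -> fhomog p j (f - g).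
Proof. by move=> hf hg; rewrite addrC -scaleN1r; apply: fhomog_lin. Qed.

Lemma fhomog_fkd q p j (f : fchain q) : fhomog p.+1 j f -> fhomog p j (fkd f).
Proof.
move=> hf l; apply: (eq_kchain (f := kd setT (fpart f l))).
  by move=> T; rewrite /fpart ffunE.
apply: kchain_kd; rewrite (_ : _ - 1 = j - p.+1%:Z - fr_deg l) //.
by rewrite -addn1 PoszD; rewrite opprD -!addrA [- 1 + _]addrC.
Qed.

Lemma fhomog_fdif q p j (f : fchain q.+1) : fhomog p j f -> fhomog p j (fdif f).
Proof.
move=> hf l T; rewrite /fpart ffunE /=; split.
  apply: zhomog_sum => k _.
  have -> : j - p%:Z - fr_deg l = j - p%:Z - fr_deg k + (fr_deg k - fr_deg l).
    by rewrite addrA subrK.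
  by apply: zhomogM (fr_dif_homog _ _); have [] := hf k T.
by move=> ne; apply: big1 => k _; rewrite (hf k T).2 // mul0r.
Qed.

Lemma fdif_exact q p j (f : fchain q) : fhomog p j f -> fker f ->
  exists2 h : fchain q.+1, fhomog p j h & f = fdif h.
Proof.
move=> hf kf.
have /(@choice _ _) [w wP] T : exists w : 'I_(rk q.+1) -> Q,
    (forall k, zhomog (j - p%:Z - fr_deg k) (w k)) /\
    (forall l, fpart f l T = \sum_k w k * fr_dif F q k l).
  have [|w w1 w2] := @vker_exact q (j - p%:Z) ((fpart f)^~ T) _ (kf T); last by exists w.
  by move=> l; have [] := hf l T.
exists [ffun x : {set 'I_N} * 'I_(rk q.+1) => if #|x.1| == p then w x.1 x.2 else 0].
  move=> l T; rewrite /fpart ffunE /=; case: eqP => _; split=> //; last exact: zhomog0.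
  exact: (wP T).1.
apply/ffunP => -[T l]; rewrite ffunE /= -/(fpart f l T).
case: (eqVneq #|T| p) => [e|ne].
  by rewrite (wP T).2; apply: eq_bigr => k _; rewrite /fpart ffunE /= e eqxx.
rewrite (hf l T).2 // big1 // => k _; rewrite /fpart ffunE /= (negPf ne) mul0r //.
Qed.

Lemma fkd_exact q p j (f : fchain q) : fhomog p j f -> fkd f = 0 ->
  (forall l, fconst f l = 0) ->
  exists2 h : fchain q, fhomog p.+1 j h & f = fkd h.
Proof.
move=> hf kf cf.
have /(@choice _ _) [w wP] l : exists h : chain,
    kchain p.+1 (j - p%:Z - fr_deg l - 1) h /\
    (forall T, fpart f l T = kd setT h T).
  have [||h h1 h2] := @kd_exactT _ _ p _ _ (hf l); [|exact: cf|by exists h].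
  by move=> T; have /ffunP/(_ (T, l)) := kf; rewrite !ffunE.
exists [ffun x => w x.2 x.1].
  move=> l; apply: (eq_kchain (f := w l)); first by move=> T; rewrite /fpart ffunE.
  rewrite (_ : j - p.+1%:Z - _ = j - p%:Z - fr_deg l - 1); first exact: (wP l).1.
  by rewrite -addn1 PoszD opprD -!addrA [- 1 + _]addrC.
apply/ffunP => -[T l]; rewrite ffunE /= -/(fpart f l T) (wP l).2.
by apply: eq_kd => T'; rewrite /fpart ffunE.
Qed.

(** At the place (p, q) of the double complex wedge^p (x) F_q, with the two
    commuting differentials fkd and fdif, these are (ker fkd /\ ker fdif) and
    im (fkd o fdif).  For p = 0 the condition on constants is the kernel of
    F_q -> F_q (x) K, the augmentation of the row. *)
Definition zz_cycle p q j (f : fchain q) : Prop :=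
  [/\ fhomog p j f, fkd f = 0, forall l, fconst f l = 0 & fker f].

Definition zz_bound p q j (f : fchain q) : Prop :=
  exists2 h : fchain q.+1, fhomog p.+1 j h & f = fkd (fdif h).

Lemma vker_lin q a (v w : 'I_(rk q) -> Q) : vker v -> vker w ->
  vker (fun l => a *: v l + w l).
Proof.
have E (c : 'I_(rk q) -> Q) : \sum_l (a *: v l + w l) * c l =
    a *: (\sum_l v l * c l) + \sum_l w l * c l.
  rewrite scaler_sumr -big_split; apply: eq_bigr => l _ /=.
  by rewrite mulrDl scalerAl.
case: q v w E => [|q] v w E /= hv hw.
  rewrite E; apply: ideal_predD => //; try exact: ann_ideal.
  by apply: ideal_predZ => //; apply: ann_ideal.
by move=> l'; rewrite E hv hw scaler0 addr0.
Qed.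

Lemma subspace_zz_cycle p q j : subspace_pred (@zz_cycle p q j).
Proof.
split.
  split; [exact: fhomog0|exact: linear0|by move=> l; rewrite /fconst ffunE mcoeff0|].
  move=> T; have -> : (fpart (0 : fchain q))^~ T = fun=> 0.
    by apply/funext => l; rewrite /fpart ffunE.
  case: (q) => [|q'] /=; last by move=> l'; rewrite big1 // => l _; rewrite mul0r.
  by rewrite big1; [exact: ann_ideal.1|move=> l _; rewrite mul0r].
move=> a f g [f1 f2 f3 f4] [g1 g2 g3 g4]; split.
- exact: fhomog_lin.
- by rewrite linearP /= f2 g2 scaler0 addr0.
- move=> l; rewrite /fconst !ffunE mcoeffD mcoeffZ.
  by have := f3 l; have := g3 l; rewrite /fconst => -> ->; rewrite mulr0 addr0.
- move=> T; have -> : (fpart (a *: f + g))^~ T = fun l => a *: fpart f l T + fpart g l T.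
    by apply/funext => l; rewrite fpart_lin.
  exact: vker_lin.
Qed.

(** The subquotients at (p + 1, q) and (p, q + 1) are both isomorphic to one
    at (p + 1, q + 1): any c there has an image under fdif at (p + 1, q) and
    one under fkd at (p, q + 1).  Exactness of the column provides c for a
    given element at (p + 1, q), exactness of the row for one at (p, q + 1). *)
Lemma zz_step p q j k :
  qdim (@zz_cycle p q.+1 j) (zz_bound p j) k ->
  qdim (@zz_cycle p.+1 q j) (zz_bound p.+1 j) k.
Proof.
apply: (@qdim_transfer _ _ _ (fun c2 c1 => exists2 c : fchain q.+1,
   fhomog p.+1 j c & fkd c = c2 /\ fdif c = c1)).
- exact: subspace_zz_cycle.
- exact: subspace_zz_cycle.
split.
- split; first by exists 0; [exact: fhomog0|rewrite !linear0].
  move=> a x y x' y' [c hc [<- <-]] [d hd [<- <-]].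
  by exists (a *: c + d); [exact: fhomog_lin|rewrite !linearP].
- move=> c2 [h1 h2 h3 h4]; have [c hc e] := fkd_exact h1 h2 h3.
  exists (fdif c); last by exists c.
  split; [exact: fhomog_fdif| |by move=> l; apply: fconst0 (fhomog_fdif hc)|exact: fker_fdif].
  by rewrite fkd_fdif -e; apply/fkerS.
- move=> c1 [h1 h2 h3 h4]; have [c hc e] := fdif_exact h1 h4.
  exists (fkd c); last by exists c.
  split; [exact: fhomog_fkd|exact: fkd_fkd|exact: fconst_fkd|].
  by apply/fkerS; rewrite -fkd_fdif -e.
move=> _ _ _ _ [c hc [<- <-]]; split.
  case=> h hh e; have z : fkd (c - fdif h) = 0 by rewrite linearB /= e subrr.
  have hch := fhomogB hc (fhomog_fdif hh).
  have [g hg ce] := fkd_exact hch z (fun l => fconst0 l hch).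
  exists g => //; rewrite -(subrK (fdif h) c) ce linearD /= fdif_fdif addr0.
  exact/esym/fkd_fdif.
case=> h hh e; have z : fdif (c - fkd h) = 0 by rewrite linearB /= e fkd_fdif subrr.
have hch := fhomogB hc (fhomog_fkd hh).
have [g hg ce] := fdif_exact hch ((fkerS _).2 z).
by exists g => //; rewrite -(subrK (fkd h) c) ce linearD /= fkd_fkd addr0.
Qed.


Lemma tensK_pieceP q j (v : 'rV[K]_(rk q)) :
  reflect (forall l, fr_deg l != j -> v 0 l = 0) (v \in tensK_piece F q j).
Proof.
apply: (iffP idP) => [/memv_sumP[vs vsP ->] l lj|h].
  rewrite summxE big1 // => k /eqP kj; have /vlineP[a ->] := vsP k (introT eqP kj).
  rewrite !mxE eqxx /= (_ : (l == k) = false) ?mulr0 //.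
  by apply: contraNF lj => /eqP ->; rewrite kj.
rewrite [v]row_sum_delta; apply: memv_suml => l _.
have [e|ne] := eqVneq (fr_deg l) j; last by rewrite h // scale0r mem0v.
apply: memvZ; apply: (subvP (sumv_sup l _ (subvv _))); first by rewrite e.
exact: memv_line.
Qed.

Lemma tensK_difE q (v : 'rV[K]_(rk q.+1)) l :
  tensK_dif F q v 0 l = \sum_k v 0 k * (fr_dif F q k l)@_0%MM.
Proof. by rewrite lfunE /= mxE; apply: eq_bigr => k _; rewrite mxE. Qed.

Definition fconst_row q (f : fchain q) : 'rV[K]_(rk q) := \row_l fconst f l.

Lemma fconst_row_is_linear q : linear (@fconst_row q).
Proof.
move=> a f g; apply/rowP => l.
by rewrite !mxE /fconst !ffunE mcoeffD mcoeffZ.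
Qed.

HB.instance Definition _ q :=
  GRing.isLinear.Build K (fchain q) 'rV[K]_(rk q) _ (@fconst_row q)
    (@fconst_row_is_linear q).

Lemma fconst_row_fdif q (f : fchain q.+1) :
  fconst_row (fdif f) = tensK_dif F q (fconst_row f).
Proof.
by apply/rowP => l; rewrite tensK_difE mxE fconst_fdif; apply: eq_bigr => k _; rewrite mxE.
Qed.

Lemma fconst_row_fkd q (f : fchain q) : fconst_row (fkd f) = 0.
Proof. by apply/rowP => l; rewrite !mxE fconst_fkd. Qed.

Lemma fconst_row_piece q j (f : fchain q) :
  fhomog 0 j f -> fconst_row f \in tensK_piece F q j.
Proof.
move=> hf; apply/tensK_pieceP => l ne; rewrite mxE.
apply: (zhomog_coeff0 (hf l set0).1).
by rewrite subr0 subr_eq0 eq_sym.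
Qed.

Lemma fconst_lift q j v : v \in tensK_piece F q j ->
  exists2 f : fchain q, fhomog 0 j f & fconst_row f = v.
Proof.
move=> /tensK_pieceP hv.
exists [ffun x : {set 'I_N} * 'I_(rk q) => if x.1 == set0 then (v 0 x.2)%:MP else 0].
  move=> l T; rewrite /fpart ffunE /= cards_eq0; case: (T == set0) => /=; last first.
    by split=> //; apply: zhomog0.
  split=> //; rewrite subr0; have [->|ne] := eqVneq (fr_deg l) j.
    by rewrite subrr; apply: zhomogC.
  by rewrite hv // mpolyC0; apply: zhomog0.
apply/rowP => l; rewrite mxE /fconst ffunE /= eqxx.
by rewrite mcoeffC eqxx mulr1.
Qed.

Lemma fkd_homog0 q j (f : fchain q) : fhomog 0 j f -> fkd f = 0.
Proof.
move=> hf; apply/ffunP => -[T l]; rewrite !ffunE /kd big1 //= => k _.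
rewrite (hf l _).2 ?mulr0 ?scaler0 // cards_eq0; apply/set0Pn.
by exists k; rewrite !inE eqxx.
Qed.

(** Lifting a boundary of F (x) K to F leaves an error with zero constants,
    which is a Koszul boundary. *)
Lemma tor_boundariesP q j (f : fchain q) : fhomog 0 j f ->
  (fconst_row f \in tor_boundaries F q j) <->
  (exists2 h : fchain q.+1, fhomog 0 j h &
   exists2 g : fchain q, fhomog 1 j g & f = fdif h + fkd g).
Proof.
move=> hf; split=> [/memv_imgP[w /fconst_lift[h hh <-] e]|[h hh [g hg ->]]].
  exists h => //.
  have hfh := fhomogB hf (fhomog_fdif hh).
  have [||g hg e'] := fkd_exact hfh; last by exists g; rewrite // -e' addrC subrK.
    by rewrite linearB /= fkd_fdif !(@fkd_homog0 _ j) // linear0 subrr.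
  move=> l; have /rowP/(_ l) : fconst_row (f - fdif h) = 0.
    by rewrite linearB /= fconst_row_fdif -e subrr.
  by rewrite !mxE.
rewrite linearD /= fconst_row_fkd addr0 fconst_row_fdif.
exact/memv_img/fconst_row_piece.
Qed.

Lemma subspace_vspace (W : vectType K) (U : {vspace W}) :
  subspace_pred (fun v : W => v \in U).
Proof. by split=> [|c x y hx hy]; [exact: mem0v|exact/memvD/hy/memvZ]. Qed.

(** The same step at the end of a row, where the place next to (0, q + 1) is
    F_(q+1) (x) K. *)
Lemma zz_end q j k :
  qdim (fun v => v \in tor_cycles F q.+1 j) (fun v => v \in tor_boundaries F q.+1 j) k ->
  qdim (@zz_cycle 0 q j) (zz_bound 0 j) k.
Proof.
apply: (@qdim_transfer _ _ _ (fun v c1 => exists2 c : fchain q.+1,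
   fhomog 0 j c & fconst_row c = v /\ fdif c = c1)).
- exact: subspace_vspace.
- exact: subspace_zz_cycle.
split.
- split; first by exists 0; [exact: fhomog0|rewrite !linear0].
  move=> a x y x' y' [c hc [<- <-]] [d hd [<- <-]].
  by exists (a *: c + d); [exact: fhomog_lin|rewrite !linearP].
- move=> v /memv_capP[/fconst_lift[c hc <-]]; rewrite memv_ker => /eqP dc.
  exists (fdif c); last by exists c.
  have hdc := fhomog_fdif hc; split=> //; [exact: fkd_homog0 hdc| |exact: fker_fdif].
  by move=> l; have /rowP/(_ l) := dc; rewrite -fconst_row_fdif !mxE.
- move=> c1 [h1 h2 h3 h4]; have [c hc e] := fdif_exact h1 h4.
  exists (fconst_row c); last by exists c.
  apply/memv_capP; split; first exact: fconst_row_piece.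
  rewrite memv_ker -fconst_row_fdif -e; apply/eqP/rowP => l.
  by rewrite !mxE h3.
move=> _ _ _ _ [c hc [<- <-]]; split.
  case/(tor_boundariesP hc) => h hh [g hg ->]; exists g => //.
  by rewrite linearD /= fdif_fdif add0r fkd_fdif.
case=> g hg e; apply/(tor_boundariesP hc).
have z : fdif (c - fkd g) = 0 by rewrite linearB /= e fkd_fdif subrr.
have [h hh e'] := fdif_exact (fhomogB hc (fhomog_fkd hg)) ((fkerS _).2 z).
by exists h => //; exists g; rewrite // -e' subrK.
Qed.

Definition faug (f : fchain 0) : chain :=
  [ffun T => \sum_l fpart f l T * gam l].

Lemma faug_is_linear : linear faug.
Proof.
move=> a f g; apply/ffunP => T; rewrite !ffunE /= scaler_sumr -big_split /=.
by apply: eq_bigr => l' _; rewrite fpart_lin mulrDl scalerAl.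
Qed.

HB.instance Definition _ :=
  GRing.isLinear.Build K (fchain 0) chain _ faug faug_is_linear.

Lemma faugB f g T : faug (f - g) T = faug f T - faug g T.
Proof. by rewrite linearB !ffunE. Qed.

Lemma kd_faug f T : kd setT (faug f) T = faug (fkd f) T.
Proof.
rewrite (eq_kd _ _ (ffunE _)) kd_sumM ffunE.
by apply: eq_bigr => l _; rewrite {2}/fpart ffunE.
Qed.

Lemma faug_homog p j f : fhomog p j f -> kchain p (j - p%:Z) (faug f).
Proof.
move=> hf T; rewrite ffunE; split.
  apply: zhomog_sum => l _; rewrite -[_ - _](subrK (fr_deg l)).
  by apply: zhomogM (gam_homog l); have [] := hf l T.
by move=> ne; apply: big1 => l _; rewrite (hf l T).2 // mul0r.
Qed.

Lemma fker0P (f : fchain 0) : fker f <-> forall T, ann (faug f T).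
Proof. by split=> h T; have := h T; rewrite ffunE. Qed.

Lemma faug_exact p j (c : chain) : kchain p (j - p%:Z) c ->
  exists2 f : fchain 0, fhomog p j f & forall T, ann (c T - faug f T).
Proof.
move=> hc.
have /(@choice _ _) [w wP] T : exists w : 'I_(rk 0) -> Q,
    (forall l, zhomog (j - p%:Z - fr_deg l) (w l)) /\
    ann (c T - \sum_l w l * gam l).
  by have [w w1 w2] := aug_exact (hc T).1; exists w.
exists [ffun x : {set 'I_N} * 'I_(rk 0) => if #|x.1| == p then w x.1 x.2 else 0].
  move=> l T; rewrite /fpart ffunE /=; case: eqP => _; split=> //; last exact: zhomog0.
  exact: (wP T).1.
move=> T; rewrite ffunE; have [e|ne] := eqVneq #|T| p; last first.
  rewrite (hc T).2 // big1 ?subr0; first exact: ann_ideal.1.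
  by move=> l _; rewrite /fpart ffunE /= (negPf ne) mul0r.
under eq_bigr do rewrite /fpart ffunE /= e eqxx.
exact: (wP T).2.
Qed.

Lemma ann_faug_fdif h T : ann (faug (fdif h) T).
Proof. by move: T; apply/fker0P/fker_fdif. Qed.

Lemma zz_bound_faug p j f : fhomog p j f ->
  (exists2 h : fchain 1, fhomog p j h &
   exists2 g : fchain 0, fhomog p.+1 j g & f = fdif h + fkd g) <->
  kbound ann p (j - p%:Z) (faug f).
Proof.
have sh : j - p%:Z - 1 = j - p.+1%:Z by rewrite -addn1 PoszD opprD addrA.
have aI := ann_ideal.
move=> hf; split=> [[h hh [g hg fE]]|[_ [g]]].
  split; first exact: faug_homog.
  exists (faug g); first by rewrite sh; apply: faug_homog.
  move=> T; rewrite kd_faug fE linearD /= ffunE addrK; exact: ann_faug_fdif.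
rewrite sh => /faug_exact[G hG gG] Ig.
have hfG := fhomogB hf (fhomog_fkd hG).
have [|h hh e] := fdif_exact hfG; last by exists h => //; exists G; rewrite // -e subrK.
apply/fker0P => T; rewrite faugB -kd_faug -(subrKA (kd setT g T)).
apply: ideal_predD => //; rewrite -kdB; exact: ideal_pred_kd.
Qed.

(** The same step at the start of a column, where the place next to
    (p + 1, 0) is wedge^(p+1) (x) M. *)
Lemma zz_start p j k :
  qdim (@zz_cycle p 0 j) (zz_bound p j) k ->
  qdim (kcycle ann p.+1 (j - p.+1%:Z)) (kbound ann p.+1 (j - p.+1%:Z)) k.
Proof.
have aI := ann_ideal.
apply: (@qdim_transfer _ _ _ (fun (c2 : fchain 0) (c1 : chain) => exists2 c : fchain 0,
   fhomog p.+1 j c & fkd c = c2 /\ forall T, ann (c1 T - faug c T))).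
- exact: subspace_zz_cycle.
- exact: subspace_kcycle.
split.
- split.
    exists 0; [exact: fhomog0|rewrite !linear0; split=> // T; rewrite ffunE subr0].
    exact: aI.1.
  move=> a x y x' y' [c hc [<- cx]] [d hd [<- dy]].
  exists (a *: c + d); [exact: fhomog_lin|rewrite !linearP; split=> // T].
  rewrite !ffunE opprD addrACA -scalerBr; apply: ideal_predD => //.
    by apply: ideal_predZ => //; have := cx T; rewrite !ffunE.
  by have := dy T; rewrite !ffunE.
- move=> c2 [h1 h2 h3 h4]; have [c hc e] := fkd_exact h1 h2 h3.
  exists (faug c).
    split; first exact: faug_homog.
    by move=> T; rewrite kd_faug -e; move: T; apply/fker0P.
  exists c => //; split=> // T; rewrite subrr; exact: aI.1.
- move=> c1 [h1 Ic]; have [c hc ce] := faug_exact h1.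
  exists (fkd c); last by exists c.
  split; [exact: fhomog_fkd|exact: fkd_fkd|exact: fconst_fkd|].
  apply/fker0P => T; rewrite -kd_faug; apply/(ideal_pred_eq aI _).1: (Ic T).
  by rewrite -kdB; apply: ideal_pred_kd.
move=> _ c1 _ [h1 _] [c hc [<- ce]].
suff -> : kbound ann p.+1 (j - p.+1%:Z) c1 <-> kbound ann p.+1 (j - p.+1%:Z) (faug c).
  rewrite -(zz_bound_faug hc); split.
    case=> h hh e; exists h => //.
    have hch := fhomogB hc (fhomog_fdif hh).
    have z : fkd (c - fdif h) = 0 by rewrite linearB /= e fkd_fdif subrr.
    have [g hg ce'] := fkd_exact hch z (fun l => fconst0 l hch).
    by exists g; rewrite // -ce' addrC subrK.
  case=> h hh [g hg ->]; exists h => //.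
  by rewrite linearD /= fkd_fkd addr0 fkd_fdif.
split=> [][_ [g hg Ig]].
  split; first exact: faug_homog.
  exists g => // T; rewrite -[faug c T](subKr (c1 T)) addrAC.
  by apply: ideal_predB.
split=> //; exists g => // T; rewrite -[c1 T](subrK (faug c T)) -addrA.
by apply: ideal_predD.
Qed.

(** In homological degree 0 both ends of the walk coincide. *)
Lemma zz_start0 j k :
  qdim (fun v => v \in tor_cycles F 0 j) (fun v => v \in tor_boundaries F 0 j) k ->
  qdim (kcycle ann 0 (j - 0%:Z)) (kbound ann 0 (j - 0%:Z)) k.
Proof.
have aI := ann_ideal.
apply: (@qdim_transfer _ _ _ (fun (v : 'rV_(rk 0)) (c1 : chain) => exists2 c : fchain 0,
   fhomog 0 j c & fconst_row c = v /\ forall T, ann (c1 T - faug c T))).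
- exact: subspace_vspace.
- exact: subspace_kcycle.
split.
- split.
    exists 0; [exact: fhomog0|rewrite !linear0; split=> // T; rewrite ffunE subr0].
    exact: aI.1.
  move=> a x y x' y' [c hc [<- cx]] [d hd [<- dy]].
  exists (a *: c + d); [exact: fhomog_lin|rewrite !linearP; split=> // T].
  rewrite !ffunE opprD addrACA -scalerBr; apply: ideal_predD => //.
    by apply: ideal_predZ => //; have := cx T; rewrite !ffunE.
  by have := dy T; rewrite !ffunE.
- move=> v /fconst_lift[c hc <-]; exists (faug c).
    split; first exact: faug_homog.
    by move=> T; rewrite kd_faug (fkd_homog0 hc) linear0 ffunE; exact: aI.1.
  exists c => //; split=> // T; rewrite subrr; exact: aI.1.
- move=> c1 [h1 Ic]; have [c hc ce] := faug_exact h1.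
  by exists (fconst_row c); [exact: fconst_row_piece|exists c].
move=> _ c1 _ [h1 _] [c hc [<- ce]].
rewrite (tor_boundariesP hc) (zz_bound_faug hc).
split=> [][_ [g hg Ig]].
  split=> //; exists g => // T; rewrite -[c1 T](subrK (faug c T)) -addrA.
  by apply: ideal_predD.
split; first exact: faug_homog.
exists g => // T; rewrite -[faug c T](subKr (c1 T)) addrAC.
by apply: ideal_predB.
Qed.

Lemma zz_tor p q j k :
  qdim (fun v => v \in tor_cycles F (p + q).+1 j)
       (fun v => v \in tor_boundaries F (p + q).+1 j) k ->
  qdim (@zz_cycle p q j) (zz_bound p j) k.
Proof.
elim: p q => [|p IH] q; first exact: zz_end.
by rewrite addSnnS => /IH/zz_step.
Qed.

Lemma tor_qdim_aux i j k :
  qdim (fun v => v \in tor_cycles F i j) (fun v => v \in tor_boundaries F i j) k ->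
  qdim (kcycle ann i (j - i%:Z)) (kbound ann i (j - i%:Z)) k.
Proof.
case: i => [|i]; first exact: zz_start0.
by have := @zz_tor i 0 j k; rewrite addn0 => h /h/zz_start.
Qed.

End Balance.

Lemma qdim_vspace (K : fieldType) (W : vectType K) (Z B : {vspace W}) :
  qdim (fun v => v \in Z) (fun v => v \in B) (\dim (Z :\: B)).
Proof.
exists (fun i => (vbasis (Z :\: B))`_i); split.
- move=> i; apply: (subvP (diffvSl Z B)); apply: vbasis_mem.
  by rewrite mem_nth // size_tuple.
- move=> v vB; have vZB : lin_comb (fun i => (vbasis (Z :\: B))`_i) v \in (Z :\: B)%VS.
    apply: memv_suml => i _; apply/memvZ/vbasis_mem.
    by rewrite mem_nth // size_tuple.
  have : lin_comb (fun i => (vbasis (Z :\: B))`_i) v \in ((Z :\: B) :&: B)%VS.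
    by rewrite memv_cap vZB.
  rewrite capv_diff memv0 => /eqP v0; apply/rowP => i; rewrite mxE.
  by move/freeP: (basis_free (vbasisP (Z :\: B))) => /(_ (v 0) v0 i).
- move=> z; rewrite -{1}(addv_diff_cap Z B) => /memv_addP[x xZB [y yZ ->]].
  exists (\row_i coord (vbasis (Z :\: B)) i x).
  rewrite (_ : lin_comb _ _ = x); first by rewrite addrC addKr; case/memv_capP: yZ.
  by rewrite {2}(coord_vbasis xZB); apply: eq_bigr => i _; rewrite mxE.
Qed.

Theorem tor_koszul (K : fieldType) (N : nat) (M : lmodType {mpoly K[N]})
    (piece : int -> M -> Prop) (u0 : M) (F : free_resolution piece) i j :
  cyclic_graded piece u0 ->
  qdim (kcycle (ann u0) i (j - i%:Z)) (kbound (ann u0) i (j - i%:Z)) (poincare F i j).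
Proof.
move=> cyc.
have /(@choice _ _) [gam gamP] l : exists q, zhomog (fr_deg l) q /\
    fr_aug F (delta_mx 0 l) = q *: u0.
  by have [q hq e] := cyclic_piece cyc (fr_aug_homog l); exists q.
apply: (tor_qdim_aux cyc (F := F) (gam := gam)).
- by move=> l; have [] := gamP l.
- by move=> l; have [] := gamP l.
rewrite /poincare /= dimvf; exact: qdim_vspace.
Qed.


(** * Ranks of the Koszul differentials *)

Section SubquotientOfIntersection.
Variables (K : fieldType) (V : lmodType K).
Implicit Types Z B U : V -> Prop.

Lemma qdim_full Z B : subspace_pred B -> (forall v, Z v -> B v) -> qdim Z B 0.
Proof.
move=> sB ZB; exists (fun=> 0); split=> [[]//|v _|z /ZB Bz].
  by apply/rowP => -[].
by exists 0; rewrite lin_comb0 subr0.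
Qed.

(** As U = Z1 + Z2, the second isomorphism theorem identifies Z1 / (Z1 /\ Z2)
    with U / Z2. *)
Lemma qdim_split U Z1 Z2 k l : subspace_pred U -> subspace_pred Z1 ->
  subspace_pred Z2 -> (forall v, Z1 v -> U v) -> (forall v, Z2 v -> U v) ->
  (forall u, U u -> exists2 z, Z1 z & Z2 (u - z)) ->
  qdim U Z1 k -> qdim U Z2 l -> qdim U (fun v => Z1 v /\ Z2 v) (k + l).
Proof.
move=> sU s1 s2 Z1U Z2U dec q1 q2.
have s12 : subspace_pred (fun v => Z1 v /\ Z2 v).
  split; first by split; [exact: s1.1|exact: s2.1].
  by move=> c x y [? ?] [? ?]; split; [apply: s1.2|apply: s2.2].
apply: (qdim_add sU s1 s12 Z1U _ q1); first by move=> v [].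
apply: (qdim_transfer (rho := fun u z => Z2 (u - z)) sU s1 _ q2).
split.
- split; first by rewrite subrr; exact: s2.1.
  by move=> c x y x' y' hx hy; rewrite opprD addrACA -scalerBr; apply: s2.2.
- exact: dec.
- by move=> z hz; exists z; [exact: Z1U|rewrite subrr; exact: s2.1].
- move=> u z _ hz huz; split=> [hu|[_ hz2]].
    by split=> //; rewrite -[z](subKr u); apply: subspaceB.
  by rewrite -[u](subrK z); apply: subspaceD.
Qed.

End SubquotientOfIntersection.

Section StrandDimensions.
Variables (K : fieldType) (N : nat).
Local Notation Q := {mpoly K[N]}.
Local Notation chain := {ffun {set 'I_N} -> Q}.
Implicit Types (f g : chain) (J T : {set 'I_N}) (p q : Q) (d : int).
Implicit Types (I : Q -> Prop).

Definition chains i d : chain -> Prop := fun f => kchain i d f.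

Definition kzero I i d f : Prop := kchain i d f /\ forall T, I (f T).

(** A homogeneous polynomial of degree d is determined by its coefficients at
    the finitely many monomials of degree at most D = |d|. *)
Definition kcoord D (f : chain) :
    'rV[K]_#|{: {set 'I_N} * 'X_{1..N < D.+1}}| :=
  \row_x (fun y : {set 'I_N} * 'X_{1..N < D.+1} => (f y.1)@_y.2) (enum_val x).

Lemma kcoord_is_linear D : linear (kcoord D).
Proof. by move=> a f g; apply/rowP => x; rewrite !mxE !ffunE mcoeffD mcoeffZ. Qed.

HB.instance Definition _ D := GRing.isLinear.Build K chain _ _ (kcoord D)
  (kcoord_is_linear D).

Lemma kcoord_inj i d f : kchain i d f -> kcoord `|d|%N f = 0 -> f = 0.
Proof.
move=> hf f0; apply/ffunP => T; rewrite ffunE; apply/mpolyP => mu; rewrite mcoeff0.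
have [e|ne] := eqVneq (mdeg mu)%:Z d; last exact: zhomog_coeff (hf T).1 ne.
have mub : (mdeg mu < `|d|.+1)%N by rewrite -e absz_nat.
have /rowP/(_ (enum_rank (T, BMultinom mub))) := f0.
by rewrite !mxE enum_rankK.
Qed.

Lemma qdim_chains (Z B : chain -> Prop) i d :
  subspace_pred Z -> subspace_pred B -> (forall f, Z f -> kchain i d f) ->
  exists k, qdim Z B k.
Proof.
move=> sZ sB Zc; apply: (qdim_exists (c := kcoord `|d|%N)) => // f Zf.
by move/(kcoord_inj (Zc _ Zf)) => ->; apply: sB.1.
Qed.

(** Numbers attached to the place (i, d) of the Koszul complex of Q / I,
    computed with chains lifted to Q; the rank is that of the differential
    which leaves this place. *)
Definition kchain_dim I i d := dimq (chains i d) (kzero I i d).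
Definition kd_rank I i d := dimq (chains i d) (kcycle I i d).
Definition khom_dim I i d := dimq (kcycle I i d) (kbound I i d).

Lemma subspace_kzero I i d : ideal_pred I -> subspace_pred (kzero I i d).
Proof.
move=> idI; split.
  by split; [exact: (@subspace_kchain K N i d).1|move=> T; rewrite ffunE; exact: idI.1].
move=> c x y [hx Ix] [hy Iy]; split; first exact: (@subspace_kchain K N i d).2.
by move=> T; rewrite !ffunE; apply: ideal_predD => //; apply: ideal_predZ.
Qed.

Section OneIdeal.
Variables (I : Q -> Prop) (idI : ideal_pred I).

Let sC i d : subspace_pred (chains i d) := @subspace_kchain K N i d.
Let sZ i d := subspace_kcycle idI i d.
Let sB i d := subspace_kbound idI i d.
Let s0 i d := subspace_kzero i d idI.

Lemma kzero_bound i d f : kzero I i d f -> kbound I i d f.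
Proof.
move=> [hf If]; split=> //; exists 0; first exact: (sC _ _).1.
move=> T; rewrite (eq_kd _ _ (g := fun=> 0)) ?kd0 ?subr0 // => T'.
by rewrite ffunE.
Qed.

Lemma kbound_cycle i d f : kbound I i d f -> kcycle I i d f.
Proof.
move=> [hf [g hg Ig]]; split=> // T.
have := ideal_pred_kd idI setT T Ig.
by rewrite kdB [X in _ - X](kd_kd setT g T) subr0.
Qed.

Lemma kchain_dimP i d : qdim (chains i d) (kzero I i d) (kchain_dim I i d).
Proof. by apply: dimqP; apply: (@qdim_chains _ _ i d). Qed.

Lemma kd_rankP i d : qdim (chains i d) (kcycle I i d) (kd_rank I i d).
Proof. by apply: dimqP; apply: (@qdim_chains _ _ i d). Qed.

Lemma khom_dimP i d : qdim (kcycle I i d) (kbound I i d) (khom_dim I i d).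
Proof. by apply: dimqP; apply: (@qdim_chains _ _ i d) => // f []. Qed.

Lemma kchain_dimE i d k : qdim (chains i d) (kzero I i d) k -> kchain_dim I i d = k.
Proof. exact: dimqE. Qed.

Lemma kd_rankE i d k : qdim (chains i d) (kcycle I i d) k -> kd_rank I i d = k.
Proof. exact: dimqE. Qed.

Lemma khom_dimE i d k : qdim (kcycle I i d) (kbound I i d) k -> khom_dim I i d = k.
Proof. exact: dimqE. Qed.

(** Chains modulo cycles are the image of the outgoing differential, and
    boundaries modulo I the image of the incoming one. *)
Theorem chain_rank_homology i d : kchain_dim I i d = (kd_rank I i d + (khom_dim I i d + kd_rank I i.+1 (d - 1)))%N.
Proof.
apply: kchain_dimE; apply: qdim_add (kd_rankP i d) _ => //; [by move=> f []| |].
  by move=> f /kzero_bound/kbound_cycle.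
apply: qdim_add (khom_dimP i d) _ => //; [exact: kbound_cycle|exact: kzero_bound|].
apply: (qdim_transfer (rho := fun g f => forall T, I (f T - kd setT g T))) (kd_rankP i.+1 (d - 1)) => //.
split.
- split.
    move=> T; rewrite (eq_kd _ _ (g := fun=> 0)) ?kd0 ?ffunE ?subr0; first exact: idI.1.
    by move=> T'; rewrite ffunE.
  move=> c x y x' y' hx hy T.
  rewrite (eq_kd _ _ (g := fun T => c *: x T + y T)); last by move=> T'; rewrite !ffunE.
  rewrite kdP !ffunE opprD addrACA -scalerBr.
  by apply: ideal_predD => //; apply: ideal_predZ.
- move=> g hg; exists [ffun T => kd setT g T]; last first.
    by move=> T; rewrite ffunE subrr; exact: idI.1.
  split; first by apply: eq_kchain (kchain_kd setT hg) => T; rewrite ffunE.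
  by exists g => // T; rewrite ffunE subrr; exact: idI.1.
- by move=> f [_ [g hg Ig]]; exists g.
move=> g f hg [hf _] fg; split=> [[_ Ig]|[_ If]]; split=> // T.
  by apply/(ideal_pred_eq idI (fg T)).
by apply/(ideal_pred_eq idI (fg T)).
Qed.

Lemma kchain_dim_full i d : (forall q, zhomog d q -> I q) -> kchain_dim I i d = 0%N.
Proof.
by move=> h; apply/kchain_dimE/qdim_full => // f hf; split=> // T; apply/h/(hf T).1.
Qed.

Lemma kchain_dim_neg i d : (d < 0)%R -> kchain_dim I i d = 0%N.
Proof. by move=> d0; apply: kchain_dim_full => q /zhomog_neg -> //; exact: idI.1. Qed.

Lemma kchain_dim_large i d : (N < i)%N -> kchain_dim I i d = 0%N.
Proof.
move=> Ni; apply/kchain_dimE/qdim_full => // f hf; split=> // T; rewrite (hf T).2; first exact: idI.1.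
by rewrite ltn_eqF // (leq_ltn_trans (max_card _)) // card_ord.
Qed.

Lemma kchain_dim0_strand i d : kchain_dim I i d = 0%N -> [/\ kd_rank I i d = 0%N, khom_dim I i d = 0%N & kd_rank I i.+1 (d - 1) = 0%N].
Proof.
by rewrite chain_rank_homology => /eqP; rewrite !addn_eq0 => /andP[/eqP-> /andP[/eqP-> /eqP->]].
Qed.

Lemma kd_zhomog i d f J T : kchain i d f -> zhomog (d + 1) (kd J f T).
Proof.
by move=> hf; apply: zhomog_sum => k _; apply/zhomogZ/zhomogXM; rewrite addrK; have [] := hf (k |: T).
Qed.

Lemma kd_rank_full i d : (forall q, zhomog (d + 1) q -> I q) -> kd_rank I i d = 0%N.
Proof.
by move=> h; apply/kd_rankE/qdim_full => // f hf; split=> // T; apply/h/kd_zhomog/hf.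
Qed.

Lemma kd_rank_source0 d : kd_rank I 0 d = 0%N.
Proof.
apply/kd_rankE/qdim_full => // f hf; split=> // T; rewrite /kd big1; first exact: idI.1.
move=> k _; rewrite (hf _).2 ?mulr0 ?scaler0 // cards_eq0; apply/set0Pn.
by exists k; rewrite !inE eqxx.
Qed.

Definition single T q : chain := [ffun T' => if T' == T then q else 0].

Lemma kchain_single T q d : zhomog d q -> kchain #|T| d (single T q).
Proof.
move=> hq T'; rewrite ffunE; case: eqVneq => [->|ne]; first by rewrite eqxx.
by split=> //; apply: zhomog0.
Qed.

(** A chain of constants is a cycle iff its entries at the sets meeting J
    vanish: the entry at k |: T, with k in J, is the coefficient of X_k in the
    entry of the boundary at T. *)
Lemma kd_rank_degree0 J i :
  (forall c : 'I_N -> K, I (\sum_(k in J) c k *: 'X_k) -> forall k, k \in J -> c k = 0) ->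
  (forall k, k \notin J -> I 'X_k) ->
  kd_rank I i 0 = #|[set T : {set 'I_N} | (#|T| == i) && (T :&: J != set0)]|.
Proof.
move=> Jfree JI; apply: kd_rankE.
apply: (@qdim_dual _ _ _ _ (fun (f : chain) T => (f T)@_0%MM)) => //.
- by move=> a x y T; rewrite !ffunE mcoeffD mcoeffZ.
- move=> f hf; have fE T : f T = ((f T)@_0%MM)%:MP by apply/zhomog0_const/(hf T).1.
  split=> [[_ If] T|h].
    rewrite inE => /andP[/eqP Ti /set0Pn[k]]; rewrite inE => /andP[kT kJ].
    (* Modulo I the boundary at T minus k is a combination of the variables of J. *)
    pose T' := T :\ k; have kT' : k \notin T' by rewrite !inE eqxx.
    have : I (\sum_(l in J) (if l \in T' then 0 else ksign K l T' * (f (l |: T'))@_0%MM) *: 'X_l).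
      apply/(ideal_pred_eq idI _).1: (If T').
      rewrite /kd (bigID (fun l => l \in J)) /= addrC.
      rewrite [X in _ - X](bigID (fun l => l \in T')) /= [X in _ - (X + _)]big1; last first.
        by move=> l /andP[_ ->]; rewrite scale0r.
      rewrite add0r -addrA [X in _ + X](_ : _ = 0) ?addr0; last first.
        apply/eqP; rewrite subr_eq0; apply/eqP; apply: eq_big => [l|l].
          by rewrite !inE andbT andbC.
        rewrite !inE andbT => /andP[/negPf lT' _].
        rewrite lT' {1}fE mulrC -scalerA; congr (_ *: _).
        by rewrite mul_mpolyC.
      apply: ideal_pred_sum => // l /andP[_ lJ]; apply: ideal_predZ => //.
      by rewrite mulrC; apply: ideal_predM => //; apply: JI.
    move/Jfree/(_ k kJ); rewrite (negPf kT') setD1K // => /(congr1 (fun z => ksign K k T' * z)).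
    by rewrite mulrA ksign_sqr mul1r mulr0.
  split=> // T; apply: ideal_pred_sum => // k; rewrite !inE andbT => kT; apply: ideal_predZ => //.
  have [kJ|kJ] := boolP (k \in J); last by rewrite mulrC; apply: ideal_predM => //; apply: JI.
  rewrite (_ : f (k |: T) = 0) ?mulr0; first exact: idI.1.
  have [ki|/(hf _).2->//] := eqVneq #|k |: T| i; rewrite fE h ?mpolyC0 // inE ki eqxx.
  by apply/set0Pn; exists k; rewrite !inE eqxx.
- move=> T; rewrite inE => /andP[/eqP Ti _]; exists (single T 1).
    by rewrite /chains -Ti; apply: kchain_single; rewrite -mpolyC1; apply: zhomogC.
  move=> T' _; rewrite ffunE eq_sym; case: eqP => _; rewrite ?mcoeff0 //.
  by rewrite mcoeff1 eqxx.
Qed.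

Section Top.
(* phi identifies the degree d part of Q / I with a subspace of K. *)
Variables (d : int) (phi : Q -> K).
Hypothesis phiP : forall a x y, phi (a *: x + y) = a * phi x + phi y.
Hypothesis Iphi : forall q, zhomog d q -> (I q <-> phi q = 0).

Let phi0 : phi 0 = 0.
Proof. by have := phiP (-1) 0 0; rewrite scaler0 addr0 mulN1r addNr. Qed.

Let phiZ a x : phi (a *: x) = a * phi x.
Proof. by rewrite -[_ *: _]addr0 phiP phi0 addr0. Qed.

Lemma kchain_dim_top i : (exists2 w, zhomog d w & phi w = 1) ->
  kchain_dim I i d = #|[set T : {set 'I_N} | #|T| == i]|.
Proof.
move=> [w hw phiw]; apply: kchain_dimE.
apply: (@qdim_dual _ _ _ _ (fun (f : chain) T => phi (f T))) => //.
- by move=> a x y T; rewrite !ffunE phiP.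
- move=> f hf; split=> [[_ If] T _|h]; first by apply/Iphi => //; apply: (hf T).1.
  split=> // T; apply/Iphi; first exact: (hf T).1.
  by have [e|/(hf T).2 -> //] := eqVneq #|T| i; apply: h; rewrite inE e.
- move=> T; rewrite inE => /eqP Ti; exists (single T w).
    by rewrite /chains -Ti; apply: kchain_single.
  by move=> T' _; rewrite ffunE eq_sym; case: eqP => _; rewrite ?phi0.
Qed.

(** A boundary has no entry at a set containing J, as the variables outside J
    act as zero; at any other set T the entry can be prescribed, by placing
    the form dual to some k in J minus T at k |: T. *)
Lemma kd_rank_top J i :
  (forall k w, k \notin J -> zhomog (d - 1) w -> phi ('X_k * w) = 0) ->
  (forall k, k \in J -> exists2 w, zhomog (d - 1) w &
     forall l, phi ('X_l * w) = (l == k)%:R) ->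
  kd_rank I i.+1 (d - 1) = #|[set T : {set 'I_N} | (#|T| == i) && ~~ (J \subset T)]|.
Proof.
move=> nJ inJ; apply: kd_rankE.
have phi_sum (A : finType) (P : pred A) (F : A -> Q) :
    phi (\sum_(x | P x) F x) = \sum_(x | P x) phi (F x).
  elim/big_rec2: _ => [|x a b _ <-]; first exact: phi0.
  by rewrite -[F x]scale1r phiP mul1r scale1r.
have phikd (f : chain) T : phi (kd setT f T) =
    \sum_(k in setT :\: T) ksign K k T * phi ('X_k * f (k |: T)).
  by rewrite phi_sum; apply: eq_bigr => k _; rewrite phiZ.
apply: (@qdim_dual _ _ _ _ (fun (f : chain) T => phi (kd setT f T))) => //.
- move=> a x y T; rewrite (eq_kd _ _ (g := fun T => a *: x T + y T)) ?kdP ?phiP //.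
  by move=> T'; rewrite !ffunE.
- move=> f hf; have hkd T : zhomog d (kd setT f T).
    by rewrite -[d](subrK 1); apply: kd_zhomog hf.
  split=> [[_ If] T _|h]; first exact/Iphi.
  split=> // T; apply/Iphi => //.
  have [e|ne] := eqVneq #|T| i; last by rewrite ((kchain_kd setT hf T).2 ne).
  have [JT|nJT] := boolP (J \subset T); last by apply: h; rewrite inE e eqxx.
  rewrite phikd big1 // => k; rewrite !inE andbT => kT.
  rewrite nJ ?mulr0 //; first by apply: contra kT => /(subsetP JT).
  exact: (hf _).1.
- move=> T; rewrite inE => /andP[/eqP Ti /subsetPn[k kJ kT]].
  have [w hw wk] := inJ k kJ; exists (single (k |: T) (ksign K k T *: w)).
    rewrite /chains (_ : i.+1 = #|k |: T|); last by rewrite cardsU1 kT Ti.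
    exact/kchain_single/zhomogZ.
  move=> T' _; rewrite phikd.
  have E l : phi ('X_l * single (k |: T) (ksign K k T *: w) (l |: T')) =
      ((l |: T' == k |: T) && (l == k))%:R * ksign K k T.
    rewrite ffunE; case: eqP => _ /=; last by rewrite mulr0 phi0 mul0r.
    by rewrite -scalerAr phiZ wk mulrC.
  under eq_bigr do rewrite E.
  have [<-|ne] := eqVneq T T'; last first.
    rewrite big1 // => l; rewrite !inE andbT => lT'.
    case: (eqVneq l k) => [lk|_]; last by rewrite andbF mul0r mulr0.
    rewrite andbT (_ : (_ == _) = false) ?mul0r ?mulr0 //; apply/negP => /eqP e.
    case/eqP: ne; rewrite -(setU1K kT) -e lk setU1K //.
    by rewrite -lk.
  rewrite (bigD1 k) /=; last by rewrite !inE kT.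
  rewrite !eqxx mul1r ksign_sqr big1 ?addr0 // => l /andP[_ /negPf ->].
  by rewrite andbF mul0r mulr0.
Qed.

End Top.
End OneIdeal.

Section Split.
Variables (I1 I2 L : Q -> Prop).
Hypotheses (id1 : ideal_pred I1) (id2 : ideal_pred I2) (idL : ideal_pred L).
Variable d : int.
Hypothesis dec : forall q, zhomog d q -> exists q1, [/\ zhomog d q1, I1 q1 & I2 (q - q1)].

(** A decomposition of Q_d = I1_d + I2_d extends to chains entrywise; hence the
    two lemmas below, applied when Q / L is Q / I1 (+) Q / I2 in the relevant
    degrees. *)
Lemma chain_split i f : kchain i d f -> exists g,
  [/\ kchain i d g, forall T, I1 (g T) & forall T, I2 (f T - g T)].
Proof.
move=> hf.
have /(@choice _ _) [w wP] T : exists q1, [/\ zhomog d q1, I1 q1 & I2 (f T - q1)].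
  by apply/dec/(hf T).1.
exists [ffun T : {set 'I_N} => if #|T| == i then w T else 0]; split=> T; rewrite ffunE;
  case: (eqVneq #|T| i) => [e|ne]; have [w1 w2 w3] := wP T => //.
- by split=> //; apply: zhomog0.
- exact: id1.1.
- by rewrite (hf T).2 // subrr; exact: id2.1.
Qed.

Lemma kchain_dim_split i : (forall q, zhomog d q -> (L q <-> I1 q /\ I2 q)) ->
  kchain_dim L i d = (kchain_dim I1 i d + kchain_dim I2 i d)%N.
Proof.
move=> LI; apply: kchain_dimE => //.
have s1 := subspace_kzero i d id1; have s2 := subspace_kzero i d id2.
have sC : subspace_pred (chains i d) := @subspace_kchain K N i d.
have := qdim_split sC s1 s2 _ _ _ (kchain_dimP id1 i d) (kchain_dimP id2 i d).
move=> /(_ _ _ _)/qdim_ext; apply=> //; try (by move=> f []); last first.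
  move=> f hf; have [g [g1 g2 g3]] := chain_split hf; exists g => //.
  by split; [exact: (subspaceB sC)|move=> T; rewrite !ffunE].
move=> f hf; split=> [[[_ f1] [_ f2]]|[_ fL]].
  by split=> // T; apply/LI => //; apply: (hf T).1.
by split; split=> // T; have /LI[] := fL T => //; apply: (hf T).1.
Qed.

Lemma kd_rank_split i : (forall q, zhomog (d + 1) q -> (L q <-> I1 q /\ I2 q)) ->
  kd_rank L i d = (kd_rank I1 i d + kd_rank I2 i d)%N.
Proof.
move=> LI; apply: kd_rankE => //.
have s1 := subspace_kcycle id1 i d; have s2 := subspace_kcycle id2 i d.
have sC : subspace_pred (chains i d) := @subspace_kchain K N i d.
have := qdim_split sC s1 s2 _ _ _ (kd_rankP id1 i d) (kd_rankP id2 i d).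
move=> /(_ _ _ _)/qdim_ext; apply=> //; try (by move=> f []); last first.
  move=> f hf; have [g [g1 g2 g3]] := chain_split hf; exists g => //.
    by split=> // T; apply: ideal_pred_kd.
  split; first exact: (subspaceB sC).
  by move=> T; apply: ideal_pred_kd => // T'; rewrite !ffunE.
move=> f hf; split=> [[[_ f1] [_ f2]]|[_ fL]].
  by split=> // T; apply/LI => //; apply: kd_zhomog hf.
by split; split=> // T; have /LI[] := fL T => //; apply: kd_zhomog hf.
Qed.

End Split.

Lemma card_not_sub_compl J i : (i <= N)%N ->
  #|[set T : {set 'I_N} | (#|T| == i) && ~~ (J \subset T)]| =
  #|[set T : {set 'I_N} | (#|T| == N - i)%N && (T :&: J != set0)]|.
Proof.
move=> iN; rewrite -(card_imset _ (@setC_inj 'I_N)); apply: eq_card => T.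
apply/imsetP/idP => [[S]|]; rewrite inE => /andP[/eqP ST].
  move=> JS ->; rewrite inE cardsCs setCK card_ord ST eqxx.
  by rewrite setI_eq0 disjoint_sym disjoints_subset setCK.
move=> TJ; exists (~: T); rewrite ?setCK // inE cardsCs setCK card_ord ST subKn // eqxx.
by rewrite -disjoints_subset disjoint_sym -setI_eq0.
Qed.

End StrandDimensions.

Lemma poincare_kh (K : fieldType) (N : nat) (M : lmodType {mpoly K[N]})
    (piece : int -> M -> Prop) (u0 : M) (F : free_resolution piece) (i : nat) j :
  cyclic_graded piece u0 -> poincare F i j = khom_dim (ann u0) i (j - i%:Z).
Proof. by move=> cyc; apply/esym/khom_dimE/tor_koszul => //; apply: ann_ideal. Qed.

(** * Killing some of the variables *)

Section PolynomialMorphisms.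
Variables (K : fieldType) (r : nat).
Local Notation R := {mpoly K[r]}.

Lemma mpoly_alg_ind (P : R -> Prop) :
  (forall c, P c%:MP) -> (forall i, P 'X_i) ->
  (forall p q, P p -> P q -> P (p + q)) ->
  (forall p q, P p -> P q -> P (p * q)) -> forall p, P p.
Proof.
move=> hC hX hD hM p; elim/mpolyind: p => [|c mu p _ _ IH].
  by rewrite -mpolyC0.
apply: (hD) => //; rewrite -mul_mpolyC; apply: (hM) => //.
rewrite mpolyXE_id; elim/big_rec: _ => [|i q _ IHq]; first by rewrite -mpolyC1.
apply: (hM) => //; elim: (mu i) => [|k IHk]; first by rewrite expr0 -mpolyC1.
by rewrite exprS; apply: (hM).
Qed.

Lemma mpoly_monom_factor (mu : 'X_{1..r}) : mu != 0%MM ->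
  exists i nu, 'X_[mu] = 'X_i * 'X_[nu] :> R /\ (0 < mu i)%N.
Proof.
move=> nz; have [i nzi] : exists i, mu i != 0%N.
  apply/existsP; apply: contraNT nz; rewrite negb_exists => /forallP h.
  by apply/eqP/mnmP => i; rewrite mnm0E; apply/eqP; have := h i; rewrite negbK.
have im : (U_(i) <= mu)%MM.
  by apply/mnm_lepP => j; rewrite mnm1E; case: eqVneq => [<-|//]; rewrite lt0n.
exists i, (mu - U_(i))%MM; rewrite lt0n; split=> //.
by rewrite -mpolyXD addmC submK.
Qed.

Section GradedMorphism.
Variables (s : nat) (f : {rmorphism R -> {mpoly K[s]}}).
Hypothesis fC : forall c, f c%:MP = c%:MP.
Hypothesis fX : forall i, zhomog 1 (f 'X_i).

Lemma rmorph_mpolyZ c p : f (c *: p) = c *: f p.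
Proof. by rewrite -mul_mpolyC rmorphM fC mul_mpolyC. Qed.

Lemma zhomog_rmorphX mu : zhomog (mdeg mu)%:Z (f 'X_[mu]).
Proof.
have [k] := ubnP (mdeg mu); elim: k mu => // k IH mu; rewrite ltnS => mk.
have [->|/mpoly_monom_factor[i [nu [e mi]]]] := eqVneq mu 0%MM.
  by rewrite mpolyX0 rmorph1 mdeg0 -mpolyC1; apply: zhomogC.
have mE : mu = (U_(i) + nu)%MM.
  by have := congr1 (@msupp _ _) e; rewrite -mpolyXD !msuppX => -[].
rewrite e rmorphM mE mdegD mdeg1 PoszD; apply: zhomogM => //; apply: IH.
by apply: leq_trans mk; rewrite mE mdegD mdeg1 ltnS.
Qed.

Lemma zcomp_rmorph d p : f (zcomp d p) = zcomp d (f p).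
Proof.
elim/mpolyind: p => [|c mu p _ _ IH]; first by rewrite !(linear0, rmorph0).
rewrite linearD rmorphD IH [in RHS]rmorphD linearD /=; congr (_ + _).
rewrite rmorph_mpolyZ !linearZ /= rmorph_mpolyZ; congr (_ *: _).
have hX : zhomog (mdeg mu)%:Z ('X_[mu] : R) by rewrite /= dhomogX.
have [<-|ne] := eqVneq (mdeg mu)%:Z d; first by rewrite !zcomp_id ?zhomog_rmorphX.
by rewrite (zcomp_neq hX ne) (zcomp_neq (zhomog_rmorphX mu) ne) rmorph0.
Qed.

Lemma zhomog_rmorph d p : zhomog d p -> zhomog d (f p).
Proof. by move=> /zcomp_id <-; rewrite zcomp_rmorph; apply: zhomog_zcomp. Qed.

End GradedMorphism.
End PolynomialMorphisms.

(* The polynomial ring R in the variables J is both a subring and a quotient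
   of Q; kill_y and kill_x are the two instances. *)
Section Retraction.
Variables (K : fieldType) (r N : nat) (iota : 'I_r -> 'I_N).
Local Notation Q := {mpoly K[N]}.
Local Notation R := {mpoly K[r]}.
Local Notation J := [set iota k | k : 'I_r].
Variable kill : {rmorphism Q -> R}.
Hypothesis killC : forall c, kill c%:MP = c%:MP.
Hypothesis killX : forall k, kill 'X_(iota k) = 'X_k.
Hypothesis killX0 : forall l, l \notin J -> kill 'X_l = 0.

Definition mpoly_embed : R -> Q := comp_mpoly [tuple 'X_(iota k) | k < r].
HB.instance Definition _ := GRing.RMorphism.on mpoly_embed.

Lemma mpoly_embedC c : mpoly_embed c%:MP = c%:MP.
Proof. exact: comp_mpolyC. Qed.

Lemma mpoly_embedX k : mpoly_embed 'X_k = 'X_(iota k).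
Proof. by rewrite /mpoly_embed comp_mpolyXU -tnth_nth tnth_mktuple. Qed.

Lemma mpoly_embedZ c p : mpoly_embed (c *: p) = c *: mpoly_embed p.
Proof. exact: comp_mpolyZ. Qed.

Lemma embedK p : kill (mpoly_embed p) = p.
Proof.
elim/mpoly_alg_ind: p => [c|i|p q hp hq|p q hp hq].
- by rewrite mpoly_embedC killC.
- by rewrite mpoly_embedX killX.
- by rewrite !rmorphD /= hp hq.
- by rewrite !rmorphM /= hp hq.
Qed.

Lemma embed_killX l : mpoly_embed (kill 'X_l) = if l \in J then 'X_l else 0.
Proof.
case: ifPn => [/imsetP[k _ ->]|/killX0 ->]; last by rewrite rmorph0.
by rewrite killX mpoly_embedX.
Qed.

Lemma zhomog_embed d p : zhomog d p -> zhomog d (mpoly_embed p).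
Proof.
apply: zhomog_rmorph => [c|i]; first exact: mpoly_embedC.
by rewrite /= mpoly_embedX; apply: zhomogX.
Qed.

Lemma kill_homogX l : zhomog 1 (kill 'X_l).
Proof.
have [/imsetP[k _ ->]|/killX0 ->] := boolP (l \in J); last exact: zhomog0.
by rewrite killX; apply: zhomogX.
Qed.

Lemma zhomog_kill d p : zhomog d p -> zhomog d (kill p).
Proof. by apply: zhomog_rmorph => //; apply: kill_homogX. Qed.

Lemma zcomp_kill d p : kill (zcomp d p) = zcomp d (kill p).
Proof. by apply: zcomp_rmorph => //; apply: kill_homogX. Qed.

Lemma kill_mpolyZ c p : kill (c *: p) = c *: kill p.
Proof. exact: rmorph_mpolyZ. Qed.

(** The polynomials with this property form a subalgebra that contains the
    variables. *)
Lemma sub_embed_kill (I : Q -> Prop) p : ideal_pred I ->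
  (forall l, l \notin J -> I 'X_l) -> I (p - mpoly_embed (kill p)).
Proof.
move=> idI IX; elim/mpoly_alg_ind: p => [c|i|p q hp hq|p q hp hq].
- by rewrite killC mpoly_embedC subrr; exact: idI.1.
- rewrite embed_killX; case: ifPn => [_|/IX]; first by rewrite subrr; exact: idI.1.
  by rewrite subr0.
- by rewrite !rmorphD /= opprD addrACA; apply: ideal_predD.
- rewrite !rmorphM /= -(subrKA (p * mpoly_embed (kill q))) -mulrBr -mulrBl.
  apply: ideal_predD => //; first exact: ideal_predM.
  by rewrite mulrC; apply: ideal_predM.
Qed.

Lemma mcoeff_embed0 d p (mu : 'X_{1..N}) : zhomog d p -> d != 0 ->
  (forall l, l \in J -> mu l = 0%N) -> (mpoly_embed p)@_mu = 0.
Proof.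
move=> hp d0 mu0; rewrite [p]mpolyE rmorph_sum raddf_sum big_seq big1 //= => nu.
rewrite mcoeff_msupp => /(zhomogP d p hp) nud.
rewrite -mul_mpolyC rmorphM /= mpoly_embedC mcoeffCM.
have : nu != 0%MM by apply: contraNneq d0 => e; rewrite -nud e mdeg0.
case/(@mpoly_monom_factor K) => i [nu' [-> _]].
by rewrite rmorphM /= mpoly_embedX mcoeffXUM mu0 ?mulr0 ?imset_f.
Qed.

Definition kernel (q : Q) : Prop := kill q = 0.

Lemma kernel_ideal : ideal_pred kernel.
Proof.
split=> [|q x y]; rewrite /kernel; first exact: rmorph0.
by move=> hx hy; rewrite rmorphD rmorphM hx hy mulr0 addr0.
Qed.

(** Representing a cycle by polynomials in the variables of J turns it into a
    cycle for the Koszul differential of J, which is exact in positive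
    degree; the other variables only contribute terms of the kernel. *)
Lemma khom_dim_kernel i d : (0 < d)%R -> khom_dim kernel i d = 0%N.
Proof.
move=> d0; have dn0 : d != 0 by rewrite gt_eqF.
apply: khom_dimE; first exact: kernel_ideal.
apply: qdim_full => [|f [hf cyc]]; first exact/subspace_kbound/kernel_ideal.
split=> //; pose f' T := mpoly_embed (kill (f T)).
have hf' : kchain i d f'.
  move=> T; split; first by apply/zhomog_embed/zhomog_kill/(hf T).1.
  by move=> ne; rewrite /f' (hf T).2 // !rmorph0.
have cyc' T : kd J f' T = 0.
  have := congr1 mpoly_embed (cyc T); rewrite rmorph0 => e; rewrite -[RHS]e.
  rewrite /kd !rmorph_sum /= big_mkcond [RHS]big_mkcond; apply: eq_bigr => l _ /=.
  rewrite !in_setD in_setT andbT; case: (l \notin T) => //=.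
  rewrite kill_mpolyZ mpoly_embedZ !rmorphM /= embed_killX.
  by case: (l \in J); rewrite // mul0r scaler0.
have ex := kd_exact cyc'.
exists [ffun T => khomotopy J f' T].
  by apply: eq_kchain (kchain_homotopy J hf') => T; rewrite ffunE.
move=> T; rewrite (eq_kd _ _ (ffunE _)) -(subrKA (f' T)).
apply: ideal_predD; first exact: kernel_ideal.
  apply: sub_embed_kill; first exact: kernel_ideal.
  exact: killX0.
rewrite /kernel -{1}ex; last by move=> T' nu _; apply: mcoeff_embed0 (zhomog_kill (hf T').1) dn0.
rewrite rmorphB /kd !rmorph_sum /= big_mkcond [X in _ - X]big_mkcond -sumrB big1 // => l _.
rewrite !in_setD in_setT andbT; case: (l \notin T); rewrite /= ?subrr //.
case: ifPn => lJ; first by rewrite subrr.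
by rewrite kill_mpolyZ rmorphM /= (killX0 lJ) mul0r scaler0 subr0.
Qed.

Lemma kill_linear_form (c : 'I_N -> K) :
  kill (\sum_(k in J) c k *: 'X_k) = 0 -> forall k, k \in J -> c k = 0.
Proof.
move=> h k kJ; have /(congr1 (mcoeff U_(k))) := congr1 mpoly_embed h.
rewrite rmorph0 mcoeff0 !rmorph_sum raddf_sum /= (bigD1 k) //= big1 => [|l /andP[lJ lk]];
  rewrite kill_mpolyZ -mul_mpolyC rmorphM /= mpoly_embedC embed_killX ?kJ ?lJ mcoeffCM mcoeffXU.
  by rewrite eqxx mulr1 addr0.
by rewrite (negPf lk) mulr0.
Qed.

End Retraction.

(** * The socle pairing of an Artinian Gorenstein algebra *)

Section Gorenstein.
Variables (K : fieldType) (r e : nat) (a : hideal K r).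
Variables (f : {linear galg a -> K^o}) (t : galg a).
Hypothesis AG : AG_algebra a e.
Hypothesis orient : orientation e f.
Hypothesis thom : thom_class e f t.
Local Notation R := {mpoly K[r]}.
Local Notation pi := (galg_pi a).
Implicit Types (p q v w : R).

Lemma galg_piZ c p : pi (c *: p) = c *: pi p.
Proof. by rewrite -mul_mpolyC rmorphM. Qed.

Lemma galg_pi_eq0 p : pi p = 0 <-> p \in hideal_idealr a.
Proof.
rewrite -(rmorph0 pi); split=> [/eqP|h]; last apply/eqP.
  by rewrite -(Quotient.idealrBE (hideal_idealr a)) subr0.
by rewrite -(Quotient.idealrBE (hideal_idealr a)) subr0.
Qed.

Lemma galg_zcomp d p : pi p = 0 -> pi (zcomp d p) = 0.
Proof.
move=> /galg_pi_eq0 h; apply/galg_pi_eq0; case: d => d; first exact: hideal_homog.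
by rewrite /= idealr0.
Qed.

Lemma galg_above d p : (e%:Z < d)%R -> zhomog d p -> pi p = 0.
Proof.
case: d => d; last by move=> _ /eqP ->; rewrite rmorph0.
rewrite ltz_nat => ed hp; have [_ _ [_ h]] := AG.
by apply: (h d) => //; exists p.
Qed.

Lemma mul_monoms_pi q p : q@_0%MM = 0 -> (forall i, pi ('X_i * p) = 0) -> pi (q * p) = 0.
Proof.
move=> q0 h; rewrite [q]mpolyE mulr_suml rmorph_sum big_seq big1 //= => nu.
rewrite mcoeff_msupp => nuq; have : nu != 0%MM by apply: contraNneq nuq => ->; rewrite q0.
case/(@mpoly_monom_factor K) => i [nu' [-> _]].
by rewrite -scalerAl galg_piZ mulrAC rmorphM /= h mul0r scaler0.
Qed.

Lemma top_socle p : zhomog e%:Z p -> socle (pi p).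
Proof.
move=> hp u; have [q ->] := galg_piP u; rewrite galg_projE -rmorphM => q0.
apply: mul_monoms_pi => // i; apply: (@galg_above (1 + e%:Z)); last exact: zhomogM (zhomogX K i) hp.
by rewrite -PoszD ltz_nat add1n.
Qed.

Lemma thom_lift : exists2 p, zhomog e%:Z p & t = pi p.
Proof. by have [] := thom. Qed.

Lemma thom_neq0 : t != 0.
Proof.
have [_ ft] := thom; apply/eqP => t0; have := ft; rewrite t0 linear0 => /esym/eqP.
by rewrite oner_eq0.
Qed.

(** The socle is one-dimensional and contains the top degree, hence the Thom
    class t, which therefore spans both. *)
Lemma socle_thom x : socle x -> exists c, x = c *: t.
Proof.
have [_ [s [_ s0] sP] _] := AG; move=> /sP[c ->].
have [p hp tE] := thom_lift; have /sP[c' tc] := top_socle hp; rewrite -tE in tc.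
have c'0 : c' != 0 by apply: contraNneq thom_neq0 => c0; rewrite tc c0 scale0r.
by exists (c / c'); rewrite tc scalerA divfK.
Qed.

Lemma orient_other d p : d != e%:Z -> zhomog d p -> f (pi p) = 0.
Proof.
have [h _] := orient; case: d => d; last by move=> _ /eqP ->; rewrite rmorph0 linear0.
by rewrite eqz_nat => de hp; apply: (h d) => //; exists p.
Qed.

Lemma top_thom p : zhomog e%:Z p -> pi p = (f (pi p) : K) *: t.
Proof.
have [_ ft] := thom; move=> /top_socle/socle_thom[c pc]; rewrite {1}pc; congr (_ *: _).
by rewrite pc linearZ /= ft /GRing.scale /= mulr1.
Qed.

(** So the ideal generated by the pair of Thom classes in the fiber product is
    a line. *)
Lemma thom_absorb u : u * t = galg_proj u *: t.
Proof.
have [q uq] := galg_piP u; have [p hp tp] := thom_lift.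
have := top_socle hp; rewrite -tp => /(_ (u - pi (galg_proj u)%:MP)).
rewrite rmorphB /= galg_projE mcoeffC eqxx mulr1 subrr mulrBl => /(_ erefl)/eqP.
by rewrite subr_eq0 => /eqP.
Qed.

(** A nonzero element of degree below e is not in the socle, so some variable
    does not kill it; repeat until degree e is reached. *)
Lemma top_nondegenerate k p : (k <= e)%N -> zhomog (e - k)%N%:Z p -> pi p != 0 ->
  exists2 v, zhomog k%:Z v & f (pi (v * p)) != 0.
Proof.
elim: k p => [|k IH] p ke hp pn0.
  exists 1; first by rewrite -mpolyC1; apply: zhomogC.
  rewrite mul1r; apply: contraNneq pn0 => fp0.
  by rewrite subn0 in hp; rewrite (top_thom hp) fp0 scale0r.
have [i Xp] : exists i, pi ('X_i * p) != 0.
  apply: contrapT => no; have h i : pi ('X_i * p) = 0.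
    by apply/eqP/negPn/negP => ni; apply: no; exists i.
  have : socle (pi p).
    move=> u; have [q ->] := galg_piP u; rewrite galg_projE -rmorphM => q0.
    exact: mul_monoms_pi.
  move=> /socle_thom[c pc]; have [_ ft] := thom.
  have : f (pi p) = 0 by apply: orient_other hp; rewrite eqz_nat -{2}[e]subn0 eqn_sub2lE // subn0.
  by rewrite pc linearZ /= ft /GRing.scale /= mulr1 => c0; rewrite pc c0 scale0r eqxx in pn0.
have hXp : zhomog (e - k)%N%:Z ('X_i * p).
  apply: zhomogXM; rewrite (_ : _ - 1 = (e - k.+1)%N%:Z) //.
  by rewrite subnS -subn1 -[RHS]subzn ?subn_gt0.
have [v hv fv] := IH _ (ltnW ke) hXp Xp.
exists ('X_i * v); last by rewrite mulrAC -mulrA [p * v]mulrC mulrCA in fv *.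
by rewrite -add1n PoszD; apply: zhomogM (zhomogX K i) hv.
Qed.

Hypothesis nolin : no_linear_forms a.
Hypothesis e_gt0 : (0 < e)%N.

(** Perfectness of the pairing of degrees 1 and e - 1: the matrix of values of
    f on products of a variable and a monomial of degree e - 1 has independent
    columns, because a dependency is a linear form that kills degree e - 1. *)
Lemma dual_forms i : exists2 w, zhomog (e%:Z - 1) w &
  forall l, f (pi ('X_l * w)) = (l == i)%:R.
Proof.
pose mon := 'X_{1..r < e}.
pose G : 'M[K]_(#|{: mon}|, r) := \matrix_(x, k)
  (fun nu : mon => if mdeg nu == e.-1 then f (pi ('X_k * 'X_[nu])) else 0) (enum_val x).
have full : row_full G.
  rewrite /row_full -mxrank_tr -/(row_free _) -kermx_eq0; apply/rowV0P => c /sub_kermxP cG.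
  pose l : R := \sum_k c 0 k *: 'X_k.
  have hl : zhomog 1 l by apply: zhomog_sum => k _; apply/zhomogZ/zhomogX.
  have fl v : zhomog (e.-1)%:Z v -> f (pi (v * l)) = 0.
    move=> hv; rewrite [v]mpolyE mulr_suml rmorph_sum linear_sum big_seq big1 //= => nu.
    rewrite mcoeff_msupp => /(zhomogP _ _ hv)[nue].
    have nub : (mdeg nu < e)%N by rewrite nue prednK.
    rewrite -scalerAl galg_piZ linearZ /= [f _](_ : _ = 0) ?scaler0 //.
    have /rowP/(_ (enum_rank (BMultinom nub : mon))) := cG; rewrite !mxE => h.
    rewrite -[RHS]h /l mulr_sumr rmorph_sum linear_sum; apply: eq_bigr => k _ /=.
    rewrite !mxE enum_rankK /= nue eqxx -scalerAr galg_piZ linearZ /=.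
    by rewrite mulrC.
  have l0 : l = 0.
    apply: contrapT => ln0; have pl : pi l != 0.
      by apply/eqP => /galg_pi_eq0 la; apply: ln0; apply: nolin.
    have [||v hv] := @top_nondegenerate e.-1 l _ _ pl; first exact: leq_pred.
      by rewrite -subn1 subKn.
    by rewrite fl ?eqxx.
  apply/rowP => k; rewrite mxE; have := congr1 (mcoeff U_(k)) l0.
  rewrite mcoeff0 /l raddf_sum /= (bigD1 k) //= big1 => [|j jk]; rewrite mcoeffZ mcoeffXU.
    by rewrite eqxx mulr1 addr0.
  by rewrite (negPf jk) mulr0.
have [B BG] := row_fullP full.
exists (\sum_x (fun nu : mon => if mdeg nu == e.-1 then B i x *: 'X_[nu] else 0) (enum_val x)).
  apply: zhomog_sum => x _; case: eqP => [nue|_]; last exact: zhomog0.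
  apply/zhomogZ; rewrite (_ : _ - 1 = (e.-1)%:Z); last by rewrite -subn1 -subzn.
  by rewrite -nue /= dhomogX.
move=> l; have /matrixP/(_ i l) := BG; rewrite !mxE eq_sym => <-.
rewrite mulr_sumr rmorph_sum linear_sum; apply: eq_bigr => x _ /=.
rewrite !mxE; case: eqP => _; last by rewrite !mulr0 rmorph0 linear0.
by rewrite -scalerAr galg_piZ linearZ.
Qed.

End Gorenstein.

(** * The four modules as quotients of Q *)

Section Components.
Variables (K : fieldType) (r : nat) (a : hideal K r).

Lemma galg_pi_zcomp d p q (c : K) : zhomog d p ->
  galg_pi a q = c *: galg_pi a p -> galg_pi a (zcomp d q) = c *: galg_pi a p.
Proof.
move=> hp h; have : galg_pi a (q - c *: p) = 0 by rewrite rmorphB /= galg_piZ h subrr.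
move/(galg_zcomp d); rewrite linearB /= (zcomp_id (zhomogZ c hp)) rmorphB /= galg_piZ.
by move/eqP; rewrite subr_eq0 => /eqP.
Qed.

Lemma galg_pi_zcomp_neq d s p q (c : K) : zhomog s p -> s != d ->
  galg_pi a q = c *: galg_pi a p -> galg_pi a (zcomp d q) = 0.
Proof.
move=> hp ne h; have : galg_pi a (q - c *: p) = 0 by rewrite rmorphB /= galg_piZ h subrr.
by move/(galg_zcomp d); rewrite linearB /= (zcomp_neq (zhomogZ c hp) ne) subr0.
Qed.

End Components.

Section RestrictedAlgebra.
Variables (K : fieldType) (r N : nat) (iota : 'I_r -> 'I_N).
Local Notation Q := {mpoly K[N]}.
Local Notation R := {mpoly K[r]}.
Variable kill : {rmorphism Q -> R}.
Hypothesis killC : forall c, kill c%:MP = c%:MP.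
Hypothesis killX : forall k, kill 'X_(iota k) = 'X_k.
Hypothesis killX0 : forall l, l \notin [set iota k | k : 'I_r] -> kill 'X_l = 0.
Variables (a : hideal K r) (act : {rmorphism Q -> galg a}).
Hypothesis actE : forall q, act q = galg_pi a (kill q).

Definition act_kernel (q : Q) : Prop := galg_pi a (kill q) = 0.

Lemma act_kernel_ideal : ideal_pred act_kernel.
Proof.
split=> [|q x y]; rewrite /act_kernel; first by rewrite !rmorph0.
by move=> hx hy; rewrite rmorphD !rmorphM rmorphD rmorphM /= hx hy mulr0 addr0.
Qed.

Lemma ann_restr q : ann (1 : restr act) q <-> act_kernel q.
Proof.
rewrite /ann (_ : q *: (1 : restr act) = act q * 1 :> galg a) //.
by rewrite mulr1 actE.
Qed.

Lemma cyclic_restr :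
  cyclic_graded (fun d (x : restr act) => @galg_piece K r a d x) 1.
Proof.
have scE q : q *: (1 : restr act) = act q * 1 :> galg a by [].
split.
- move=> u; have [p up] := galg_piP (u : galg a); exists (mpoly_embed iota p).
  by rewrite scE mulr1 actE embedK.
- move=> d u [p hp up]; exists (mpoly_embed iota p); first exact: zhomog_embed.
  by rewrite scE mulr1 actE embedK.
- move=> d q /ann_restr h; apply/ann_restr; rewrite /act_kernel.
  by rewrite (zcomp_kill killC killX killX0); apply: galg_zcomp.
Qed.

Lemma act_kernel_linear_form (c : 'I_N -> K) : no_linear_forms a ->
  act_kernel (\sum_(k in [set iota k | k : 'I_r]) c k *: 'X_k) ->
  forall k, k \in [set iota k | k : 'I_r] -> c k = 0.
Proof.
move=> nolin /galg_pi_eq0 h; apply: (kill_linear_form killC killX killX0).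
apply: nolin => //; apply: (zhomog_kill killC killX killX0 (d := 1)).
by apply: zhomog_sum => k _; apply/zhomogZ/zhomogX.
Qed.

End RestrictedAlgebra.

Section TwoSetsOfVariables.
Variables (K : fieldType) (m n : nat).
Local Notation Q := {mpoly K[m + n]}.

Lemma x_varsC : ~: x_vars m n = y_vars m n.
Proof.
apply/setP => i; rewrite inE; have [j|j] := split_ordP i => ->.
  rewrite imset_f //=; apply/esym/negbTE/negP => /imsetP[k _ /eqP].
  by rewrite eq_lrshift.
rewrite [RHS]imset_f //; apply/negP => /imsetP[k _ /eqP].
by rewrite eq_rlshift.
Qed.

Lemma notin_x_vars l : (l \notin [set lshift n k | k : 'I_m]) = (l \in y_vars m n).
Proof. by rewrite -x_varsC inE. Qed.

Lemma notin_y_vars l : (l \notin [set rshift m k | k : 'I_n]) = (l \in x_vars m n).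
Proof. by have /setP/(_ l) := x_varsC; rewrite inE => <-; rewrite negbK. Qed.

Lemma kill_yC c : @kill_y K m n c%:MP = c%:MP.
Proof. exact: comp_mpolyC. Qed.

Lemma kill_xC c : @kill_x K m n c%:MP = c%:MP.
Proof. exact: comp_mpolyC. Qed.

Lemma kill_yX k : @kill_y K m n 'X_(lshift n k) = 'X_k.
Proof.
rewrite /kill_y comp_mpolyXU -tnth_nth tnth_mktuple.
by rewrite (unsplitK (inl k : 'I_m + 'I_n)%type).
Qed.

Lemma kill_xX k : @kill_x K m n 'X_(rshift m k) = 'X_k.
Proof.
rewrite /kill_x comp_mpolyXU -tnth_nth tnth_mktuple.
by rewrite (unsplitK (inr k : 'I_m + 'I_n)%type).
Qed.

Lemma kill_yX0 l : l \notin [set lshift n k | k : 'I_m] -> @kill_y K m n 'X_l = 0.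
Proof.
rewrite notin_x_vars => /imsetP[k _ ->].
rewrite /kill_y comp_mpolyXU -tnth_nth tnth_mktuple.
by rewrite (unsplitK (inr k : 'I_m + 'I_n)%type).
Qed.

Lemma kill_xX0 l : l \notin [set rshift m k | k : 'I_n] -> @kill_x K m n 'X_l = 0.
Proof.
rewrite notin_y_vars => /imsetP[k _ ->].
rewrite /kill_x comp_mpolyXU -tnth_nth tnth_mktuple.
by rewrite (unsplitK (inl k : 'I_m + 'I_n)%type).
Qed.

Local Notation embx := (mpoly_embed (@lshift m n)).
Local Notation emby := (mpoly_embed (@rshift m n)).

Lemma kill_y_emby (p : {mpoly K[n]}) : kill_y (emby p) = (p@_0%MM)%:MP.
Proof.
elim/mpoly_alg_ind: p => [c|i|p q hp hq|p q hp hq].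
- by rewrite mpoly_embedC kill_yC mcoeffC eqxx mulr1.
- rewrite mpoly_embedX kill_yX0; last by rewrite notin_x_vars imset_f.
  by rewrite mcoeffX mnm1_eq0 mpolyC0.
- by rewrite !rmorphD /= hp hq.
- by rewrite !rmorphM /= hp hq.
Qed.

Lemma kill_x_embx (p : {mpoly K[m]}) : kill_x (embx p) = (p@_0%MM)%:MP.
Proof.
elim/mpoly_alg_ind: p => [c|i|p q hp hq|p q hp hq].
- by rewrite mpoly_embedC kill_xC mcoeffC eqxx mulr1.
- rewrite mpoly_embedX kill_xX0; last first.
    by rewrite notin_y_vars imset_f.
  by rewrite mcoeffX mnm1_eq0 mpolyC0.
- by rewrite !rmorphD /= hp hq.
- by rewrite !rmorphM /= hp hq.
Qed.

(** The preimage in Q of a pair (p, q) of polynomials with the same constant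
    term: Q maps onto the fiber product of R and S over K. *)
Definition glue (p : {mpoly K[m]}) (q : {mpoly K[n]}) : Q :=
  embx p + emby q - (p@_0%MM)%:MP.

Lemma kill_y_glue p q : p@_0%MM = q@_0%MM -> kill_y (glue p q) = p.
Proof.
move=> e; rewrite /glue rmorphB rmorphD /= (embedK kill_yC kill_yX).
by rewrite kill_y_emby kill_yC e addrK.
Qed.

Lemma kill_x_glue p q : p@_0%MM = q@_0%MM -> kill_x (glue p q) = q.
Proof.
move=> e; rewrite /glue rmorphB rmorphD /= (embedK kill_xC kill_xX).
by rewrite kill_x_embx kill_xC addrAC addrN add0r.
Qed.

Lemma zhomog_glue d p q : zhomog d p -> zhomog d q -> zhomog d (glue p q).
Proof.
move=> hp hq; apply: zhomogB; first by apply: zhomogD; apply: zhomog_embed.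
have [->|d0] := eqVneq d 0; first exact: zhomogC.
by rewrite (zhomog_coeff0 hp d0) mpolyC0; apply: zhomog0.
Qed.

Lemma in_var_ideal_pred J : ideal_pred (@in_var_ideal K m n J).
Proof. by split; [exact: in_var_ideal0|exact: in_var_ideal_closed]. Qed.

Lemma in_var_idealX (J : {set 'I_(m + n)}) i : i \in J -> @in_var_ideal K m n J 'X_i.
Proof.
move=> iJ; exists (fun k => (k == i)%:R); rewrite (bigD1 i) //= eqxx mul1r.
by rewrite big1 ?addr0 // => k /andP[_ /negPf ->]; rewrite mul0r.
Qed.

Lemma in_y_idealP (q : Q) : in_var_ideal (y_vars m n) q <-> kill_y q = 0.
Proof.
split=> [[c ->]|h].
  rewrite rmorph_sum big1 // => i iy /=; rewrite rmorphM /= kill_yX0 ?mulr0 //.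
  by rewrite notin_x_vars.
have := sub_embed_kill kill_yC kill_yX kill_yX0 q (in_var_ideal_pred (y_vars m n)).
rewrite /= h rmorph0 subr0; apply=> l lx; apply: in_var_idealX.
by rewrite -notin_x_vars.
Qed.

Lemma in_x_idealP (q : Q) : in_var_ideal (x_vars m n) q <-> kill_x q = 0.
Proof.
split=> [[c ->]|h].
  rewrite rmorph_sum big1 // => i ix /=; rewrite rmorphM /= kill_xX0 ?mulr0 //.
  by rewrite notin_y_vars.
have := sub_embed_kill kill_xC kill_xX kill_xX0 q (in_var_ideal_pred (x_vars m n)).
rewrite /= h rmorph0 subr0; apply=> l lx; apply: in_var_idealX.
by rewrite -notin_y_vars.
Qed.

Local Notation Qxy1 := (lmod_pi (@x_cap_y_submod_closed K m n) 1).

Lemma Qxy_scaleE (q : Q) : q *: (Qxy1 : Qxy K m n) = lmod_pi (@x_cap_y_submod_closed K m n) q.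
Proof.
rewrite [LHS](lmod_quot_scaleE (@x_cap_y_submod_closed K m n)); congr lmod_pi.
exact: mulr1.
Qed.

Lemma ann_Qxy (q : Q) : ann (Qxy1 : Qxy K m n) q <-> kernel (@kill_y K m n) q /\ kernel (@kill_x K m n) q.
Proof.
rewrite /ann Qxy_scaleE -[0](lmod_piK (0 : Qxy K m n)).
have -> : lmod_pi (@x_cap_y_submod_closed K m n) (repr (0 : Qxy K m n)) =
          lmod_pi (@x_cap_y_submod_closed K m n) 0.
  by rewrite lmod_piK -(subrr (0 : Q)) lmod_piB subrr.
rewrite lmod_pi_eq subr0; split=> [/asboolP[hx hy]|[hy hx]].
  by split; [apply/in_y_idealP|apply/in_x_idealP].
by apply/asboolP; split; [apply/in_x_idealP|apply/in_y_idealP].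
Qed.

Lemma cyclic_Qxy : cyclic_graded (@Qxy_piece K m n) Qxy1.
Proof.
split.
- by move=> u; exists (repr u); rewrite Qxy_scaleE lmod_piK.
- by move=> d u [p hp ->]; exists p; rewrite // Qxy_scaleE.
- move=> d q /ann_Qxy[qy qx]; apply/ann_Qxy; split; rewrite /kernel.
    by rewrite (zcomp_kill kill_yC kill_yX kill_yX0) qy linear0.
  by rewrite (zcomp_kill kill_xC kill_xX kill_xX0) qx linear0.
Qed.

Variables (a : hideal K m) (b : hideal K n) (tA : galg a) (tB : galg b).
Local Notation CS := (connected_sum tA tB).
Local Notation Cpi := (lmod_pi (thom_ideal_submod_closed tA tB)).

Definition kernelA : Q -> Prop := act_kernel (@kill_y K m n) a.
Definition kernelB : Q -> Prop := act_kernel (@kill_x K m n) b.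

Lemma CS_scaleE (q : Q) (z : fiber_product a b) : q *: (Cpi z : CS) = Cpi (q *: z).
Proof. exact: (lmod_quot_scaleE (thom_ideal_submod_closed tA tB)). Qed.

Lemma fp_scale1 (q : Q) :
  fp_val (q *: 1 : fiber_product a b) = (galg_pi a (kill_y q) : modA n a, galg_pi b (kill_x q) : modB m b).
Proof.
have -> : fp_val (q *: 1 : fiber_product a b) = q *: 1.
  by rewrite -[fp_val _]/(val _) linearZ rmorph1.
by congr (_, _); apply: mulr1.
Qed.

Lemma fp_eq (z z' : fiber_product a b) : fp_val z = fp_val z' -> z = z'.
Proof. exact: val_inj. Qed.

Lemma fp_proj (z : fiber_product a b) :
  @galg_proj K m a (fp_val z).1 = @galg_proj K n b (fp_val z).2.
Proof. exact/eqP/fp_in. Qed.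

Lemma fp_glue (z : fiber_product a b) p q :
  (fp_val z).1 = galg_pi a p -> (fp_val z).2 = galg_pi b q ->
  glue p q *: 1 = z.
Proof.
move=> e1 e2; have := fp_proj z; rewrite e1 e2 !galg_projE => e.
apply: fp_eq; rewrite fp_scale1 kill_y_glue // kill_x_glue //.
by rewrite -e1 -e2; case: (fp_val z).
Qed.

Lemma CS_pi0 z : (Cpi z : CS) = 0 <-> z \in thom_ideal tA tB.
Proof.
have <- : (Cpi 0 : CS) = 0 by rewrite -(subrr (0 : fiber_product a b)) lmod_piB subrr.
by rewrite lmod_pi_eq subr0.
Qed.

Hypothesis absA : forall u : galg a, u * tA = galg_proj u *: tA.
Hypothesis absB : forall u : galg b, u * tB = galg_proj u *: tB.

(** By thom_absorb the ideal generated by (tA, tB) is the line it spans. *)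
Lemma ann_CS q : ann (Cpi 1 : CS) q <-> exists c : K,
  galg_pi a (kill_y q) = c *: tA /\ galg_pi b (kill_x q) = c *: tB.
Proof.
rewrite /ann CS_scaleE CS_pi0; split=> [/asboolP[c]|[c [cA cB]]].
  rewrite fp_scale1 => -[hA hB]; exists (@galg_proj K m a (fp_val c).1); split.
    by rewrite -absA.
  by rewrite fp_proj -absB.
apply/asboolP; exists (c%:MP *: 1); rewrite !fp_scale1 cA cB kill_yC kill_xC.
by [].
Qed.

Lemma cyclic_CS pA pB (e : nat) : zhomog e%:Z pA -> tA = galg_pi a pA ->
  zhomog e%:Z pB -> tB = galg_pi b pB ->
  cyclic_graded (@connected_sum_piece K m n a b tA tB) (Cpi 1).
Proof.
move=> hA eA hB eB; split.
- move=> u; rewrite -[u]lmod_piK; have [p ep] := galg_piP ((fp_val (repr u)).1 : galg a).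
  have [q eq] := galg_piP ((fp_val (repr u)).2 : galg b).
  by exists (glue p q); rewrite CS_scaleE (fp_glue ep eq).
- move=> d u [z [[p hp ep] [q hq eq]] ->]; exists (glue p q); first exact: zhomog_glue.
  by rewrite CS_scaleE (fp_glue ep eq).
- move=> d q /ann_CS[c [cA cB]]; apply/ann_CS.
  have [->|ne] := eqVneq d e%:Z.
    exists c; rewrite (zcomp_kill kill_yC kill_yX kill_yX0) (zcomp_kill kill_xC kill_xX kill_xX0).
    by split; rewrite ?eA ?eB; apply: galg_pi_zcomp; rewrite -?eA -?eB.
  exists 0; rewrite !scale0r (zcomp_kill kill_yC kill_yX kill_yX0) (zcomp_kill kill_xC kill_xX kill_xX0).
  rewrite eq_sym in ne; rewrite eA in cA; rewrite eB in cB.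
  by split; [apply: galg_pi_zcomp_neq hA ne cA|apply: galg_pi_zcomp_neq hB ne cB].
Qed.

End TwoSetsOfVariables.

(** * Betti numbers of the connected sum *)

Section DegreeZeroStrand.
Variables (K : fieldType) (N : nat) (I : {mpoly K[N]} -> Prop).
Hypothesis idI : ideal_pred I.

Lemma khom_dim_degree0 i :
  (forall q, zhomog 0 q -> I q -> q = 0) ->
  kd_rank I i 0 = #|[set T : {set 'I_N} | (#|T| == i) && (T :&: setT != set0)]| ->
  khom_dim I i 0 = (i == 0%N).
Proof.
move=> I0 kr0; have := chain_rank_homology idI i 0.
have /(kchain_dim0_strand idI)[-> _ _] : kchain_dim I i.+1 (0 - 1) = 0%N by apply: kchain_dim_neg.
rewrite addn0 kr0 (@kchain_dim_top _ _ _ idI 0 (mcoeff 0%MM)); first last.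
- by exists 1; [rewrite -mpolyC1; apply: zhomogC|rewrite mcoeff1 eqxx].
- move=> q hq; split=> [/(I0 q hq) ->|q0]; first exact: mcoeff0.
  by rewrite (zhomog0_const hq) q0 mpolyC0; exact: idI.1.
- by move=> c x y; rewrite mcoeffD mcoeffZ.
rewrite (cardsD1 set0) inE cards0 addnC eq_sym.
rewrite (_ : _ :\ set0 = [set T : {set 'I_N} | (#|T| == i) && (T :&: setT != set0)]); last first.
  by apply/setP => T; rewrite !inE setIT andbC.
by move/eqP; rewrite eqn_add2l => /eqP <-.
Qed.

End DegreeZeroStrand.

Lemma strand_arith (u u1 u2 r r1 r2 h h1 h2 s s1 s2 : nat) :
  u = (u1 + u2)%N -> u = (r + (h + s))%N -> u1 = (r1 + (h1 + s1))%N ->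
  u2 = (r2 + (h2 + s2))%N -> (r + h + s = (r1 + r2) + (h1 + h2) + (s1 + s2))%N.
Proof. lia. Qed.

Section BettiNumbers.
Variables (K : fieldType) (m n e : nat).
Variables (a : hideal K m) (b : hideal K n).
Variables (fA : {linear galg a -> K^o}) (fB : {linear galg b -> K^o}).
Variables (tA : galg a) (tB : galg b).
Hypothesis e_ge3 : (3 <= e)%N.
Hypotheses (agA : AG_algebra a e) (agB : AG_algebra b e).
Hypotheses (nolinA : no_linear_forms a) (nolinB : no_linear_forms b).
Hypotheses (orA : orientation e fA) (orB : orientation e fB).
Hypotheses (thA : thom_class e fA tA) (thB : thom_class e fB tB).

Local Notation N := (m + n)%N.
Local Notation Q := {mpoly K[m + n]}.
Local Notation IA := (@kernelA K m n a).
Local Notation IB := (@kernelB K m n b).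
Local Notation IR := (kernel (@kill_y K m n)).
Local Notation IS := (kernel (@kill_x K m n)).
Local Notation IP := (ann (lmod_pi (@x_cap_y_submod_closed K m n) 1 : Qxy K m n)).
Local Notation IC := (ann (lmod_pi (thom_ideal_submod_closed tA tB) 1 : connected_sum tA tB)).
Local Notation JA := [set lshift n k | k : 'I_m].
Local Notation JB := [set rshift m k | k : 'I_n].
Local Notation kyC := (@kill_yC K m n).
Local Notation kyX := (@kill_yX K m n).
Local Notation kyX0 := (@kill_yX0 K m n).
Local Notation kxC := (@kill_xC K m n).
Local Notation kxX := (@kill_xX K m n).
Local Notation kxX0 := (@kill_xX0 K m n).

Let iA : ideal_pred IA. Proof. exact: act_kernel_ideal. Qed.
Let iB : ideal_pred IB. Proof. exact: act_kernel_ideal. Qed.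
Let iR : ideal_pred IR. Proof. exact: kernel_ideal. Qed.
Let iS : ideal_pred IS. Proof. exact: kernel_ideal. Qed.
Let iP : ideal_pred IP. Proof. exact: ann_ideal. Qed.
Let iC : ideal_pred IC. Proof. exact: ann_ideal. Qed.

Let e_gt0 : (0 < e)%N. Proof. exact: leq_trans e_ge3. Qed.

Let absA := thom_absorb agA thA.
Let absB := thom_absorb agB thB.

Lemma kernelA_const q : zhomog 0 q -> IA q -> q = 0.
Proof.
move=> /zhomog0_const -> ; rewrite /kernelA /act_kernel /= kyC => /(congr1 (@galg_proj K m a)).
by rewrite galg_projE raddf0 mcoeffC eqxx mulr1 => ->; rewrite mpolyC0.
Qed.

Lemma kernelR_A q : IR q -> IA q.
Proof. by rewrite /kernel /kernelA /act_kernel => ->; rewrite rmorph0. Qed.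

Lemma kernelS_B q : IS q -> IB q.
Proof. by rewrite /kernel /kernelB /act_kernel => ->; rewrite rmorph0. Qed.

(** Every monomial of positive degree in Q contains an x or a y, and the part
    without y's lies in the ideal of the x's. *)
Lemma kernelRS_split d q : (0 < d)%R -> zhomog d q ->
  exists q1, [/\ zhomog d q1, IR q1 & IS (q - q1)].
Proof.
move=> d0 hq; have hk := zhomog_kill kyC kyX kyX0 hq.
exists (q - mpoly_embed (@lshift m n) (kill_y q)); split.
- by apply: zhomogB => //; apply: zhomog_embed.
- by rewrite /kernel rmorphB /= (embedK kyC kyX) subrr.
- rewrite subKr /kernel /= kill_x_embx (zhomog_coeff0 hk) ?mpolyC0 //.
  by rewrite gt_eqF.
Qed.

Lemma kernelAB_split d q : (0 < d)%R -> zhomog d q ->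
  exists q1, [/\ zhomog d q1, IA q1 & IB (q - q1)].
Proof.
move=> d0 hq; have [q1 [h1 h2 h3]] := kernelRS_split d0 hq.
by exists q1; split=> //; [apply: kernelR_A|apply: kernelS_B].
Qed.

Lemma kernelP_RS q : IP q <-> IR q /\ IS q.
Proof. exact: ann_Qxy. Qed.

(** The Thom classes live in degree e, so below it nothing is divided out. *)
Lemma kernelC_below d q : (d < e%:Z)%R -> zhomog d q -> (IC q <-> IA q /\ IB q).
Proof.
move=> de hq; have dne : d != e%:Z by rewrite lt_eqF.
have hA := zhomog_kill kyC kyX kyX0 hq.
have hB := zhomog_kill kxC kxX kxX0 hq.
split=> [/(ann_CS absA absB)[c [cA cB]]|[hIA hIB]]; last first.
  by apply/(ann_CS absA absB); exists 0; rewrite !scale0r.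
have c0 : c = 0.
  have := orient_other orA dne hA; have [_ ft] := thA.
  by rewrite [galg_pi a _]cA linearZ /= ft /GRing.scale /= mulr1.
by move: cA cB; rewrite c0 !scale0r.
Qed.

(** Dividing out (tA, tB) leaves in degree e the functional fA - fB. *)
Definition top_form (q : Q) : K :=
  (fA (galg_pi a (kill_y q)) : K) - (fB (galg_pi b (kill_x q)) : K).

Lemma kernelC_top q : zhomog e%:Z q -> (IC q <-> top_form q = 0).
Proof.
move=> hq.
have hA := zhomog_kill kyC kyX kyX0 hq.
have hB := zhomog_kill kxC kxX kxX0 hq.
have [_ ftA] := thA; have [_ ftB] := thB.
rewrite /top_form; split=> [/(ann_CS absA absB)[c [cA cB]]|/eqP].
  by rewrite [galg_pi a _]cA [galg_pi b _]cB !linearZ /= ftA ftB subrr.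
rewrite subr_eq0 => /eqP fAB; apply/(ann_CS absA absB).
exists (fA (galg_pi a (kill_y q))); split; first exact: (top_thom agA thA).
by rewrite fAB; apply: (top_thom agB thB).
Qed.

Lemma kernelA_top q : zhomog e%:Z q -> (IA q <-> (fA (galg_pi a (kill_y q)) : K) = 0).
Proof.
move=> hq; have hA := zhomog_kill kyC kyX kyX0 hq.
rewrite /kernelA /act_kernel; split=> [->|h]; first exact: linear0.
by rewrite [LHS](top_thom agA thA hA) /= h scale0r.
Qed.

Lemma kernelB_top q : zhomog e%:Z q -> (IB q <-> (fB (galg_pi b (kill_x q)) : K) = 0).
Proof.
move=> hq; have hB := zhomog_kill kxC kxX kxX0 hq.
rewrite /kernelB /act_kernel; split=> [->|h]; first exact: linear0.
by rewrite [LHS](top_thom agB thB hB) /= h scale0r.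
Qed.

Lemma kernelA_above d q : (e%:Z < d)%R -> zhomog d q -> IA q.
Proof.
move=> de hq; apply: (galg_above agA de).
exact: (zhomog_kill kyC kyX kyX0 hq).
Qed.

Lemma kernelB_above d q : (e%:Z < d)%R -> zhomog d q -> IB q.
Proof.
move=> de hq; apply: (galg_above agB de).
exact: (zhomog_kill kxC kxX kxX0 hq).
Qed.

Lemma kernelC_above d q : (e%:Z < d)%R -> zhomog d q -> IC q.
Proof.
move=> de hq; apply/(ann_CS absA absB); exists 0; rewrite !scale0r.
by split; [exact: kernelA_above de hq|exact: kernelB_above de hq].
Qed.

Definition meeting (J : {set 'I_N}) t : nat :=
  #|[set T : {set 'I_N} | (#|T| == t) && (T :&: J != set0)]|.

Definition missing (J : {set 'I_N}) t : nat :=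
  #|[set T : {set 'I_N} | (#|T| == t) && ~~ (J \subset T)]|.

Lemma missingE J t : (t <= N)%N -> missing J t = meeting J (N - t)%N.
Proof. exact: card_not_sub_compl. Qed.

Lemma kd_rankA0 i : kd_rank IA i 0 = meeting JA i.
Proof.
apply: kd_rank_degree0 => // [c|l].
  exact: (act_kernel_linear_form kyC kyX kyX0 nolinA).
by rewrite /kernelA /act_kernel /= => /kyX0 ->; rewrite rmorph0.
Qed.

Lemma kd_rankB0 i : kd_rank IB i 0 = meeting JB i.
Proof.
apply: kd_rank_degree0 => // [c|l].
  exact: (act_kernel_linear_form kxC kxX kxX0 nolinB).
by rewrite /kernelB /act_kernel /= => /kxX0 ->; rewrite rmorph0.
Qed.

Lemma kd_rankR0 i : kd_rank IR i 0 = meeting JA i.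
Proof.
apply: kd_rank_degree0 => // [c|l]; last exact: kyX0.
exact: (kill_linear_form kyC kyX kyX0).
Qed.

Lemma kd_rankS0 i : kd_rank IS i 0 = meeting JB i.
Proof.
apply: kd_rank_degree0 => // [c|l]; last exact: kxX0.
exact: (kill_linear_form kxC kxX kxX0).
Qed.

(** A linear form that lies in both ideals has no x-part by the first and no
    y-part by the second. *)
Lemma linear_form_split (I1 I2 : Q -> Prop) (c : 'I_N -> K) :
  ideal_pred I1 -> ideal_pred I2 ->
  (forall l, l \notin JA -> I1 'X_l) -> (forall l, l \notin JB -> I2 'X_l) ->
  (forall c, I1 (\sum_(k in JA) c k *: 'X_k) -> forall k, k \in JA -> c k = 0) ->
  (forall c, I2 (\sum_(k in JB) c k *: 'X_k) -> forall k, k \in JB -> c k = 0) ->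
  I1 (\sum_(k in [set: 'I_N]) c k *: 'X_k) -> I2 (\sum_(k in [set: 'I_N]) c k *: 'X_k) ->
  forall k, k \in [set: 'I_N] -> c k = 0.
Proof.
move=> id1 id2 X1 X2 L1 L2 h1 h2 k _.
have restr (J : {set 'I_N}) (I : Q -> Prop) : ideal_pred I ->
    (forall l, l \notin J -> I 'X_l) -> I (\sum_(k in [set: 'I_N]) c k *: 'X_k) ->
    I (\sum_(k in J) c k *: 'X_k).
  move=> idI XI; rewrite (bigID (fun k => k \in J)) /= => h.
  apply/(ideal_pred_eq idI _).1: h; rewrite addrC.
  rewrite [X in _ + X - _](eq_bigl (fun k => k \in J)); last by move=> l; rewrite inE.
  rewrite addrK; apply: ideal_pred_sum => // l /andP[_ lJ].
  by apply: ideal_predZ => //; apply: XI.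
have [kA|] := boolP (k \in JA); first by apply: L1 kA; apply: restr.
by rewrite notin_x_vars => kB; apply: L2 kB; apply: restr.
Qed.

Lemma kd_rankP0 i : kd_rank IP i 0 = meeting setT i.
Proof.
apply: kd_rank_degree0 => // [c /kernelP_RS[hR hS]|l]; last by rewrite inE.
apply: (linear_form_split iR iS) hR hS => [l|l|c'|c'].
- exact: kyX0.
- exact: kxX0.
- exact: (kill_linear_form kyC kyX kyX0).
- exact: (kill_linear_form kxC kxX kxX0).
Qed.

Lemma kd_rankC0 i : kd_rank IC i 0 = meeting setT i.
Proof.
apply: kd_rank_degree0 => // [c h|l]; last by rewrite inE.
have hl : zhomog 1 (\sum_(k in [set: 'I_N]) c k *: 'X_k : Q).
  by apply: zhomog_sum => k _; apply/zhomogZ/zhomogX.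
have /(kernelC_below _ hl)[] := h; first by rewrite ltz_nat (leq_trans _ e_ge3).
apply: (linear_form_split iA iB) => [l|l|c'|c'].
- by rewrite /kernelA /act_kernel /= => /kyX0 ->; rewrite rmorph0.
- by rewrite /kernelB /act_kernel /= => /kxX0 ->; rewrite rmorph0.
- exact: (act_kernel_linear_form kyC kyX kyX0 nolinA).
- exact: (act_kernel_linear_form kxC kxX kxX0 nolinB).
Qed.

Lemma kd_rankA_top i : kd_rank IA i.+1 (e%:Z - 1) = missing JA i.
Proof.
apply: (kd_rank_top iA (phi := fun q => (fA (galg_pi a (kill_y q)) : K))) => [c x y|q|k w kJ _|k].
- rewrite rmorphD rmorphD linearD /= kill_mpolyZ; last exact: kyC.
  by rewrite galg_piZ linearZ.
- exact: kernelA_top.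
- by rewrite rmorphM /= (kyX0 kJ) mul0r rmorph0 linear0.
- case/imsetP => k' _ ->; have [w hw wk] := dual_forms agA orA thA nolinA e_gt0 k'.
  exists (mpoly_embed (@lshift m n) w) => [|l]; first exact: zhomog_embed.
  rewrite rmorphM /= (embedK kyC kyX).
  have [/imsetP[l' _ ->]|lJ] := boolP (l \in JA).
    by rewrite kyX wk eq_lshift.
  rewrite (kyX0 lJ) mul0r rmorph0 linear0.
  by case: eqVneq lJ => [->|//]; rewrite imset_f.
Qed.

Lemma kd_rankB_top i : kd_rank IB i.+1 (e%:Z - 1) = missing JB i.
Proof.
apply: (kd_rank_top iB (phi := fun q => (fB (galg_pi b (kill_x q)) : K))) => [c x y|q|k w kJ _|k].
- rewrite rmorphD rmorphD linearD /= kill_mpolyZ; last exact: kxC.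
  by rewrite galg_piZ linearZ.
- exact: kernelB_top.
- by rewrite rmorphM /= (kxX0 kJ) mul0r rmorph0 linear0.
- case/imsetP => k' _ ->; have [w hw wk] := dual_forms agB orB thB nolinB e_gt0 k'.
  exists (mpoly_embed (@rshift m n) w) => [|l]; first exact: zhomog_embed.
  rewrite rmorphM /= (embedK kxC kxX).
  have [/imsetP[l' _ ->]|lJ] := boolP (l \in JB).
    by rewrite kxX wk eq_rshift.
  rewrite (kxX0 lJ) mul0r rmorph0 linear0.
  by case: eqVneq lJ => [->|//]; rewrite imset_f.
Qed.

Lemma top_formP c x y : top_form (c *: x + y) = c * top_form x + top_form y.
Proof.
rewrite /top_form !rmorphD !linearD /= !kill_mpolyZ; try exact: kyC; try exact: kxC.
by rewrite !galg_piZ !linearZ /= /GRing.scale /= mulrBr opprD addrACA.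
Qed.

(** The dual forms of A and of B, the latter with the sign of fB in top_form,
    serve for C: a form of positive degree in the y's vanishes in A, and
    e - 1 > 0. *)
Lemma kd_rankC_top i : kd_rank IC i.+1 (e%:Z - 1) = missing setT i.
Proof.
have e1 : e%:Z - 1 != 0 by lia.
apply: (kd_rank_top iC top_formP) => [q|k w|k _]; [exact: kernelC_top|by rewrite inE|].
have [k'|k'] := split_ordP k => ->.
  have [w hw wk] := dual_forms agA orA thA nolinA e_gt0 k'.
  exists (mpoly_embed (@lshift m n) w) => [|l]; first exact: zhomog_embed.
  rewrite /top_form !rmorphM /= (embedK kyC kyX).
  rewrite [kill_x (mpoly_embed _ _)]kill_x_embx (zhomog_coeff0 hw e1) mpolyC0.
  rewrite rmorph0 mulr0 linear0 subr0.
  have [l'|l'] := split_ordP l => ->; first by rewrite kyX -rmorphM /= wk eq_lshift.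
  rewrite kyX0; last by rewrite notin_x_vars imset_f.
  by rewrite rmorph0 mul0r linear0 eq_rlshift.
have [w hw wk] := dual_forms agB orB thB nolinB e_gt0 k'.
exists (- mpoly_embed (@rshift m n) w) => [|l]; first exact/zhomogN/zhomog_embed.
rewrite /top_form mulrN !rmorphN !linearN /= opprK !rmorphM /= (embedK kxC kxX).
rewrite [kill_y (mpoly_embed _ _)]kill_y_emby (zhomog_coeff0 hw e1) mpolyC0.
rewrite rmorph0 mulr0 linear0 oppr0 add0r.
have [l'|l'] := split_ordP l => ->; last by rewrite kxX -rmorphM /= wk eq_rshift.
rewrite kxX0; last by rewrite notin_y_vars imset_f.
by rewrite rmorph0 mul0r linear0 eq_lrshift.
Qed.

Lemma kchain_dimC_top i : kchain_dim IC i e%:Z = #|[set T : {set 'I_N} | #|T| == i]|.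
Proof.
apply: (kchain_dim_top iC top_formP kernelC_top).
have [pA hA tE] := thom_lift thA; have [_ ft] := thA.
exists (mpoly_embed (@lshift m n) pA); first exact: zhomog_embed.
rewrite /top_form (embedK kyC kyX) -tE ft kill_x_embx (zhomog_coeff0 hA).
  by rewrite mpolyC0 rmorph0 linear0 subr0.
by lia.
Qed.

Lemma meeting_large J t : (N < t)%N -> meeting J t = 0%N.
Proof.
move=> Nt; apply: eq_card0 => T; rewrite !inE; apply/negP => /andP[/eqP Tt _].
by have := max_card T; rewrite card_ord Tt leqNgt Nt.
Qed.

Lemma khom_dim_neg (I : Q -> Prop) i d : ideal_pred I -> (d < 0)%R -> khom_dim I i d = 0%N.
Proof. by move=> idI d0; have [] := kchain_dim0_strand idI (kchain_dim_neg idI i d0). Qed.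

Lemma khom_dim_large (I : Q -> Prop) i d : ideal_pred I -> (N < i)%N -> khom_dim I i d = 0%N.
Proof. by move=> idI iN; have [] := kchain_dim0_strand idI (kchain_dim_large idI d iN). Qed.

Lemma khom_dim_full (I : Q -> Prop) i d : ideal_pred I ->
  (forall q, zhomog d q -> I q) -> khom_dim I i d = 0%N.
Proof. by move=> idI h; have [] := kchain_dim0_strand idI (kchain_dim_full idI i h). Qed.

(** In the strand d = 1 the polynomial rings R and S have no homology, so the
    homology of P measures how far the rank out of degree 0 is from being
    additive. *)
Lemma khom_dimP_linear i : (khom_dim IP i 1 + meeting setT i.+1 = meeting JA i.+1 + meeting JB i.+1)%N.
Proof.
have uP := kchain_dim_split iR iS iP (fun q => @kernelRS_split 1 q ltr01) i (fun q _ => kernelP_RS q).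
have rP := kd_rank_split iR iS iP (fun q => @kernelRS_split 1 q ltr01) i (fun q _ => kernelP_RS q).
have eP := chain_rank_homology iP i 1; have eR := chain_rank_homology iR i 1; have eS := chain_rank_homology iS i 1.
rewrite subrr kd_rankP0 in eP; rewrite subrr kd_rankR0 in eR; rewrite subrr kd_rankS0 in eS.
have hR : khom_dim IR i 1 = 0%N by apply: (khom_dim_kernel kyC kyX kyX0).
have hS : khom_dim IS i 1 = 0%N by apply: (khom_dim_kernel kxC kxX kxX0).
have := strand_arith uP eP eR eS; rewrite rP hR hS !addn0 -addnA; exact: addnI.
Qed.

Lemma khom_dimP_high i d : (1 < d)%R -> khom_dim IP i d = 0%N.
Proof.
move=> d1; have d0 : (0 < d)%R by lia.
have d10 : (0 < d - 1)%R by lia.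
have uP := kchain_dim_split iR iS iP (@kernelRS_split d ^~ d0) i (fun q _ => kernelP_RS q).
have rP := kd_rank_split iR iS iP (@kernelRS_split d ^~ d0) i (fun q _ => kernelP_RS q).
have rP' := kd_rank_split iR iS iP (@kernelRS_split (d - 1) ^~ d10) i.+1 (fun q _ => kernelP_RS q).
have eP := chain_rank_homology iP i d; have eR := chain_rank_homology iR i d; have eS := chain_rank_homology iS i d.
have hR : khom_dim IR i d = 0%N by apply: (khom_dim_kernel kyC kyX kyX0).
have hS : khom_dim IS i d = 0%N by apply: (khom_dim_kernel kxC kxX kxX0).
by have := strand_arith uP eP eR eS; rewrite rP rP' hR hS => /addIn/addnI.
Qed.

Lemma khom_dimP_zero i : khom_dim IP i 0 = (i == 0%N).
Proof.
apply: khom_dim_degree0 => // [q hq /kernelP_RS[/kernelR_A hA _]|]; last exact: kd_rankP0.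
exact: kernelA_const.
Qed.

Lemma khom_dimC_zero i : khom_dim IC i 0 = (i == 0%N).
Proof.
apply: khom_dim_degree0 => // [q hq|]; last exact: kd_rankC0.
by case/(kernelC_below _ hq) => [|hA _]; [lia|exact: kernelA_const].
Qed.

(** The ranks out of degree 0 of C, A, B equal those of P, R, S, as they depend
    on the set of acting variables only. *)
Lemma khom_dimC_linear i : khom_dim IC i 1 = (khom_dim IA i 1 + khom_dim IB i 1 + khom_dim IP i 1)%N.
Proof.
have uC : kchain_dim IC i 1 = (kchain_dim IA i 1 + kchain_dim IB i 1)%N.
  apply: kchain_dim_split => // [q|q hq]; first exact: kernelAB_split.
  by apply: (kernelC_below _ hq); lia.
have rC : kd_rank IC i 1 = (kd_rank IA i 1 + kd_rank IB i 1)%N.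
  apply: kd_rank_split => // [q|q hq]; first exact: kernelAB_split.
  by apply: (kernelC_below _ hq); lia.
have eC := chain_rank_homology iC i 1; have eA := chain_rank_homology iA i 1; have eB := chain_rank_homology iB i 1.
rewrite subrr kd_rankC0 in eC; rewrite subrr kd_rankA0 in eA; rewrite subrr kd_rankB0 in eB.
have := khom_dimP_linear i; lia.
Qed.

Lemma khom_dimC_middle i d : (1 < d)%R -> (d <= e%:Z - 2)%R ->
  khom_dim IC i d = (khom_dim IA i d + khom_dim IB i d)%N.
Proof.
move=> d1 de.
have uC : kchain_dim IC i d = (kchain_dim IA i d + kchain_dim IB i d)%N.
  apply: kchain_dim_split => // [q|q hq]; first by apply: kernelAB_split; lia.
  by apply: (kernelC_below _ hq); lia.
have rC : kd_rank IC i d = (kd_rank IA i d + kd_rank IB i d)%N.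
  apply: kd_rank_split => // [q|q hq]; first by apply: kernelAB_split; lia.
  by apply: (kernelC_below _ hq); lia.
have rC' : kd_rank IC i.+1 (d - 1) = (kd_rank IA i.+1 (d - 1)%R + kd_rank IB i.+1 (d - 1)%R)%N.
  apply: kd_rank_split => // [q|q hq]; first by apply: kernelAB_split; lia.
  by apply: (kernelC_below _ hq); lia.
have eC := chain_rank_homology iC i d; have eA := chain_rank_homology iA i d; have eB := chain_rank_homology iB i d.
by have := strand_arith uC eC eA eB; rewrite rC rC' => /addIn/addnI.
Qed.

(** The rank into degree e counts sets not containing J; complements turn these
    into the sets counted by the rank out of degree 0 at N - i. *)
Lemma khom_dimC_subtop i : khom_dim IC i (e%:Z - 1) =
  (khom_dim IA i (e%:Z - 1)%R + khom_dim IB i (e%:Z - 1)%R +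
   if (i <= N)%N then khom_dim IP (N - i) 1 else 0)%N.
Proof.
set d := e%:Z - 1.
have uC : kchain_dim IC i d = (kchain_dim IA i d + kchain_dim IB i d)%N.
  apply: kchain_dim_split => // [q|q hq]; first by apply: kernelAB_split; rewrite /d; lia.
  by apply: (kernelC_below _ hq); rewrite /d; lia.
have rC' : kd_rank IC i.+1 (d - 1) = (kd_rank IA i.+1 (d - 1)%R + kd_rank IB i.+1 (d - 1)%R)%N.
  apply: kd_rank_split => // [q|q hq]; first by apply: kernelAB_split; rewrite /d; lia.
  by apply: (kernelC_below _ hq); rewrite /d; lia.
have eC := chain_rank_homology iC i d; have eA := chain_rank_homology iA i d; have eB := chain_rank_homology iB i d.
case: leqP => [iN|Ni]; last by rewrite !khom_dim_large.
have := khom_dimP_linear (N - i)%N.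
case: i iN uC rC' eC eA eB => [|i] iN uC rC' eC eA eB.
  rewrite !meeting_large ?subn0 // => hP.
  rewrite uC rC' eA eB !kd_rank_source0 // in eC.
  by rewrite addn0 in hP; rewrite hP; lia.
have iN' : (i <= N)%N := ltnW iN.
rewrite uC rC' eA eB in eC.
rewrite -subSn // subSS -!missingE //.
rewrite -[missing setT i]kd_rankC_top -[missing JA i]kd_rankA_top -[missing JB i]kd_rankB_top -/d.
lia.
Qed.

(** Only the set of all variables is not reached by a boundary. *)
Lemma khom_dimC_top i : khom_dim IC i e%:Z = (i == N).
Proof.
have eC := chain_rank_homology iC i e%:Z.
rewrite kd_rankC_top kchain_dimC_top (kd_rank_full iC) ?add0n in eC; last first.
  by move=> q hq; apply: kernelC_above hq; lia.
apply/eqP; rewrite -(eqn_add2r (missing setT i)) -eC /missing.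
rewrite (cardsD1 setT [set T : {set 'I_N} | #|T| == i]) inE cardsT card_ord [N == i]eq_sym eqn_add2l; apply/eqP.
apply: eq_card => T; rewrite !inE subTset; exact: andbC.
Qed.

Lemma khom_dimC_above i d : (e%:Z < d)%R -> khom_dim IC i d = 0%N.
Proof. by move=> de; apply: khom_dim_full => // q; apply: kernelC_above. Qed.

Lemma khom_dimA_above i d : (e%:Z < d)%R -> khom_dim IA i d = 0%N.
Proof. by move=> de; apply: khom_dim_full => // q; apply: kernelA_above. Qed.

Lemma khom_dimB_above i d : (e%:Z < d)%R -> khom_dim IB i d = 0%N.
Proof. by move=> de; apply: khom_dim_full => // q; apply: kernelB_above. Qed.

Theorem khom_dim_connected_sum i d :
  (khom_dim IC i d + (if d == e%:Z then khom_dim IA i d + khom_dim IB i d else 0) =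
   (if (0 < d)%R then khom_dim IA i d + khom_dim IB i d else 0) + khom_dim IP i d +
   (if i <= N then khom_dim IP (N - i) (e%:Z - d)%R else 0))%N.
Proof.
have [d0|d0|->] := ltrgtP d 0.
- rewrite (khom_dim_neg i iC d0) (khom_dim_neg i iP d0) ifF; last lia.
  by rewrite khom_dimP_high ?if_same //; lia.
- have [de|de|->] := ltrgtP d e%:Z; last first.
  + rewrite khom_dimC_top subrr khom_dimP_zero khom_dimP_high; last lia.
    by case: leqP => h; lia.
  + rewrite (khom_dimC_above _ de) (khom_dimA_above _ de) (khom_dimB_above _ de) khom_dimP_high; last lia.
    by rewrite (khom_dim_neg _ iP) ?if_same //; lia.
  + have [d1|d1] := eqVneq d 1.
      rewrite d1 khom_dimC_linear (khom_dimP_high (N - i)%N); last lia.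
      by rewrite if_same !addn0.
    have [d2|d2] := eqVneq d (e%:Z - 1).
      rewrite d2 khom_dimC_subtop (khom_dimP_high i); last lia.
      by rewrite !addn0 subKr.
    rewrite khom_dimC_middle; try lia.
    by rewrite !khom_dimP_high ?if_same ?addn0 //; lia.
- rewrite khom_dimC_zero khom_dimP_zero subr0 khom_dimP_high; last lia.
  by rewrite if_same ifF ?addn0 //; lia.
Qed.

End BettiNumbers.

(** * From dimensions to isomorphisms *)

Section VectorSpaces.
Import VectorInternalTheory.
Variable K : fieldType.

Lemma castmx_row_linear p q (e : p = q) c (u v : 'rV[K]_p) :
  castmx (erefl 1%N, e) (c *: u + v) =
  c *: castmx (erefl 1%N, e) u + castmx (erefl 1%N, e) v.
Proof. by case: q / e; rewrite !castmx_id. Qed.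

Lemma vect_iso_dim (V W : vectType K) : \dim {:V} = \dim {:W} -> vect_iso V W.
Proof.
rewrite !dimvf => e.
pose f (v : V) : W := r2v (castmx (erefl 1%N, e) (v2r v)).
have fL : linear f.
  move=> c u v; rewrite /f linearP.
  by rewrite /= castmx_row_linear linearP.
pose fLM := GRing.isLinear.Build _ _ _ _ f fL.
pose fl : {linear V -> W} := HB.pack f fLM.
exists fl; exists (fun w => r2v (castmx (esym (erefl 1%N), esym e) (v2r w))) => v.
  by rewrite -[fl v]/(f v) /f r2vK castmxK v2rK.
by rewrite -[fl _]/(f _) /f r2vK castmxKV v2rK.
Qed.

Lemma dim_pair (V W : vectType K) :
  \dim {: (V * W)%type} = (\dim {:V} + \dim {:W})%N.
Proof. by rewrite !dimvf. Qed.

Lemma dim_regular : \dim {: K^o} = 1%N.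
Proof. by rewrite dimvf. Qed.

Lemma dim_row0 : \dim {: 'rV[K]_0} = 0%N.
Proof. by rewrite dimvf dim_matrix. Qed.

End VectorSpaces.

Theorem theorem3p7 (K : fieldType) (m n e : nat)
    (a : hideal K m) (b : hideal K n)
    (fA : {linear galg a -> K^o}) (fB : {linear galg b -> K^o})
    (tA : galg a) (tB : galg b)
    (FA : free_resolution (@modA_piece K m n a))
    (FB : free_resolution (@modB_piece K m n b))
    (FP : free_resolution (@Qxy_piece K m n))
    (FC : free_resolution (@connected_sum_piece K m n a b tA tB)) :
  (3 <= e)%N ->
  AG_algebra a e -> AG_algebra b e ->
  no_linear_forms a -> no_linear_forms b ->
  orientation e fA -> orientation e fB ->
  thom_class e fA tA -> thom_class e fB tB ->
  (forall (i : nat) (j : int), (1 <= i)%N ->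
     (j <= i%:Z -> (i%:Z, j) <> (0, 0) -> vect_iso (Tor FC i j) 'rV[K]_0) /\
     ((i%:Z, j) = (0, 0) -> vect_iso (Tor FC i j) K^o) /\
     (j = i%:Z + 1 ->
        vect_iso (Tor FC i j)
          (Tor FA i (i%:Z + 1) * Tor FB i (i%:Z + 1) * Tor FP i (i%:Z + 1))%type) /\
     (i%:Z + 2 <= j <= i%:Z + e%:Z - 2 ->
        vect_iso (Tor FC i j) (Tor FA i j * Tor FB i j)%type) /\
     (j = i%:Z + e%:Z - 1 ->
        vect_iso (Tor FC i j)
          (Tor FA i j * Tor FB i j *
           Tor FP (m%:Z + n%:Z - i%:Z) (m%:Z + n%:Z - i%:Z + 1))%type) /\
     ((i%:Z, j) = (m%:Z + n%:Z, e%:Z + m%:Z + n%:Z) ->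
        vect_iso (Tor FC i j) K^o) /\
     (e%:Z + i%:Z <= j -> (i%:Z, j) <> (m%:Z + n%:Z, e%:Z + m%:Z + n%:Z) ->
        vect_iso (Tor FC i j) 'rV[K]_0)) /\
  (forall i j : int,
     (poincare FC i j + (poincare_line FA e i j + poincare_line FB e i j) =
      poincare_gt FA i j + poincare_gt FB i j + poincare FP i j +
      poincare FP (m%:Z + n%:Z - i)%R (m%:Z + n%:Z + e%:Z - j)%R)%N).
Proof.
move=> e3 agA agB nolA nolB orA orB thA thB.
have [pA hpA tAE] := thom_lift thA; have [pB hpB tBE] := thom_lift thB.
have absA := thom_absorb agA thA; have absB := thom_absorb agB thB.
have cycA : cyclic_graded (@modA_piece K m n a) 1.
  exact: (cyclic_restr (act := @actA K m n a) (@kill_yC K m n) (@kill_yX K m n) (@kill_yX0 K m n) (fun=> erefl)).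
have cycB : cyclic_graded (@modB_piece K m n b) 1.
  exact: (cyclic_restr (act := @actB K m n b) (@kill_xC K m n) (@kill_xX K m n) (@kill_xX0 K m n) (fun=> erefl)).
have cycC := cyclic_CS absA absB hpA tAE hpB tBE.
have annA : ann (1 : modA n a) = @kernelA K m n a.
  by apply/funext => q; apply/propext; apply: ann_restr.
have annB : ann (1 : modB m b) = @kernelB K m n b.
  by apply/funext => q; apply/propext; apply: ann_restr.
have torA (i : nat) j : poincare FA i j = khom_dim (@kernelA K m n a) i (j - i%:Z).
  by rewrite (poincare_kh FA i j cycA) annA.
have torB (i : nat) j : poincare FB i j = khom_dim (@kernelB K m n b) i (j - i%:Z).
  by rewrite (poincare_kh FB i j cycB) annB.
have torC (i : nat) j := poincare_kh FC i j cycC.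
have torP (i : nat) j := poincare_kh FP i j (@cyclic_Qxy K m n).
have iP : ideal_pred (ann (lmod_pi (@x_cap_y_submod_closed K m n) 1 : Qxy K m n)).
  exact: ann_ideal.
have iC : ideal_pred (ann (lmod_pi (thom_ideal_submod_closed tA tB) 1 : connected_sum tA tB)).
  exact: ann_ideal.
have torN (M : lmodType {mpoly K[m + n]}) piece (F : @free_resolution K (m + n) M piece) i j :
    (i < 0)%R -> poincare F i j = 0%N.
  by case: i => // i _; apply: dim_row0.
have torD (i : nat) j : poincare FP (m%:Z + n%:Z - i%:Z) (m%:Z + n%:Z + j - i%:Z) =
    if (i <= m + n)%N then khom_dim (ann (lmod_pi (@x_cap_y_submod_closed K m n) 1 : Qxy K m n)) (m + n - i)%N j else 0%N.
  case: leqP => iN; last by apply: torN; lia.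
  have -> : m%:Z + n%:Z - i%:Z = (m + n - i)%N%:Z by lia.
  by rewrite torP; congr khom_dim; lia.
split.
  move=> i j i1; split; [|split; [|split; [|split; [|split; [|split]]]]].
  - move=> ji _; apply: vect_iso_dim; rewrite dim_row0 -/(poincare FC i j) torC.
    have [d0|d0|->] := ltrgtP (j - i%:Z) 0; last 2 first.
    + lia.
    + by rewrite (khom_dimC_zero e3 agA agB nolA nolB orA thA thB) gtn_eqF.
    exact: khom_dim_neg.
  - by case=> i0; lia.
  - move=> ->; apply: vect_iso_dim; rewrite !dim_pair.
    rewrite -/(poincare FC i _) -/(poincare FA i _) -/(poincare FB i _) -/(poincare FP i _).
    rewrite torA torB torC torP addrAC subrr add0r.
    exact: (khom_dimC_linear e3 agA agB nolA nolB orA thA thB).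
  - move=> jb; apply: vect_iso_dim; rewrite dim_pair.
    rewrite -/(poincare FC i _) -/(poincare FA i _) -/(poincare FB i _) torA torB torC.
    by apply: (khom_dimC_middle e3 agA agB orA thA thB); lia.
  - move=> je; apply: vect_iso_dim; rewrite !dim_pair.
    rewrite -/(poincare FC i _) -/(poincare FA i _) -/(poincare FB i _) -/(poincare FP _ _) torA torB torC.
    have -> : m%:Z + n%:Z - i%:Z + 1 = m%:Z + n%:Z + 1 - i%:Z by lia.
    have -> : j - i%:Z = e%:Z - 1 by lia.
    by rewrite torD (khom_dimC_subtop e3 agA agB nolA nolB orA orB thA thB).
  - case=> iE jE; apply: vect_iso_dim; rewrite dim_regular -/(poincare FC i _) torC.
    have -> : j - i%:Z = e%:Z by lia.
    rewrite (khom_dimC_top e3 agA agB nolA nolB orA orB thA thB).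
    have -> : i = (m + n)%N by lia.
    by rewrite eqxx.
  - move=> je ne; apply: vect_iso_dim; rewrite dim_row0 -/(poincare FC i _) torC.
    have [d0|d0|de] := ltrgtP (j - i%:Z) e%:Z; first lia.
      exact: (khom_dimC_above agA agB thA thB).
    rewrite de (khom_dimC_top e3 agA agB nolA nolB orA orB thA thB); case: eqP => // iN.
    by case: ne; congr (_, _); lia.
move=> i j; rewrite /poincare_line /poincare_gt.
case: i => [i|i]; last first.
  rewrite !(torN _ _ _ (Negz i)) // !if_same !addn0 !add0n.
  have -> : m%:Z + n%:Z - Negz i = (m + n + i.+1)%N%:Z by lia.
  by rewrite torP khom_dim_large //; lia.
have := khom_dim_connected_sum e3 agA agB nolA nolB orA orB thA thB i (j - i%:Z).
rewrite -torA -torB -torC -torP -torD.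
have -> : m%:Z + n%:Z + (e%:Z - (j - i%:Z)) - i%:Z = m%:Z + n%:Z + e%:Z - j by lia.
have -> : (j - i%:Z == e%:Z) = (j == i%:Z + e%:Z) by lia.
have -> : (0 < j - i%:Z) = (i%:Z < j) by lia.
by case: (j == _); case: (_ < _)%R.
Qed.
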